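(* Let $n=-2\widetilde{n}=-2p_1\cdots p_t$ with primes $p_i\neq 2,3$. Then the Monsky matrix of $E_n$ is $$M_n=B_2=\begin{pmatrix} 1 & 0 & 0 & 0 & 0 & 0 & O & O\\ 0 & 0 & 0 & 1 & 1+[\frac{-1}{\widetilde{n}}] & 1 & O & r_{-1}\\ 0 & 1 & 0 & 0 & [\frac{2}{\widetilde{n}}] & 1 & O & r_{2}\\ 1 & 1 & 0 & 0 & 0 & 1+[\frac{-3}{\widetilde{n}}] & r_{-3} & O\\ 0 & 0 & 1 & 0 & 0 & 0 & O & O\\ O & O & O & r_{-1}^T & r_{2}^T & r_{3}^T & D_{-3} & A+D_{-2}\\ r_{-1}^T & r_{2}^T & r_{3}^T & O & O & O & A+D_{2} & O \end{pmatrix}.$$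
   Context: Let $n$ be a nonzero squarefree integer and $E_n: y^2=x(x+3n)(x-n)$ (the curve attached to $\pi/3$-congruent numbers, twisted by $n$). Write $\widetilde{n}=|n/\gcd(6,n)|=p_1\cdots p_t$ with primes $p_i\neq 2,3$. Every element of $\mathrm{Sel}_2(E_n)$ is represented by a pair $(b_1,b_2)$ with $b_1=(-1)^{\gamma_1}2^{\gamma_2}3^{\gamma_3}\prod_i p_i^{x_i}$, $b_2=(-1)^{\xi_1}2^{\xi_2}3^{\xi_3}\prod_i p_i^{y_i}$, exponents in $\{0,1\}$, encoded by $v^T=(\xi_1,\xi_2,\xi_3,\gamma_1,\gamma_2,\gamma_3,y_1,\dots,y_t,x_1,\dots,x_t)\in\mathbb{F}_2^{2t+6}$. A Monsky matrix of $E_n$ is a matrix $M_n$ over $\mathbb{F}_2$ such that this encoding is a bijection between $\mathrm{Sel}_2(E_n)$ and $\{v: M_nv=0\}$. $[\frac{a}{p}]=\frac12(1-(\frac{a}{p}))\in\mathbb{F}_2$ is the additive Legendre symbol, $[\frac{a}{\widetilde n}]=\sum_i[\frac{a}{p_i}]$. For $d$ coprime to $\widetilde{n}$, $r_d=([\frac{d}{p_1}],\dots,[\frac{d}{p_t}])$ (row vector) and $D_d=\mathrm{diag}(r_d)$. $A=(a_{ij})$ is the $t\times t$ matrix over $\mathbb{F}_2$ with $a_{ij}=[\frac{p_j}{p_i}]$ for $i\neq j$, $a_{ii}=\sum_{j\neq i}a_{ij}$. $O$ denotes a zero block. *)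

(* Defs.v *)
From HB Require Import structures.
From mathcomp Require Import all_boot all_order all_algebra fraction.
From mathcomp Require Import all_classical all_reals.

Set Implicit Arguments.
Unset Strict Implicit.
Unset Printing Implicit Defensive.

Import Order.TTheory GRing.Theory Num.Theory.
Local Open Scope ring_scope.

(* Z_p as the inverse limit of the rings Z / p^k: an element is the coherent
   sequence of its residues, padic_res x k being the representative of
   x mod p^k in [0, p^k). The primality proof is part of the type, since it is
   what makes Z_p an integral domain. *)
Definition padic_coherent (p : nat) (x : nat -> int) : bool :=
  `[< forall k, x k = (x k.+1 %% p%:Z ^+ k)%Z >].

Record padic_int (p : nat) (p_pr : prime p) := PadicInt {
  padic_res :> nat -> int;
  padic_resP : padic_coherent p padic_res }.

HB.instance Definition _ p (p_pr : prime p) := [isSub for @padic_res p p_pr].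
HB.instance Definition _ p (p_pr : prime p) :=
  [Choice of padic_int p_pr by <:].

Section PadicInt.
Variables (p : nat) (p_pr : prime p).
Local Notation Zp := (padic_int p_pr).
Local Notation q k := (p%:Z ^+ k).
Implicit Types (x y z : Zp) (k : nat) (f : nat -> int).

Lemma padic_mod_dvd k (a : int) : ((a %% q k.+1)%Z %% q k)%Z = (a %% q k)%Z.
Proof.
by rewrite [in RHS](divz_eq a (q k.+1)) [in RHS]exprS mulrA modzMDl -exprS.
Qed.

Lemma padic_normal_coherent f :
  (forall k, f k.+1 = f k %[mod q k])%Z ->
  padic_coherent p (fun k => (f k %% q k)%Z).
Proof. by move=> fP; apply/asboolP => k; rewrite padic_mod_dvd fP. Qed.

Definition padic_of f (fP : (forall k, f k.+1 = f k %[mod q k])%Z) : Zp :=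
  PadicInt p_pr (padic_normal_coherent fP).

Lemma padic_resS x k : x k = (x k.+1 %% q k)%Z.
Proof. by case: x => x /= /asboolP. Qed.

Lemma padic_res_mod x k : (x k %% q k)%Z = x k.
Proof. by rewrite [in LHS]padic_resS modz_mod -padic_resS. Qed.

Lemma padic_res_step x k : (x k.+1 = x k %[mod q k])%Z.
Proof. by rewrite padic_res_mod -padic_resS. Qed.

Lemma padic_eqP x y : (forall k, x k = y k) -> x = y.
Proof. by move=> xy; apply/val_inj/funext. Qed.

Lemma padic_cst_step (a : int) k : (a = a %[mod q k])%Z.
Proof. by []. Qed.

Lemma padic_add_step x y k :
  (x k.+1 + y k.+1 = x k + y k %[mod q k])%Z.
Proof. by rewrite -modzDm !padic_res_step modzDm. Qed.

Lemma padic_opp_step x k : (- x k.+1 = - x k %[mod q k])%Z.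
Proof. by rewrite -modzNm padic_res_step modzNm. Qed.

Lemma padic_mul_step x y k :
  (x k.+1 * y k.+1 = x k * y k %[mod q k])%Z.
Proof. by rewrite -modzMm !padic_res_step modzMm. Qed.

Definition padic_cst (a : int) : Zp := padic_of (padic_cst_step a).
Definition padic_add x y : Zp := padic_of (padic_add_step x y).
Definition padic_opp x : Zp := padic_of (padic_opp_step x).
Definition padic_mul x y : Zp := padic_of (padic_mul_step x y).

Fact padic_addA : associative padic_add.
Proof.
by move=> x y z; apply: padic_eqP => k /=; rewrite modzDmr modzDml addrA.
Qed.

Fact padic_addC : commutative padic_add.
Proof. by move=> x y; apply: padic_eqP => k /=; rewrite addrC. Qed.

Fact padic_add0 : left_id (padic_cst 0) padic_add.
Proof.
by move=> x; apply: padic_eqP => k /=; rewrite modzDml add0r padic_res_mod.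
Qed.

Fact padic_addN : left_inverse (padic_cst 0) padic_opp padic_add.
Proof. by move=> x; apply: padic_eqP => k /=; rewrite modzDml addNr. Qed.

HB.instance Definition _ := GRing.isZmodule.Build Zp
  padic_addA padic_addC padic_add0 padic_addN.

Fact padic_mulA : associative padic_mul.
Proof.
by move=> x y z; apply: padic_eqP => k /=; rewrite modzMmr modzMml mulrA.
Qed.

Fact padic_mulC : commutative padic_mul.
Proof. by move=> x y; apply: padic_eqP => k /=; rewrite mulrC. Qed.

Fact padic_mul1 : left_id (padic_cst 1) padic_mul.
Proof.
by move=> x; apply: padic_eqP => k /=; rewrite modzMml mul1r padic_res_mod.
Qed.

Fact padic_mulDl : left_distributive padic_mul padic_add.
Proof.
move=> x y z; apply: padic_eqP => k /=.
by rewrite modzMml modzDm mulrDl.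
Qed.

Fact padic_oner_neq0 : padic_cst 1 != 0.
Proof.
apply/eqP => /(congr1 (fun x : Zp => x 1%N)) /=.
by rewrite expr1 mod0z modz_small //= ltz_nat prime_gt1.
Qed.

HB.instance Definition _ := GRing.Zmodule_isComNzRing.Build Zp
  padic_mulA padic_mulC padic_mul1 padic_mulDl padic_oner_neq0.

Definition padic_unit : {pred Zp} := fun x => `[< exists y, y * x = 1 >].
Definition padic_inv x : Zp :=
  if pselect (exists y, y * x = 1) is left h then sval (cid h) else x.

Fact padic_mulV : {in padic_unit, left_inverse 1 padic_inv *%R}.
Proof.
move=> x /asboolP xu; rewrite /padic_inv; case: pselect => // h.
by case: cid.
Qed.

Fact padic_unitPl x y : y * x = 1 -> padic_unit x.
Proof. by move=> yx; apply/asboolP; exists y. Qed.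

Fact padic_inv_out : {in [predC padic_unit], padic_inv =1 id}.
Proof.
move=> x xNu; rewrite /padic_inv; case: pselect => // h.
by case/negP: xNu; apply/asboolP.
Qed.

HB.instance Definition _ := GRing.ComNzRing_hasMulInverse.Build Zp
  padic_mulV padic_unitPl padic_inv_out.

Lemma padic_res_mod_le x k m : (k <= m)%N -> (x m = x k %[mod q k])%Z.
Proof.
move=> /subnK <-; elim: (m - k)%N => // d IHd.
rewrite -IHd addSn; have := padic_res_step x (d + k).
move=> /eqP; rewrite eqz_mod_dvd => h; apply/eqP; rewrite eqz_mod_dvd.
by apply: dvdz_trans h; rewrite exprD dvdz_mull.
Qed.

Lemma padic_neq0P x : x != 0 -> exists k, ~~ (q k %| x k)%Z.
Proof.
move=> x0; apply: contrapT => /forallNP xk; case/eqP: x0.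
apply: padic_eqP => k /=.
by have /negP/negPn/dvdz_mod0P := xk k; rewrite padic_res_mod mod0z.
Qed.

Fact padic_integral x y : x * y = 0 -> (x == 0) || (y == 0).
Proof.
move=> xy0; apply/negPn/negP; rewrite negb_or => /andP[x0 y0].
have [i xi] := padic_neq0P x0; have [j yj] := padic_neq0P y0.
pose m := (i + j)%N.
have xm : ~~ (q i %| x m)%Z.
  apply: contra xi => /dvdz_mod0P; rewrite (padic_res_mod_le x (leq_addr j i)).
  by move=> h; apply/dvdz_mod0P.
have ym : ~~ (q j %| y m)%Z.
  apply: contra yj => /dvdz_mod0P; rewrite (padic_res_mod_le y (leq_addl i j)).
  by move=> h; apply/dvdz_mod0P.
have : (q m %| x m * y m)%Z.
  apply/dvdz_mod0P.
  by have := congr1 (fun z : Zp => z m) xy0; rewrite /= mod0z.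
move: xm ym; rewrite !dvdzE !abszX abszM /=.
have dvd_or : (0 < `|x m|)%N -> (0 < `|y m|)%N ->
    (p ^ m %| `|x m| * `|y m|)%N -> (p ^ i %| `|x m|)%N || (p ^ j %| `|y m|)%N.
  move=> a0 b0; rewrite !pfactor_dvdn ?muln_gt0 ?a0 // lognM //.
  rewrite /m => le_ij; case: leqP => //= lt_i.
  by rewrite -(leq_add2l i) (leq_trans le_ij) // leq_add2r ltnW.
case: (posnP `|x m|) => [->|/dvd_or {}dvd_or]; first by rewrite dvdn0.
case: (posnP `|y m|) => [->|/dvd_or {}dvd_or]; first by rewrite dvdn0.
by move=> /negPf xi' /negPf yj' /dvd_or; rewrite xi' yj'.
Qed.

HB.instance Definition _ := GRing.ComUnitRing_isIntegral.Build Zp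
  padic_integral.

End PadicInt.

Definition padic (p : nat) (p_pr : prime p) := {fraction padic_int p_pr}.
HB.instance Definition _ p (p_pr : prime p) := GRing.Field.on (padic p_pr).

(* For E : y^2 = (x - e1)(x - e2)(x - e3), the classes of H^1(Q, E[2]) are the
   pairs (b1, b2) of elements of Q^* / Q^*2, the class of P = (x, y) in E(Q)
   being (x - e1, x - e2). The torsor of (b1, b2) is the curve of P^3 given by
   x - e1 = b1 z1^2, x - e2 = b2 z2^2, x - e3 = b1 b2 z3^2, with x eliminated
   and homogenized by z0. *)
Definition torsor_has_point (K : fieldType) (e1 e2 e3 b1 b2 : rat) : Prop :=
  exists z0 z1 z2 z3 : K,
    [/\ (z0, z1, z2, z3) != (0, 0, 0, 0),
        ratr b1 * z1 ^+ 2 - ratr b2 * z2 ^+ 2 = ratr (e2 - e1) * z0 ^+ 2 &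
        ratr b1 * z1 ^+ 2 - ratr (b1 * b2) * z3 ^+ 2
          = ratr (e3 - e1) * z0 ^+ 2].

Definition square_class (a : rat) : set rat :=
  [set b | exists2 s : rat, s != 0 & b = a * s ^+ 2]%classic.

(* An element of Q^* / Q^*2 is represented by the corresponding coset, a set of
   rationals. *)
Definition selmer2 (R : realType) (e1 e2 e3 : rat) : set (set rat * set rat) :=
  [set c | exists b1 b2 : rat,
    [/\ b1 != 0, b2 != 0, c = (square_class b1, square_class b2),
        torsor_has_point R e1 e2 e3 b1 b2 &
        forall (p : nat) (p_pr : prime p),
          torsor_has_point (padic p_pr) e1 e2 e3 b1 b2]]%classic.

(* E_n : y^2 = x (x + 3n) (x - n), where b1 and b2 are the classes of x and
   x - n. *)
Definition selmer2_E (R : realType) (n : int) : set (set rat * set rat) :=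
  selmer2 R 0 n%:~R (- (3 * n%:~R)).

(* For v = (xi_1, xi_2, xi_3, gamma_1, gamma_2, gamma_3, y, x). *)
Definition decode1 (t : nat) (p : 'I_t -> nat) (v : 'cV['F_2]_(6 + (t + t))) :
    rat :=
  let g i := val (usubmx v (inord i) 0) in
  let x i := val (dsubmx (dsubmx v) i 0) in
  (-1) ^+ g 3%N * 2 ^+ g 4%N * 3 ^+ g 5%N * \prod_(i < t) (p i)%:R ^+ x i.

Definition decode2 (t : nat) (p : 'I_t -> nat) (v : 'cV['F_2]_(6 + (t + t))) :
    rat :=
  let xi i := val (usubmx v (inord i) 0) in
  let y i := val (usubmx (dsubmx v) i 0) in
  (-1) ^+ xi 0%N * 2 ^+ xi 1%N * 3 ^+ xi 2%N * \prod_(i < t) (p i)%:R ^+ y i.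

Definition decode (t : nat) (p : 'I_t -> nat) (v : 'cV['F_2]_(6 + (t + t))) :
    set rat * set rat :=
  (square_class (decode1 p v), square_class (decode2 p v)).

(* M is a Monsky matrix of E_n, where p enumerates the prime factors of
   n / gcd(6, n). *)
Definition is_monsky_matrix (R : realType) (n : int) (t : nat)
    (p : 'I_t -> nat) (m : nat) (M : 'M['F_2]_(m, 6 + (t + t))) : Prop :=
  set_bij [set v | M *m v = 0]%classic (selmer2_E R n) (decode p).

Definition legendre (a : int) (p : nat) : int :=
  if (p%:Z %| a)%Z then 0
  else if [exists x : 'I_p, (x%:Z ^+ 2 == a %[mod p%:Z])%Z] then 1 else -1.

Definition add_legendre (a : int) (p : nat) : 'F_2 :=
  ((1 - legendre a p) %/ 2)%Z%:~R.

Section MonskyBlocks.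
Variables (t : nat) (p : 'I_t -> nat).

Definition add_jacobi (a : int) : 'F_2 := \sum_(i < t) add_legendre a (p i).

Definition r_ (d : int) : 'rV['F_2]_t := \row_i add_legendre d (p i).

Definition D_ (d : int) : 'M['F_2]_t := diag_mx (r_ d).

Definition A_ : 'M['F_2]_t :=
  \matrix_(i, j)
    if i == j then \sum_(k < t | k != i) add_legendre (p k) (p i)
    else add_legendre (p j) (p i).

Definition of_rows (m k : nat) (s : seq 'rV['F_2]_k) : 'M['F_2]_(m, k) :=
  \matrix_(i < m) nth 0 s i.

Definition of_entries (m k : nat) (s : seq (seq 'F_2)) : 'M['F_2]_(m, k) :=
  \matrix_(i < m, j < k) nth 0 (nth [::] s i) j.

Definition B2 : 'M['F_2]_(5 + (t + t), 6 + (t + t)) :=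
  block_mx
    (of_entries 5 6
      [:: [:: 1; 0; 0; 0; 0                  ; 0                    ];
          [:: 0; 0; 0; 1; 1 + add_jacobi (-1); 1                    ];
          [:: 0; 1; 0; 0; add_jacobi 2       ; 1                    ];
          [:: 1; 1; 0; 0; 0                  ; 1 + add_jacobi (- 3) ];
          [:: 0; 0; 1; 0; 0                  ; 0                    ]])
    (row_mx (of_rows 5 [:: 0; 0; 0; r_ (- 3); 0])
            (of_rows 5 [:: 0; r_ (-1); r_ 2; 0; 0]))
    (col_mx (of_rows 6 [:: 0; 0; 0; r_ (-1); r_ 2; r_ 3])^T
            (of_rows 6 [:: r_ (-1); r_ 2; r_ 3; 0; 0; 0])^T)
    (block_mx (D_ (- 3))   (A_ + D_ (- 2))
              (A_ + D_ 2)  0).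

End MonskyBlocks.

(* Main.v *)
(* The classes [(b1, b2)] are tested place by place. At an odd prime [q] not
   dividing [6 n], a character sum shows that every torsor unramified at [q] has
   as many points over [F_q] as the trivial one, hence a point, which Hensel's
   lemma lifts; a ramified torsor has no primitive solution modulo [q ^ 2]. At
   [p_i] the soluble classes are those of the 2-torsion, at 3 they are found
   modulo 9, at 2 modulo 16 by a finite computation, and at infinity the only
   condition is [0 < b2]. Written with Legendre symbols through quadratic
   reciprocity, these conditions are the rows of [B2], except for one condition
   at 2, which the other rows imply: it says that the Hilbert symbol of
   [(b2, n)] at 2 is trivial, and the symbols at the other places are. *)
Require Import Defs.
From mathcomp Require Import all_boot all_order all_algebra.
From mathcomp Require Import all_fingroup all_solvable all_field fraction.
From mathcomp Require Import all_classical all_reals.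
From mathcomp Require Import zify ring lra.
Import Order.TTheory GRing.Theory Num.Theory.
Local Open Scope ring_scope.

Set Implicit Arguments.
Unset Strict Implicit.
Unset Printing Implicit Defensive.

(** * Quadratic characters of finite fields *)

(** The omitted condition at 2 is implied for a structural reason: the symbol of [(b2, n)] is the
    local Tate pairing of [(b1, b2)] with [(n, 1)], the class of the 2-torsion point [(n, 0)], so it
    is trivial wherever the torsor is soluble. At [p_i] this is the second row attached to [p_i]; at
    3 both entries have even valuation, and at infinity [b2] is positive. The roots 0, [n], [-3n]
    differ by [n], [3n], [4n], which is why 2 and 3 join the divisors of [n] as special places. All
    local points are built alike: two of the four coordinates receive integer values, and the two
    quadrics then separate into two conditions, each asking that one integer be a local square.
    Lifting square roots is thus the only form of Hensel's lemma involved. Insolubility is always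
    read from a primitive integer solution modulo a power of the prime. *)

Section QuadraticCharacter.
Variables (F : finFieldType) (h : nat).
Hypothesis cardF : #|F| = h.*2.+1.
Implicit Types (x y a b : F).

Definition is_square x := [exists y, y ^+ 2 == x].
Definition chi x : int := if x == 0 then 0 else if is_square x then 1 else -1.

Lemma is_squareP x : reflect (exists y, y ^+ 2 = x) (is_square x).
Proof. exact: 'exists_eqP. Qed.

Lemma expf_order x : x != 0 -> x ^+ h.*2 = 1.
Proof.
by move=> x0; have := expf_card x; rewrite cardF exprS => /(canRL (mulKf x0)) ->; rewrite mulVf.
Qed.

Lemma half_card_gt0 : (0 < h)%N.
Proof.
have := finNzRing_gt1 F; rewrite cardF; by case: (h).
Qed.

(** [X^h - 1] has at most [h] roots, fewer than the [2h] nonzero elements. *)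
Lemma half_order_neq1 : exists2 x : F, x != 0 & x ^+ h != 1.
Proof.
apply/exists_inP; apply: contraT; rewrite negb_exists_in => /forall_inP xh.
pose q : {poly F} := 'X^h - 1.
have q0 : q != 0 by rewrite -size_poly_eq0 size_XnsubC ?half_card_gt0.
have := max_poly_roots q0 (rs := enum [pred x : F | x != 0]).
rewrite enum_uniq size_XnsubC ?half_card_gt0 // -cardE.
have -> : #|[pred x : F | x != 0]| = h.*2.
  have := cardC1 (0 : F); rewrite cardF /= => <-; exact: eq_card.
move=> H; have: (h.*2 < h.+1)%N.
  apply: H => //; apply/allP => x; rewrite mem_enum inE => x0.
  by rewrite rootE !hornerE subr_eq0; have /negPn := xh x x0.
by have := half_card_gt0; lia.
Qed.

(** Take a generator of the cyclic unit group. Its [h]-th power is a square root of 1, and it is not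
    1, as otherwise every [h]-th power would be. *)
Lemma primitive_root :
  exists2 g : F, g ^+ h = -1 & forall x, x != 0 -> exists k, x = g ^+ k.
Proof.
have /cyclicP[u uG] := field_unit_group_cyclic [set: {unit F}]%G.
have gen x : x != 0 -> exists k, x = FinRing.uval u ^+ k.
  rewrite -unitfE => xu.
  have: FinRing.Unit xu \in <[u]>%g by rewrite -uG inE.
  case/cycleP=> k /(congr1 FinRing.uval).
  by rewrite FinRing.val_unitX /= => ->; exists k.
exists (FinRing.uval u) => //; set g := FinRing.uval u in gen *.
have g0 : g != 0 by rewrite -unitfE; apply: (valP u).
have : (g ^+ h - 1) * (g ^+ h + 1) = 0.
  by rewrite -subr_sqr expr1n -exprM muln2 expf_order ?subrr.
move=> /eqP; rewrite mulf_eq0 subr_eq0 addr_eq0 => /orP[|/eqP//] /eqP gh.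
have [x /gen[k ->]] := half_order_neq1.
by rewrite -exprM mulnC exprM gh expr1n eqxx.
Qed.

(** A nonsquare is an odd power of the generator [g], and [g ^+ h = -1]. *)
Lemma euler_criterion x : x != 0 -> x ^+ h = (chi x)%:~R.
Proof.
move=> x0; rewrite /chi (negbTE x0).
case: is_squareP => [[y yx]|Nsq].
  rewrite -yx -exprM mul2n expf_order //.
  by apply: contraNneq x0 => y0; rewrite -yx y0 expr0n.
have [g gh /(_ x x0)[k xk]] := primitive_root.
rewrite xk -exprM mulnC exprM gh -signr_odd; case: (boolP (odd k)) => // ke.
by case: Nsq; exists (g ^+ k./2); rewrite xk -exprM muln2 halfK (negbTE ke) subn0.
Qed.

(** If [1 = -1], Euler's criterion would give [x ^+ h = 1] for all nonzero [x]. *)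
Lemma oner_neqN1 : (1 : F) != -1.
Proof.
apply/negP => /eqP N11; have [x x0] := half_order_neq1.
by rewrite euler_criterion // /chi (negbTE x0); case: ifP => _; rewrite ?mulrN1z -?N11 eqxx.
Qed.

(** Lets identities between values of [chi] be checked in [F], where Euler's criterion turns them
    into identities between powers. *)
Lemma chi_inj (a b : int) : a \in [:: 0; 1; -1] -> b \in [:: 0; 1; -1] ->
  a%:~R = b%:~R :> F -> a = b.
Proof.
have n1 := negPf oner_neqN1; have n2 := negPf (oner_neq0 F).
have n3 : ((-1 : F) == 0) = false by rewrite oppr_eq0.
rewrite !inE => /or3P[] /eqP-> /or3P[] /eqP-> //;
  rewrite ?(mulr1z, mulr0z, mulrN1z) => /eqP; rewrite ?(n1, n2, n3) // eq_sym;
  by rewrite ?(n1, n2, n3).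
Qed.

Lemma chi_mem x : chi x \in [:: 0; 1; -1].
Proof. by rewrite /chi; case: ifP => // _; case: ifP. Qed.

Lemma chi0 : chi 0 = 0. Proof. by rewrite /chi eqxx. Qed.

Lemma chi_eq1 x : x != 0 -> (chi x == 1) = is_square x.
Proof. by rewrite /chi => /negbTE ->; case: is_square. Qed.

Lemma chi_sqr x : x != 0 -> chi (x ^+ 2) = 1.
Proof.
move=> x0; apply/eqP; rewrite chi_eq1 ?expf_neq0 //.
by apply/is_squareP; exists x.
Qed.

Lemma chiM x y : chi (x * y) = chi x * chi y.
Proof.
have [->|x0] := eqVneq x 0; first by rewrite mul0r chi0 mul0r.
have [->|y0] := eqVneq y 0; first by rewrite mulr0 chi0 mulr0.
apply: chi_inj; first exact: chi_mem.
  have := chi_mem x; have := chi_mem y.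
  by rewrite !inE => /or3P[] /eqP-> /or3P[] /eqP->; rewrite ?mul0r ?mulr0.
by rewrite intrM -!euler_criterion ?mulf_neq0 // exprMn.
Qed.

Lemma chi_nonsquare : exists2 a, a != 0 & chi a = -1.
Proof.
have [x x0 xh] := half_order_neq1; exists x => //.
move: xh; rewrite euler_criterion //.
by rewrite /chi (negbTE x0); case: ifP; rewrite ?eqxx.
Qed.

(** Multiplication by a nonsquare permutes [F] and changes the sign of every term. *)
Lemma sum_chi : \sum_x chi x = 0.
Proof.
have [a a0 chia] := chi_nonsquare.
suff : \sum_x chi x = - \sum_x chi x by lia.
rewrite [LHS](reindex_inj (mulfI a0)) -sumrN; apply: eq_bigr => x _.
by rewrite chiM chia mulN1r.
Qed.

Lemma sum_chi_affine a b : a != 0 -> \sum_x chi (a * x + b) = 0.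
Proof.
move=> a0; rewrite -[RHS]sum_chi [RHS](reindex (fun x => a * x + b)) //.
exists (fun x => a^-1 * (x - b)) => x _; first by rewrite addrK mulKf.
by rewrite mulVKf // subrK.
Qed.

(** After translating by [a], replace [x] by its inverse and multiply by the square [x ^+ 2]: the
    term becomes [chi ((a - b) * x + 1)]. The sum of these over all [x] is 0, and the missing term
    at [x = 0] is 1. *)
Lemma sum_chi_quadratic a b : a != b -> \sum_x chi ((x - a) * (x - b)) = -1.
Proof.
rewrite -subr_eq0 => ab0; rewrite (reindex_inj (addIr a)) /=.
rewrite (bigD1 0) //= add0r subrr mul0r chi0 add0r.
have -> : \sum_(x : F | x != 0) chi ((x + a - a) * (x + a - b))
        = \sum_(x : F | x != 0) chi ((a - b) * x + 1).
  rewrite (reindex_inj invr_inj) /=; apply: eq_big => [x|x x0].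
    by rewrite invr_eq0.
  rewrite -[RHS]mul1r -(chi_sqr x0) -chiM; congr chi.
  by move: x0; rewrite invr_eq0 => x0; field.
have := sum_chi_affine 1 ab0; rewrite (bigD1 0) //= mulr0 add0r.
have := @chi_sqr 1 (oner_neq0 _); rewrite expr1n => ->.
by move=> /eqP; rewrite addrC addr_eq0 => /eqP ->.
Qed.

Lemma sum_chi_shift a : \sum_x chi (x - a) = 0.
Proof.
by have := sum_chi_affine (- a) (oner_neq0 F); under eq_bigr do rewrite mul1r.
Qed.
End QuadraticCharacter.

(** * Points of the torsor over a finite field *)

Section GoodReduction.
Variables (F : finFieldType) (h : nat).
Hypothesis cardF : #|F| = h.*2.+1.
Implicit Types (x d b : F).

Let chiM := chiM cardF.

(** The number of points with [z0 = 1] above the abscissa [x]: for nonzero [b], the equation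
    [b * z ^+ 2 = c] has [1 + chi (b * c)] solutions. *)
Definition fiber_weight d b1 b2 x : int :=
  (1 + chi (b1 * x)) * (1 + chi (b2 * (x - d))) * (1 + chi (b1 * b2 * (x + 3 * d))).

Lemma chi_ge x : 0 <= 1 + chi x.
Proof. by rewrite /chi; case: ifP => // _; case: ifP. Qed.

Lemma chi_sq x : x != 0 -> chi x * chi x = 1.
Proof. by move=> x0; rewrite -chiM -expr2 chi_sqr. Qed.

(* The number of points of the torsor, including those at infinity, is the
   left-hand side plus [1 + chi b1 + chi b2 + chi (b1 * b2)]: it does not
   depend on [b1] and [b2]. *)
Lemma sum_fiber_weight d b1 b2 : d != 0 -> 3%:R != 0 :> F -> b1 != 0 -> b2 != 0 ->
  \sum_x fiber_weight d b1 b2 x = #|F|%:Z - chi b1 - chi b2 - chi b1 * chi b2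
    + \sum_x chi (x * (x - d) * (x + 3 * d)).
Proof.
move=> d0 d3 b10 b20.
have d3n : (0 : F) != - (3 * d) by rewrite eq_sym oppr_eq0 mulf_neq0.
have d4 : d != - (3 * d).
  rewrite -addr_eq0 (_ : d + 3 * d = (1 + 1) * (1 + 1) * d); last by ring.
  by rewrite !mulf_neq0 // addr_eq0 (oner_neqN1 cardF).
have d0' : 0 != d by rewrite eq_sym.
(* In the expansion, linear terms sum to 0 and quadratic ones to -1, the three roots being distinct.
   The cubic term carries each of [b1], [b2] twice, so it loses them. *)
have E x : fiber_weight d b1 b2 x =
   1 + chi b1 * chi (x - 0) + chi b2 * chi (x - d)
   + chi b1 * chi b2 * chi (x - (- (3 * d)))
   + chi b1 * chi b2 * chi ((x - 0) * (x - d))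
   + chi b2 * chi ((x - 0) * (x - (- (3 * d))))
   + chi b1 * chi ((x - d) * (x - (- (3 * d))))
   + chi (x * (x - d) * (x + 3 * d)).
  rewrite /fiber_weight !chiM !subr0 !opprK.
  have := chi_sq b10; have := chi_sq b20.
  move: (chi b1) (chi b2) (chi x) (chi (x - d)) (chi (x + 3 * d)).
  move=> c1 c2 u v w h2 h1.
  have [->|->] : c1 = 1 \/ c1 = -1 by clear -h1; nia.
    by have [->|->] : c2 = 1 \/ c2 = -1; [nia|ring|ring].
  by have [->|->] : c2 = 1 \/ c2 = -1; [nia|ring|ring].
under eq_bigr do rewrite E.
rewrite !big_split /= -!mulr_sumr !(sum_chi_shift cardF).
rewrite !(sum_chi_quadratic cardF) // sumr_const.
rewrite !mulr0 !addr0 !mulrN1; rewrite natz -[#|xpredT|]/#|F|; ring.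
Qed.

Lemma chi_neqN1 x : 1 + chi x != 0 -> exists y, y ^+ 2 = x.
Proof.
have [->|x0] := eqVneq x 0; first by exists 0; rewrite expr0n.
rewrite /chi (negPf x0).
by case: is_squareP => [?|_] //; rewrite subrr eqxx.
Qed.

Lemma torsor_finfield_point d b1 b2 :
  d != 0 -> 3%:R != 0 :> F -> b1 != 0 -> b2 != 0 ->
  exists z0 z1 z2 z3 : F, [/\ (z0, z1, z2, z3) != (0, 0, 0, 0),
    b1 * z1 ^+ 2 - b2 * z2 ^+ 2 = d * z0 ^+ 2 &
    b1 * z1 ^+ 2 - b1 * b2 * z3 ^+ 2 = - (3 * d) * z0 ^+ 2].
Proof.
move=> d0 d3 b10 b20; have [[x]|wt0] := altP (@existsP _ (fun x => fiber_weight d b1 b2 x != 0)).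
  rewrite /fiber_weight !mulf_eq0 !negb_or -andbA => /and3P[].
  move=> /chi_neqN1[u uE] /chi_neqN1[v vE] /chi_neqN1[w wE].
  exists 1, (u / b1), (v / b2), (w / (b1 * b2)); split.
  - by rewrite !xpair_eqE oner_eq0.
  - by rewrite !exprMn uE vE; field; rewrite b10 b20.
  - by rewrite !exprMn uE wE; field; rewrite b10 b20.
have wt x : fiber_weight d b1 b2 x = 0.
  by move: wt0; rewrite negb_exists => /forallP/(_ x)/negPn/eqP.
have s0 : \sum_x fiber_weight d b1 b2 x = 0 by rewrite big1.
have s1 : 0 <= \sum_x fiber_weight d 1 1 x.
  by apply: sumr_ge0 => x _; rewrite !mulr_ge0 ?chi_ge.
have c1 : chi (1 : F) = 1 by rewrite -[1](expr1n F 2) chi_sqr ?oner_neq0.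
move: s0 s1; rewrite !sum_fiber_weight ?oner_neq0 // c1.
move=> s0 s1.
(* Comparison with the trivial torsor gives [chi b1 + chi b2 + chi b1 * chi b2 >= 3]. Hence [b1] and
   [b2] are squares, and there is a point at infinity, with [z0 = 0]. *)
have : (1 + chi b1) * (1 + chi b2) != 0 by lia.
rewrite mulf_eq0 negb_or => /andP[/chi_neqN1[u uE] /chi_neqN1[v vE]].
have u0 : u != 0 by apply: contraNneq b10 => u0; rewrite -uE u0 expr0n.
have v0 : v != 0 by apply: contraNneq b20 => v0; rewrite -vE v0 expr0n.
exists 0, u^-1, v^-1, (u * v)^-1; split.
- by rewrite !xpair_eqE !invr_eq0 (negPf u0) andbF.
- by rewrite -uE -vE; field; rewrite u0 v0.
- by rewrite -uE -vE; field; rewrite u0 v0.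
Qed.
End GoodReduction.

(** * Quadratic reciprocity *)

Lemma F2_cases (x : 'F_2) : x = 0 \/ x = 1.
Proof. by case: x => [[|[|n]] //= i]; [left|right]; apply: val_inj. Qed.

Lemma F2_addxx (x : 'F_2) : x + x = 0.
Proof. by case: (F2_cases x) => ->; apply: val_inj. Qed.

Lemma F2_opp (x : 'F_2) : - x = x.
Proof. by case: (F2_cases x) => ->; apply: val_inj. Qed.

Lemma F2_natr (n : nat) : n%:R = (odd n)%:R :> 'F_2.
Proof. by apply: val_inj; rewrite /= !val_Fp_nat // !modn2 oddb. Qed.

Lemma F2_add_eq0 (x y : 'F_2) : x + y = 0 <-> x = y.
Proof. by split=> [/eqP|->]; rewrite ?F2_addxx // addr_eq0 F2_opp => /eqP. Qed.

Section ResidueSymbol.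
Variables (p : nat) (p_pr : prime p).
Implicit Types a b : int.

Lemma intr_Fp_eq0 a : (a%:~R == 0 :> 'F_p) = (p%:Z %| a)%Z.
Proof. by rewrite -(dvdz_pcharf (pchar_Fp p_pr)). Qed.

Lemma intr_Fp_eq a b : (a%:~R == b%:~R :> 'F_p) = (p%:Z %| a - b)%Z.
Proof. by rewrite -subr_eq0 -intrB intr_Fp_eq0. Qed.

Lemma intr_Fp_surj (y : 'F_p) : exists a : int, y = a%:~R.
Proof. by exists (Posz (val y)); rewrite -pmulrn natr_Zp. Qed.

Lemma is_square_Fp a :
  reflect (exists x : int, (p%:Z %| x ^+ 2 - a)%Z) (is_square (a%:~R : 'F_p)).
Proof.
apply: (iffP (is_squareP _)) => [[y]|[x]]; last first.
  by rewrite -intr_Fp_eq rmorphXn => /eqP xa; exists x%:~R.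
have [b ->] := intr_Fp_surj y; move=> /eqP; rewrite -[_ ^+ 2](rmorphXn (intr : int -> 'F_p)).
by rewrite intr_Fp_eq; exists b.
Qed.

Lemma legendreE a : legendre a p = chi (a%:~R : 'F_p).
Proof.
rewrite /legendre /chi intr_Fp_eq0; case: ifP => // _.
congr (if _ then _ else _); apply/existsP/is_square_Fp => [[x]|[x]].
  by rewrite eqz_mod_dvd; exists x.
have p0 := prime_gt0 p_pr; move=> xa.
have xp : (`|(x %% p%:Z)%Z| < p)%N by lia.
exists (Ordinal xp); rewrite eqz_mod_dvd /=.
have -> : `|(x %% p%:Z)%Z|%N%:Z = x - (x %/ p%:Z)%Z * p%:Z by lia.
rewrite -intr_Fp_eq rmorphXn rmorphB rmorphM /=.
have /eqP -> : ((p%:Z)%:~R == 0 :> 'F_p) by rewrite intr_Fp_eq0.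
by rewrite mulr0 subr0 -rmorphXn intr_Fp_eq.
Qed.

Lemma add_legendreE a : add_legendre a p = (chi (a%:~R : 'F_p) == -1)%:R.
Proof.
rewrite /add_legendre legendreE; have := chi_mem (a%:~R : 'F_p).
by rewrite !inE => /or3P[] /eqP->.
Qed.

End ResidueSymbol.

(** * The Legendre symbol at an odd prime; lemmas of Gauss and Eisenstein *)

Section OddPrime.
Variables (p h : nat) (p_pr : prime p).
Hypothesis ph : p = h.*2.+1.
Implicit Types a b : int.

Let cardFp : #|'F_p| = h.*2.+1. Proof. by rewrite card_Fp. Qed.

Lemma add_legendre_eq0 a : ~~ (p%:Z %| a)%Z ->
  add_legendre a p = 0 <-> exists x : int, (p%:Z %| x ^+ 2 - a)%Z.
Proof.
rewrite -(intr_Fp_eq0 p_pr) => a0; rewrite add_legendreE // /chi (negbTE a0).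
by case: (is_square_Fp p_pr) => H; split.
Qed.

Lemma add_legendreM a b : ~~ (p%:Z %| a)%Z -> ~~ (p%:Z %| b)%Z ->
  add_legendre (a * b) p = add_legendre a p + add_legendre b p.
Proof.
rewrite -!(intr_Fp_eq0 p_pr) => a0 b0; rewrite !add_legendreE // intrM.
rewrite (chiM cardFp) /chi (negbTE a0) (negbTE b0).
by do 2!case: ifP => _; apply: val_inj.
Qed.

Lemma add_legendre_sqr a : add_legendre (a ^+ 2) p = 0.
Proof.
have [pa|pa] := boolP (p%:Z %| a)%Z; last by rewrite add_legendreM // F2_addxx.
by rewrite /add_legendre /legendre dvdz_exp.
Qed.

Lemma add_legendre1 : add_legendre 1 p = 0.
Proof. by rewrite -(expr1n _ 2) add_legendre_sqr. Qed.

Lemma add_legendre_mod a b : (p%:Z %| a - b)%Z -> add_legendre a p = add_legendre b p.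
Proof. by rewrite -(intr_Fp_eq p_pr) !add_legendreE // => /eqP ->. Qed.

Section GaussLemma.
Variable a : nat.
Hypothesis pa : ~~ (p %| a)%N.

(** The index [k] stands for the multiplier [k.+1], ordinals starting at 0. [gauss_rep k] is the
    absolute value of the least absolute residue of [a * k.+1], and [gauss_sign k] tells whether
    that residue is negative. *)
Definition gauss_sign k : bool := (h < (a * k.+1) %% p)%N.
Definition gauss_rep k : nat :=
  (if gauss_sign k then p - (a * k.+1) %% p else (a * k.+1) %% p)%N.

Let a0 : (a%:R : 'F_p) != 0.
Proof. by rewrite -(dvdn_pcharf (pchar_Fp p_pr)). Qed.

Let natFp_eq (m n : nat) : (m < p)%N -> (n < p)%N -> m%:R = n%:R :> 'F_p -> m = n.
Proof.
move=> mp np /(congr1 val) /=.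
by rewrite !val_Fp_nat ?modn_small //.
Qed.

Lemma gauss_rep_range k : (k < h)%N -> (0 < gauss_rep k <= h)%N.
Proof.
move=> kh; have : ~~ (p %| a * k.+1)%N.
  by rewrite Euclid_dvdM // (negbTE pa) /= gtnNdvd //; lia.
rewrite /dvdn /gauss_rep /gauss_sign.
have := ltn_pmod (a * k.+1) (prime_gt0 p_pr); move: (_ %% _)%N => r; case: ifP; lia.
Qed.

Lemma gauss_repE k : (gauss_rep k)%:R = (-1) ^+ gauss_sign k * (a%:R * k.+1%:R) :> 'F_p.
Proof.
have E : ((a * k.+1) %% p)%N%:R = a%:R * k.+1%:R :> 'F_p.
  by apply: val_inj; rewrite -natrM /= !val_Fp_nat // modn_mod.
rewrite /gauss_rep; case: ifP => _; last by rewrite E mul1r.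
rewrite natrB ?E; last by rewrite ltnW // ltn_pmod // prime_gt0.
by have -> := pcharf0 (pchar_Fp p_pr); rewrite sub0r mulN1r.
Qed.

(** Squaring removes the signs and leaves [k.+1] equal to plus or minus [l.+1] modulo [p]; minus is
    excluded because [k.+1 + l.+1] lies strictly between 0 and [p]. *)
Lemma gauss_rep_inj k l : (k < h)%N -> (l < h)%N -> gauss_rep k = gauss_rep l -> k = l.
Proof.
move=> kh lh kl.
have := congr1 (fun n => (n%:R : 'F_p) ^+ 2) kl.
rewrite /= !gauss_repE !exprMn !sqrr_sign !mul1r.
move=> /(mulfI (expf_neq0 2 a0)) /eqP; rewrite eqf_sqr => /orP[]/eqP.
  by move=> /natFp_eq H; have := H; rewrite ph; lia.
move=> /eqP; rewrite -subr_eq0 opprK -natrD.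
by rewrite -(dvdn_pcharf (pchar_Fp p_pr)) gtnNdvd //; lia.
Qed.

Lemma gauss_rep_perm (T : Type) (idx : T) (op : Monoid.com_law idx) (f : nat -> T) :
  \big[op/idx]_(k < h) f (gauss_rep k) = \big[op/idx]_(k < h) f k.+1.
Proof.
have rng (k : 'I_h) : ((gauss_rep k).-1 < h)%N.
  by have := gauss_rep_range (ltn_ord k); lia.
pose g (k : 'I_h) := Ordinal (rng k).
have g_inj : injective g.
  move=> k l /(congr1 val) /= E; apply/val_inj/gauss_rep_inj => //=.
  by have := gauss_rep_range (ltn_ord k); have := gauss_rep_range (ltn_ord l); lia.
rewrite [RHS](reindex_inj g_inj); apply: eq_bigr => k _ /=.
by rewrite prednK //; have := gauss_rep_range (ltn_ord k); lia.
Qed.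

(** The representatives permute [1, ..., h], so comparing products shows that [a ^+ h] is the
    product of the signs; Euler's criterion concludes. *)
Lemma gauss_lemma :
  add_legendre a p = (\sum_(k < h) gauss_sign k)%:R :> 'F_2.
Proof.
have : \prod_(k < h) (gauss_rep k)%:R = \prod_(k < h) k.+1%:R :> 'F_p.
  exact: (@gauss_rep_perm _ _ *%R (fun n => n%:R)).
under eq_bigr do rewrite gauss_repE.
rewrite !big_split /= prodr_const card_ord mulrA prodrXr.
set P := (X in _ * X = X); set s := (\sum_(k < h) _)%N.
have P0 : P != 0.
  apply/prodf_neq0 => k _; rewrite -(dvdn_pcharf (pchar_Fp p_pr)) gtnNdvd //.
  by have := ltn_ord k; lia.
rewrite -[RHS]mul1r => /(mulIf P0) E.
rewrite add_legendreE // [RHS]F2_natr -pmulrn.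
have -> : chi (a%:R : 'F_p) = (-1) ^+ odd s.
  apply: (chi_inj cardFp); first exact: chi_mem.
    by case: (odd s); rewrite !inE.
  rewrite -(euler_criterion cardFp) // intr_sign signr_odd.
  by rewrite -[LHS](signrMK s) E mulr1.
by case: (odd s).
Qed.

(** As [p] is odd, the remainder of [a * k.+1] has the parity of [gauss_rep k + gauss_sign k], and
    the quotient keeps its own. Summing over [k] trades the signs for the quotients. For odd [a] the
    first term is even; for [a = 2] the quotients vanish. *)
Lemma eisenstein_lemma :
  add_legendre a p =
    (a.+1 * \sum_(k < h) k.+1 + \sum_(k < h) (a * k.+1) %/ p)%N%:R :> 'F_2.
Proof.
rewrite gauss_lemma [LHS]F2_natr [RHS]F2_natr; congr (nat_of_bool _)%:R.
have E1 : (\sum_(k < h) gauss_rep k = \sum_(k < h) k.+1)%N.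
  exact: (@gauss_rep_perm _ _ addn id).
have : odd (\sum_(k < h) (a * k.+1)) =
  odd (\sum_(k < h) (((a * k.+1) %/ p)%N + (gauss_rep k + gauss_sign k))).
  elim/big_ind2: _ => // [x1 x2 y1 y2 e1 e2|k _]; first by rewrite !oddD e1 e2.
  rewrite {1}(divn_eq (a * k.+1) p) !oddD oddM ph /= odd_double andbT; congr (_ (+) _).
  rewrite /gauss_rep; case: ifP => _; rewrite -?ph ?addbF //.
  rewrite oddB ?ph /= ?odd_double; last by rewrite ltnW // -ph ltn_pmod // prime_gt0.
  by rewrite -ph; case: (odd _).
rewrite !big_split /= E1 -big_distrr /= !oddD !oddM /=.
move: (odd a) (odd (\sum_(k < h) k.+1)) (odd (\sum_(k < h) gauss_sign k))
  (odd (\sum_(k < h) (a * k.+1) %/ p)%N).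
by do 4!case.
Qed.
End GaussLemma.
End OddPrime.

(** On odd integers, [eps] and [omega] are the classes of [(a - 1) / 2] and [(a^2 - 1) / 8], the
    additive characters of the supplementary laws; [theta] is the quadratic character modulo 3. *)
Definition eps (a : int) : 'F_2 := ((a %% 4)%Z == 3)%:R.
Definition omega (a : int) : 'F_2 := (((a %% 8)%Z == 3) || ((a %% 8)%Z == 5))%:R.
Definition theta (a : int) : 'F_2 := ((a %% 3)%Z == 2)%:R.

Lemma odd_primeE p : prime p -> p <> 2%N -> p = p./2.*2.+1.
Proof. by move=> p_pr /eqP p2; have := odd_prime_gt2; case: (even_prime p_pr) => //; lia. Qed.

Lemma add_legendreN1 p : prime p -> p <> 2%N -> add_legendre (-1) p = eps p.
Proof.
move=> p_pr p2; have ph := odd_primeE p_pr p2.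
have cF : #|'F_p| = p./2.*2.+1 by rewrite card_Fp.
rewrite add_legendreE // /eps; congr (nat_of_bool _)%:R.
have -> : chi ((-1)%:~R : 'F_p) = (-1) ^+ odd p./2.
  apply: (chi_inj cF); first exact: chi_mem.
    by case: (odd _); rewrite !inE.
  rewrite -(euler_criterion cF) ?intr_sign ?signr_odd ?rmorphN1 ?mulrN1z //.
  by rewrite oppr_eq0 oner_neq0.
have -> : ((-1) ^+ odd p./2 == -1 :> int) = odd p./2 by case: odd.
lia.
Qed.

Lemma odd_sum_succ h : odd (\sum_(k < h) k.+1) = ((h %% 4 == 1) || (h %% 4 == 2))%N.
Proof. by elim: h => [|h IH]; rewrite ?big_ord0 // big_ord_recr /= oddD IH; lia. Qed.

Lemma add_legendre2 p : prime p -> p <> 2%N -> add_legendre 2 p = omega p.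
Proof.
move=> p_pr p2; have ph := odd_primeE p_pr p2.
rewrite (@eisenstein_lemma p _ p_pr ph 2); last first.
  by rewrite gtnNdvd //; have := prime_gt1 p_pr; lia.
rewrite [X in (_ + X)%N]big1 ?addn0 => [|k _]; last first.
  by rewrite divn_small //; have := ltn_ord k; lia.
rewrite F2_natr oddM odd_sum_succ /=; congr (nat_of_bool _)%:R; lia.
Qed.

Lemma sum_leq_count m n : (m <= n)%N -> (\sum_(l < n) (l.+1 <= m) = m)%N.
Proof.
elim: n m => [|n IH] m; first by rewrite leqn0 => /eqP ->; rewrite big_ord0.
rewrite big_ord_recr /= leq_eqVlt => /orP[/eqP->|mn].
  rewrite leqnn addn1; congr S; rewrite -[RHS](IH n) //.
  by apply: eq_bigr => l _; have := ltn_ord l; lia.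
by rewrite IH // leqNgt mn addn0.
Qed.

(** Both sums count lattice points of an [h] by [h'] rectangle, on the two sides of its diagonal. No
    point is on the diagonal, since [p] does not divide [q * k.+1]. *)
Lemma eisenstein_lattice p q h h' : prime p -> prime q -> p <> q ->
  p = h.*2.+1 -> q = h'.*2.+1 ->
  (\sum_(k < h) (q * k.+1) %/ p + \sum_(l < h') (p * l.+1) %/ q = h * h')%N.
Proof.
move=> p_pr q_pr pq ph qh.
have E (r s m n : nat) : r = m.*2.+1 -> s = n.*2.+1 ->
  (\sum_(k < m) (s * k.+1) %/ r = \sum_(k < m) \sum_(l < n) (l.+1 * r <= s * k.+1))%N.
  move=> rm sn; apply: eq_bigr => k _.
  rewrite -[LHS](@sum_leq_count _ n); last first.
    by rewrite -ltnS ltn_divLR rm // sn; have := ltn_ord k; nia.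
  by apply: eq_bigr => l _; rewrite leq_divRL rm.
rewrite (E _ _ _ _ ph qh) (E _ _ _ _ qh ph) [X in (_ + X)%N]exchange_big -big_split /=.
under eq_bigr => k _ do rewrite -big_split /=.
transitivity (\sum_(k < h) \sum_(l < h') 1)%N; last by rewrite !sum_nat_const !card_ord muln1.
apply: eq_bigr => k _; apply: eq_bigr => l _.
have : (l.+1 * p != q * k.+1)%N.
  apply: contraTneq (dvdn_mull l.+1 (dvdnn p)) => ->.
  rewrite Euclid_dvdM // dvdn_prime2 // (introF eqP pq) /= gtnNdvd //.
  by have := ltn_ord k; lia.
by rewrite [(p * _)%N]mulnC [(k.+1 * _)%N]mulnC; case: (ltngtP (l.+1 * p) (q * k.+1))%N.
Qed.

Lemma quadratic_reciprocity p q : prime p -> prime q -> p <> 2%N -> q <> 2%N -> p <> q ->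
  add_legendre p q + add_legendre q p = eps p * eps q.
Proof.
move=> p_pr q_pr p2 q2 pq; have ph := odd_primeE p_pr p2; have qh := odd_primeE q_pr q2.
have pq' : ~~ (p %| q)%N by rewrite dvdn_prime2 //; apply/eqP.
have qp' : ~~ (q %| p)%N by rewrite dvdn_prime2 // eq_sym; apply/eqP.
rewrite (eisenstein_lemma p_pr ph pq') (eisenstein_lemma q_pr qh qp').
have op : odd p by rewrite ph /= odd_double.
have oq : odd q by rewrite qh /= odd_double.
rewrite -natrD F2_natr !oddD !oddM /= op oq /= !addbb !addFb addbC -oddD.
rewrite (eisenstein_lattice p_pr q_pr pq ph qh) /eps -natrM mulnb oddM.
by congr (nat_of_bool _)%:R; congr (_ && _); lia.
Qed.

Lemma add_legendre_theta (a : int) : ~~ (3 %| a)%Z -> add_legendre a 3 = theta a.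
Proof.
move=> a3; have n32 : 3%N <> 2%N by [].
rewrite /theta; have [h|h] : (a %% 3)%Z = 1 \/ (a %% 3)%Z = 2 by lia.
  by rewrite (@add_legendre_mod 3 isT a 1) ?(@add_legendre1 3 1) // ?h //; lia.
by rewrite (@add_legendre_mod 3 isT a (-1)) ?add_legendreN1 // ?h //; lia.
Qed.

(** The sign in the reciprocity between 3 and [p] is the symbol of -1 at [p]; this makes [- 3],
    rather than 3, depend on [p] modulo 3 only. *)
Lemma add_legendreN3 p : prime p -> p <> 2%N -> p <> 3%N -> add_legendre (- 3) p = theta p.
Proof.
move=> p_pr p2 p3; have ph := odd_primeE p_pr p2.
have p3' : ~~ (p %| 3)%N by rewrite dvdn_prime2 //; apply/eqP.
have p1' : ~~ (p %| 1)%N by rewrite gtnNdvd // prime_gt1.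
rewrite -[add_legendre (- 3) p]/(add_legendre (-1 * 3%:Z) p).
rewrite (add_legendreM p_pr ph) // add_legendreN1 //.
have n32 : 3%N <> 2%N by [].
have := quadratic_reciprocity (isT : prime 3) p_pr n32 p2 (nesym p3).
rewrite {1}/eps /= mul1r => <-; rewrite addrAC F2_addxx add0r add_legendre_theta //.
by rewrite dvdzE /= dvdn_prime2 //; apply/eqP; exact: nesym.
Qed.

Lemma odd_res8 (a : int) : ~~ (2 %| a)%Z ->
  [\/ (a %% 8)%Z = 1, (a %% 8)%Z = 3, (a %% 8)%Z = 5 | (a %% 8)%Z = 7].
Proof.
move=> a2; have H : (a %% 8)%Z = 1 \/ (a %% 8)%Z = 3 \/ (a %% 8)%Z = 5 \/ (a %% 8)%Z = 7.
  by lia.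
by case: H => [|[|[]]] H; [constructor 1|constructor 2|constructor 3|constructor 4].
Qed.

Lemma odd_res8M (a b r s : int) : (a %% 8)%Z = r -> (b %% 8)%Z = s ->
  ((a * b) %% 8)%Z = ((r * s) %% 8)%Z.
Proof. by move=> <- <-; rewrite modzMm. Qed.

Lemma eps_res8 (a : int) : eps a = (((a %% 8)%Z %% 4)%Z == 3)%:R.
Proof. by rewrite /eps; congr (nat_of_bool _)%:R; lia. Qed.

Lemma epsM (a b : int) : ~~ (2 %| a)%Z -> ~~ (2 %| b)%Z -> eps (a * b) = eps a + eps b.
Proof.
move=> /odd_res8 ha /odd_res8 hb; rewrite !eps_res8.
by case: ha => ha; case: hb => hb; rewrite (odd_res8M ha hb) ha hb; apply: val_inj.
Qed.

Lemma omegaM (a b : int) : ~~ (2 %| a)%Z -> ~~ (2 %| b)%Z ->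
  omega (a * b) = omega a + omega b.
Proof.
move=> /odd_res8 ha /odd_res8 hb; rewrite /omega.
by case: ha => ha; case: hb => hb; rewrite (odd_res8M ha hb) ha hb; apply: val_inj.
Qed.

(** * Torsors and their p-adic points *)

Section Torsor.
Variable K : fieldType.
Implicit Types d b r s t u : K.

Definition torsor d b1 b2 b3 : Prop :=
  exists z0 z1 z2 z3 : K, [/\ (z0, z1, z2, z3) != (0, 0, 0, 0),
    b1 * z1 ^+ 2 - b2 * z2 ^+ 2 = d * z0 ^+ 2 &
    b1 * z1 ^+ 2 - b3 * z3 ^+ 2 = - (3 * d) * z0 ^+ 2].

Lemma torsor_scale d b1 b2 b3 r s t u : r != 0 -> s != 0 -> t != 0 -> u != 0 ->
  torsor d b1 b2 b3 -> torsor (d * r ^+ 2) (b1 * s ^+ 2) (b2 * t ^+ 2) (b3 * u ^+ 2).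
Proof.
move=> r0 s0 t0 u0 [z0 [z1 [z2 [z3 [nz e1 e2]]]]].
exists (z0 / r), (z1 / s), (z2 / t), (z3 / u).
have E (c z v : K) : v != 0 -> c * v ^+ 2 * (z / v) ^+ 2 = c * z ^+ 2 by move=> v0; field.
split.
- move: nz; rewrite !xpair_eqE !mulf_eq0 !invr_eq0.
  by rewrite (negPf r0) (negPf s0) (negPf t0) (negPf u0) !orbF.
- by rewrite !E.
- by rewrite [in RHS]mulrA -[in RHS]mulNr !E.
Qed.

Lemma torsor_rescale d b1 b2 b3 r s t u : r != 0 -> s != 0 -> t != 0 -> u != 0 ->
  torsor (d * r ^+ 2) (b1 * s ^+ 2) (b2 * t ^+ 2) (b3 * u ^+ 2) <-> torsor d b1 b2 b3.
Proof.
move=> r0 s0 t0 u0; split; last exact: torsor_scale.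
move=> H; have V (v : K) : v != 0 -> v^-1 != 0 by rewrite invr_eq0.
have := torsor_scale (V r r0) (V s s0) (V t t0) (V u u0) H.
have E (c v : K) : v != 0 -> c * v ^+ 2 * v^-1 ^+ 2 = c by move=> v0; field.
by rewrite !E.
Qed.

Definition square_in (a : int) : Prop := exists s : K, s ^+ 2 = a%:~R.

(* In the torsors of interest [b3 = b1 * b2] up to squares; a separate [b3] lets
   square factors be removed from each coefficient. *)
Definition torsorZ (d b1 b2 b3 : int) : Prop :=
  torsor d%:~R b1%:~R b2%:~R b3%:~R.

Hypothesis K0 : forall a : int, a != 0 -> a%:~R != 0 :> K.

Lemma intr_eq0_char0 (a : int) : (a%:~R == 0 :> K) = (a == 0).
Proof. by apply/idP/eqP => [|->//]; apply: contraTeq => /K0. Qed.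

Lemma square_in_ratio (a b : int) : a != 0 -> b != 0 -> square_in (a * b) ->
  exists2 s : K, s != 0 & b%:~R = a%:~R * s ^+ 2.
Proof.
move=> a0 b0 [s sE]; have := K0 a0; have := K0 b0 => b0' a0'.
have s0 : s != 0.
  by rewrite -sqrf_eq0 sE intr_eq0_char0 mulf_neq0.
exists (s / a%:~R); first by rewrite mulf_neq0 ?invr_eq0.
by rewrite expr_div_n sE intrM; field.
Qed.

(** Each of the four coefficients matters only up to a square of [K], independently of the others.
    Every place uses this to normalize them. *)
Lemma torsorZ_square (d b1 b2 b3 d' b1' b2' b3' : int) :
  d != 0 -> b1 != 0 -> b2 != 0 -> b3 != 0 ->
  d' != 0 -> b1' != 0 -> b2' != 0 -> b3' != 0 ->
  square_in (d * d') -> square_in (b1 * b1') -> square_in (b2 * b2') ->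
  square_in (b3 * b3') ->
  torsorZ d b1 b2 b3 <-> torsorZ d' b1' b2' b3'.
Proof.
rewrite /torsorZ => d0 b10 b20 b30 d0' b10' b20' b30'.
move=> /(square_in_ratio d0 d0')[r r0 ->] /(square_in_ratio b10 b10')[s s0 ->].
move=> /(square_in_ratio b20 b20')[t t0 ->] /(square_in_ratio b30 b30')[u u0 ->].
by rewrite torsor_rescale.
Qed.

(** [ratr] divides a numerator by a denominator inside [K], so multiplicativity rests on
    denominators staying nonzero there. *)
Lemma ratrM_char0 : {morph (@ratr K) : x y / x * y}.
Proof.
move=> x y; rewrite /ratr.
have nz z : (denq z)%:~R != 0 :> K by rewrite intr_eq0_char0 denq_neq0.
have := mulf_neq0 (nz x) (nz y); have := nz (x * y).
move=> H1 H2; apply/eqP; rewrite mulf_div eqr_div // -!intrM; apply/eqP; congr (_%:~R).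
have N z : (numq z)%:~R = z * (denq z)%:~R :> rat by rewrite numqE.
by apply: (@intr_inj rat); rewrite !intrM /= !N; ring.
Qed.

Lemma ratr_neq0_char0 x : x != 0 -> ratr x != 0 :> K.
Proof.
by move=> x0; rewrite mulf_eq0 invr_eq0 !intr_eq0_char0 numq_eq0 denq_eq0 negb_or x0.
Qed.

Lemma torsor_has_pointE (n : int) (b1 b2 : rat) :
  torsor_has_point K 0 n%:~R (- (3 * n%:~R)) b1 b2 <->
  torsor n%:~R (ratr b1) (ratr b2) (ratr (b1 * b2)).
Proof.
rewrite /torsor_has_point /torsor !subr0 ratr_int.
have -> : - (3 * n%:~R) = (- (3 * n))%:~R :> rat by rewrite intrN intrM.
by rewrite ratr_int intrN intrM.
Qed.

Lemma torsor_has_pointZ (n : int) (b1 b2 s1 s2 : rat) (m1 m2 : int) :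
  s1 != 0 -> s2 != 0 -> b1 = m1%:~R * s1 ^+ 2 -> b2 = m2%:~R * s2 ^+ 2 ->
  torsor_has_point K 0 n%:~R (- (3 * n%:~R)) b1 b2 <-> torsorZ n m1 m2 (m1 * m2).
Proof.
move=> s10 s20 -> ->; rewrite torsor_has_pointE mulrACA -exprMn -intrM.
have E (m : int) (s : rat) : ratr (m%:~R * s ^+ 2) = m%:~R * ratr s ^+ 2 :> K.
  by rewrite !expr2 !ratrM_char0 ratr_int.
have s30 := mulf_neq0 s10 s20; rewrite !E -[X in torsor X]mulr1 -[X in _ * X](expr1n _ 2).
by rewrite torsor_rescale ?ratr_neq0_char0 ?oner_neq0.
Qed.
End Torsor.

Lemma fraction_numden (R : idomainType) (x : {fraction R}) :
  exists (n d : R), d != 0 /\ x * tofrac d = tofrac n.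
Proof.
elim/quotW: x => x; exists (frac x).1, (frac x).2; split; first exact: denom_ratioP.
unlock FracField.tofrac; rewrite -[LHS]FracField.pi_mul; apply/eqmodP.
rewrite /= FracField.equivfE /FracField.mulf !numden_Ratio ?oner_eq0 ?mulf_neq0
  ?denom_ratioP ?oner_neq0 //.
by rewrite !mulr1 mulrC.
Qed.

(** Replaces a point by its primitive multiple: [D] is a common denominator of the coordinates and
    [c] their common factor once it is cleared. *)
Lemma quadric_rescale (F : fieldType) (a0 a1 a2 z0 z1 z2 f0 f1 f2 c D : F) : c != 0 ->
  z0 * D = c * f0 -> z1 * D = c * f1 -> z2 * D = c * f2 ->
  a1 * z1 ^+ 2 - a2 * z2 ^+ 2 = a0 * z0 ^+ 2 ->
  a1 * (f1 * f1) - a2 * (f2 * f2) - a0 * (f0 * f0) = 0.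
Proof.
move=> c0 E0 E1 E2 E; apply: (mulfI (mulf_neq0 c0 c0)); rewrite mulr0.
transitivity (a1 * (c * f1) ^+ 2 - a2 * (c * f2) ^+ 2 - a0 * (c * f0) ^+ 2).
  by ring.
rewrite -E0 -E1 -E2.
transitivity ((a1 * z1 ^+ 2 - a2 * z2 ^+ 2 - a0 * z0 ^+ 2) * D ^+ 2); first by ring.
by rewrite E subrr mul0r.
Qed.

(** * Residues of p-adic points and lifting of square roots *)

Section Padic.
Variables (p : nat) (p_pr : prime p).
Local Notation Zp := (padic_int p_pr).
Local Notation K := (padic p_pr).
Local Notation q k := (p%:Z ^+ k).
Implicit Types (x y z : Zp) (k : nat) (a b : int).

Lemma padic_intrE a k : (a%:~R : Zp) k = (a %% q k)%Z.
Proof.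
elim/int_ind: a => [|n IH|n IH]; first exact: erefl.
  by rewrite -addn1 PoszD intrD -modzDm -IH; exact: erefl.
  by rewrite -addn1 PoszD opprD intrD -modzDm -IH -[(-1 %% _)%Z]modzNm intrN; exact: erefl.
Qed.

Lemma padic_char0 a : a != 0 -> a%:~R != 0 :> K.
Proof.
move=> a0; rewrite -(rmorph_int (@tofrac Zp)) tofrac_eq0; apply/negP => /eqP a0'.
(* The level [|a|] suffices, because [p ^ |a|] exceeds [|a|] and cannot divide [a]. *)
have := congr1 (fun x : Zp => x `|a|%N) a0'; rewrite padic_intrE /= mod0z => /dvdz_mod0P.
rewrite dvdzE abszX => /dvdn_leq; rewrite absz_gt0 => /(_ a0).
by rewrite leqNgt ltn_expl // prime_gt1.
Qed.

Definition approx k x a : Prop := (q k %| x k - a)%Z.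

Lemma approx_refl k x : approx k x (x k).
Proof. by rewrite /approx subrr. Qed.

Lemma approx_int k a : approx k a%:~R a.
Proof. by rewrite /approx padic_intrE -eqz_mod_dvd modz_mod. Qed.

Lemma approxD k x y a b : approx k x a -> approx k y b -> approx k (x + y) (a + b).
Proof.
rewrite /approx -!eqz_mod_dvd /= modz_mod => /eqP xa /eqP yb.
by rewrite -modzDm xa yb modzDm.
Qed.

Lemma approxM k x y a b : approx k x a -> approx k y b -> approx k (x * y) (a * b).
Proof.
rewrite /approx -!eqz_mod_dvd /= modz_mod => /eqP xa /eqP yb.
by rewrite -modzMm xa yb modzMm.
Qed.

Lemma approxN k x a : approx k x a -> approx k (- x) (- a).
Proof.
rewrite /approx -!eqz_mod_dvd /= modz_mod => /eqP xa.
by rewrite -modzNm xa modzNm.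
Qed.

Lemma approx_quadric k a b c x y z :
  approx k (a%:~R * (x * x) - b%:~R * (y * y) - c%:~R * (z * z))
    (a * x k ^+ 2 - b * y k ^+ 2 - c * z k ^+ 2).
Proof.
have sq t e : approx k (e%:~R * (t * t)) (e * t k ^+ 2).
  exact: approxM (approx_int k e) (approxM (approx_refl k t) (approx_refl k t)).
exact: approxD (approxD (sq x a) (approxN (sq y b))) (approxN (sq z c)).
Qed.

Lemma approx0 k a : approx k 0 a -> (q k %| a)%Z.
Proof. by rewrite /approx /= mod0z sub0r rpredN. Qed.

Lemma padic_divp x : x 1%N = 0 -> exists y, x = p%:Z%:~R * y.
Proof.
move=> x1; have p0 : p%:Z != 0 by have := prime_gt0 p_pr; lia.
have dv k : (p%:Z %| x k.+1)%Z.
  apply/dvdz_mod0P; rewrite -[p%:Z]expr1 (padic_res_mod_le x (isT : (1 <= k.+1)%N)).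
  by rewrite x1 mod0z.
have st k : (((x k.+2) %/ p%:Z)%Z = (x k.+1 %/ p%:Z)%Z %[mod q k])%Z.
  apply/eqP; rewrite eqz_mod_dvd -(dvdz_mul2l p0) -exprS mulrBr.
  by rewrite ![p%:Z * _]mulrC !divzK ?dv // -eqz_mod_dvd; apply/eqP/padic_res_step.
(* Division by [p] loses one digit, so level [k] of the quotient is read at level [k.+1] of [x]. *)
exists (padic_of p_pr (f := fun k => (x k.+1 %/ p%:Z)%Z) st).
apply: padic_eqP => k /=; rewrite padic_intrE modzMml modzMmr mulrC divzK ?dv //.
by rewrite padic_resS.
Qed.

(** Induction on a level [k] at which some entry is nonzero: if all entries vanish modulo [p],
    dividing them by [p] lowers the level. The condition [u i 1%N != 0] says that [u i] is nonzero
    modulo [p]. *)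
Lemma padic_primitive (I : Type) (w : I -> Zp) : (exists i, w i != 0) ->
  exists (c : Zp) (u : I -> Zp),
    [/\ c != 0, forall i, w i = c * u i & exists i, u i 1%N != 0].
Proof.
case=> i /padic_neq0P[k]; elim: k w i => [|k IH] w i; first by rewrite expr0 dvd1z.
move=> wk; have [[j wj]|w1] := pselect (exists j, w j 1%N != 0).
  exists 1, w; split; rewrite ?oner_neq0 //; last by exists j.
  by move=> l; rewrite mul1r.
have {w1} /choice[y yE] j : exists y, w j = p%:Z%:~R * y.
  by apply: padic_divp; apply/eqP; apply: contra_notT w1 => wj; exists j.
have p0 : p%:Z != 0 by have := prime_gt0 p_pr; lia.
have : ~~ (q k %| y i k)%Z.
  apply: contra wk => yk; rewrite yE /= padic_intrE modzMml.
  apply/dvdz_mod0P; rewrite modz_mod; apply/dvdz_mod0P.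
  rewrite exprS dvdz_mul2l //; apply/dvdz_mod0P; rewrite padic_res_step.
  exact/dvdz_mod0P.
case/IH => c [u [c0 uE u1]]; exists (p%:Z%:~R * c), u; split => // [|j].
  rewrite mulf_neq0 // -(tofrac_eq0 (p%:Z%:~R : Zp)) rmorph_int padic_char0 //.
by rewrite yE uE mulrA.
Qed.

(** The source of all p-adic obstructions: denominators are cleared, the common factor is removed,
    and the primitive point is truncated at level [k]. *)
Lemma torsorZ_residues d b1 b2 b3 : torsorZ K d b1 b2 b3 ->
  forall k, (0 < k)%N -> exists a0 a1 a2 a3 : int,
  [/\ ~~ [&& (p%:Z %| a0)%Z, (p%:Z %| a1)%Z, (p%:Z %| a2)%Z & (p%:Z %| a3)%Z],
      (q k %| b1 * a1 ^+ 2 - b2 * a2 ^+ 2 - d * a0 ^+ 2)%Z &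
      (q k %| b1 * a1 ^+ 2 - b3 * a3 ^+ 2 + 3 * d * a0 ^+ 2)%Z].
Proof.
case=> z0 [z1 [z2 [z3 [nz e1 e2]]]] k k0.
have [n0 [d0 [d00 E0]]] := fraction_numden z0.
have [n1 [d1 [d10 E1]]] := fraction_numden z1.
have [n2 [d2 [d20 E2]]] := fraction_numden z2.
have [n3 [d3 [d30 E3]]] := fraction_numden z3.
pose D := d0 * d1 * d2 * d3.
have D0 : D != 0 by rewrite !mulf_neq0.
pose w (i : 'I_4) := nth 0
  [:: n0 * d1 * d2 * d3; n1 * d0 * d2 * d3; n2 * d0 * d1 * d3; n3 * d0 * d1 * d2] i.
pose z (i : 'I_4) := nth 0 [:: z0; z1; z2; z3] i.
have wz i : tofrac (w i) = z i * tofrac D.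
  case: i => [[|[|[|[|//]]]] ilt]; rewrite /w /z /D /= !rmorphM /= -?E0 -?E1 -?E2 -?E3; ring.
have [i wi] : exists i, w i != 0.
  apply: contrapT => /forallNP H; move/negP: nz; apply.
  have zi i : z i = 0.
    have := wz i; have /negP/negPn/eqP -> := H i; rewrite tofrac0 => /esym/eqP.
    by rewrite mulf_eq0 tofrac_eq0 (negPf D0) orbF => /eqP.
  have := zi (inord 0); have := zi (inord 1); have := zi (inord 2); have := zi (inord 3).
  by rewrite /z !inordK //= => -> -> -> ->.
have [c [u [c0 uE [j uj]]]] := padic_primitive (ex_intro _ i wi).
exists (u (inord 0) k), (u (inord 1) k), (u (inord 2) k), (u (inord 3) k).
have zu i' : z i' * tofrac D = tofrac c * tofrac (u i') by rewrite -tofracM -uE wz.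
have cF : tofrac c != 0 :> K by rewrite tofrac_eq0.
have z0E : z (inord 0) = z0 by rewrite /z inordK.
have z1E : z (inord 1) = z1 by rewrite /z inordK.
have z2E : z (inord 2) = z2 by rewrite /z inordK.
have z3E : z (inord 3) = z3 by rewrite /z inordK.
have := zu (inord 0); have := zu (inord 1); have := zu (inord 2); have := zu (inord 3).
rewrite z0E z1E z2E z3E => u3E u2E u1E u0E.
split.
- apply: contra uj => /and4P[h0 h1 h2 h3]; apply/eqP; rewrite -padic_res_mod expr1.
  have : (p%:Z %| u j k)%Z.
    have : j \in [:: inord 0; inord 1; inord 2; inord 3].
      by case: j => [[|[|[|[|//]]]] jlt]; rewrite !inE -!val_eqE /= !inordK.
    by rewrite !inE => /or4P[]/eqP->.
  move=> h; have := padic_res_mod_le (u j) k0; rewrite expr1 => <-.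
  exact/dvdz_mod0P.
- apply: approx0; rewrite -[0](_ : b1%:~R * (u (inord 1) * u (inord 1))
    - b2%:~R * (u (inord 2) * u (inord 2)) - d%:~R * (u (inord 0) * u (inord 0)) = 0).
    exact: approx_quadric.
  apply/eqP; rewrite -tofrac_eq0 !tofracB !tofracM !rmorph_int; apply/eqP.
  exact: (quadric_rescale cF u0E u1E u2E e1).
- rewrite -[3 * d]opprK mulNr; apply: approx0.
  rewrite -[0](_ : b1%:~R * (u (inord 1) * u (inord 1))
    - b3%:~R * (u (inord 3) * u (inord 3)) - (- (3 * d))%:~R * (u (inord 0) * u (inord 0)) = 0).
    exact: approx_quadric.
  apply/eqP; rewrite -tofrac_eq0 !tofracB !tofracM !rmorph_int; apply/eqP.
  apply: (quadric_rescale cF u0E u1E u3E); rewrite intrN intrM; exact: e2.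
Qed.

(** The part of Hensel's lemma common to all primes. The invariant [Q] may hold at a higher
    precision than [k]: one more digit for odd [p], three more for [p = 2]. *)
Lemma padic_square_of_steps (Q : nat -> int -> Prop) a s :
  Q 0%N s -> (forall k s, Q k s -> (q k %| s ^+ 2 - a)%Z) ->
  (forall k s, Q k s -> exists s', Q k.+1 s' /\ (q k %| s' - s)%Z) ->
  square_in K a.
Proof.
move=> Q0 Qa Qs.
have step k (u : {s | Q k s}) : {s' : {s | Q k.+1 s} | (q k %| sval s' - sval u)%Z}.
  apply: cid; case: u => s' Qs' /=; have [s'' [Q'' D]] := Qs _ _ Qs'.
  by exists (exist _ s'' Q'').
pose f := fix f k : {s | Q k s} := if k is k.+1 then sval (step k (f k)) else exist _ s Q0.
have fP k : (sval (f k.+1) = sval (f k) %[mod q k])%Z.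
  by apply/eqP; rewrite eqz_mod_dvd /=; exact: (svalP (step k (f k))).
exists (tofrac (padic_of p_pr fP)); rewrite -rmorphXn -(rmorph_int (@tofrac Zp)); congr tofrac.
apply: padic_eqP => k; rewrite expr2 padic_intrE /= modzMml modzMmr -expr2.
apply/eqP; rewrite eqz_mod_dvd; apply: Qa; exact: svalP.
Qed.

Lemma padic_square_odd a : p <> 2%N -> ~~ (p%:Z %| a)%Z ->
  (exists x : int, (p%:Z %| x ^+ 2 - a)%Z) -> square_in K a.
Proof.
move=> p2 pa [x xa].
pose Q k (s : int) := (q k.+1 %| s ^+ 2 - a)%Z.
have pdiv k s : Q k s -> ~~ (p%:Z %| s)%Z.
  rewrite /Q [q _.+1]exprS => H; apply: contra pa => ps.
  have : (p%:Z %| s ^+ 2 - a)%Z by apply: dvdz_trans H; apply: dvdz_mulr.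
  move=> h; have -> : a = s ^+ 2 - (s ^+ 2 - a) by ring.
  by rewrite rpredB // dvdz_exp.
apply: (@padic_square_of_steps Q a x); first by rewrite /Q expr1.
  by move=> k s; apply: dvdz_trans; rewrite [q _.+1]exprS dvdz_mull.
move=> k s Qs; have ps := pdiv k s Qs.
have cop : coprimez (2 * s) p%:Z.
  rewrite coprimezE coprime_sym prime_coprime // abszM Euclid_dvdM //.
  rewrite negb_or; apply/andP; split; last by [].
  by rewrite dvdn_prime2 //; apply/eqP.
have [[u v] /= uv] := coprimezP _ _ cop.
have [c cE] := dvdzP Qs.
(* Newton's step: [c] is the error divided by [p ^ k.+1], and the Bezout coefficient [u] inverts the
   derivative [2 * s] modulo [p]. *)
exists (s - c * u * q k.+1); split; last first.
  by rewrite addrAC subrr sub0r rpredN [q _.+1]exprS mulrA dvdz_mull.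
rewrite /Q; apply/dvdzP.
exists (c * v + c ^+ 2 * u ^+ 2 * q k).
have -> : (s - c * u * q k.+1) ^+ 2 - a
  = (s ^+ 2 - a) - c * q k.+1 * (u * (2 * s)) + (c * u * q k.+1) ^+ 2 by ring.
have -> : u * (2 * s) = 1 - v * p%:Z by apply/eqP; rewrite eq_sym subr_eq uv.
by rewrite cE (exprS _ k.+1) (exprS _ k); ring.
Qed.
End Padic.

Lemma padic_square_two (two_pr : prime 2) (a : int) : (8 %| a - 1)%Z -> square_in (padic two_pr) a.
Proof.
move=> a8; pose Q k (s : int) := (2%:Z ^+ (k + 3) %| s ^+ 2 - a)%Z.
apply: (@padic_square_of_steps 2 two_pr Q a 1).
- by rewrite /Q add0n expr1n -opprB rpredN.
- by move=> k s; apply: dvdz_trans; rewrite exprD dvdz_mulr.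
move=> k s Qs; have [c cE] := dvdzP Qs.
have s_odd : (2 %| 1 + s)%Z.
  have : (8 %| s ^+ 2 - a)%Z by apply: dvdz_trans Qs; rewrite exprD dvdz_mull.
  move=> /dvdzP[e eE]; have /dvdzP[f fE] := a8.
  have sE : s * s = 8 * (e + f) + 1 by rewrite -expr2; lia.
  have sd : s = 2 * (s %/ 2)%Z + (s %% 2)%Z by lia.
  have [s0|s0] : (s %% 2)%Z = 0 \/ (s %% 2)%Z = 1 by lia.
    by move: sE; rewrite sd s0; nia.
  by lia.
have [m mE] := dvdzP s_odd.
(* The error [c * 2 ^ (k + 3)] becomes [c * 2 ^ (k + 3) * (1 + s)] plus a multiple of [2 ^ (k + 4)].
   As [1 + s] is even, one binary digit is gained. *)
exists (s + c * 2%:Z ^+ (k + 2)); split; last first.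
  by rewrite addrAC subrr add0r exprD mulrCA dvdz_mulr.
rewrite /Q; apply/dvdzP; exists (c * m + c ^+ 2 * 2%:Z ^+ k).
have -> : (s + c * 2%:Z ^+ (k + 2)) ^+ 2 - a
  = (s ^+ 2 - a) + 2 * c * 2%:Z ^+ (k + 2) * s + (c * 2%:Z ^+ (k + 2)) ^+ 2 by ring.
rewrite cE; have -> : s = m * 2 - 1 by rewrite -mE addrC addKr.
by rewrite addSn !exprS !exprD; ring.
Qed.

(** * Local solvability *)

Section TorsorSections.
Variable K : fieldType.
Hypothesis K0 : forall a : int, a != 0 -> a%:~R != 0 :> K.
Implicit Types d b a : int.

(** Once [z0] and one more coordinate are fixed, each remaining coordinate occurs in a single
    equation, after elimination if necessary. The constants 1, 3, 4 in the three variants are the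
    differences of the roots divided by [d]. *)
Lemma torsorZ_fix01 d b1 b2 b3 a0 a1 : b2 != 0 -> b3 != 0 -> (a0 != 0) || (a1 != 0) ->
  square_in K (b2 * (b1 * a1 ^+ 2 - d * a0 ^+ 2)) ->
  square_in K (b3 * (b1 * a1 ^+ 2 + 3 * d * a0 ^+ 2)) -> torsorZ K d b1 b2 b3.
Proof.
move=> /K0 b20 /K0 b30 a01 [s sE] [t tE].
exists a0%:~R, a1%:~R, (s / b2%:~R), (t / b3%:~R); split.
- by rewrite !xpair_eqE !(intr_eq0_char0 K0); case/orP: a01 => /negPf ->; rewrite ?andbF.
- by rewrite expr_div_n sE !(intrM, intrB, intrD, rmorphXn) /=; field.
- by rewrite expr_div_n tE !(intrM, intrB, intrD, rmorphXn) /=; field.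
Qed.

Lemma torsorZ_fix02 d b1 b2 b3 a0 a2 : b1 != 0 -> b3 != 0 -> (a0 != 0) || (a2 != 0) ->
  square_in K (b1 * (b2 * a2 ^+ 2 + d * a0 ^+ 2)) ->
  square_in K (b3 * (b2 * a2 ^+ 2 + 4 * d * a0 ^+ 2)) -> torsorZ K d b1 b2 b3.
Proof.
move=> /K0 b10 /K0 b30 a01 [s sE] [t tE].
exists a0%:~R, (s / b1%:~R), a2%:~R, (t / b3%:~R); split.
- by rewrite !xpair_eqE !(intr_eq0_char0 K0); case/orP: a01 => /negPf ->; rewrite ?andbF.
- by rewrite expr_div_n sE !(intrM, intrB, intrD, rmorphXn) /=; field.
- by rewrite !expr_div_n sE tE !(intrM, intrB, intrD, rmorphXn) /=; field; apply/andP.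
Qed.

Lemma torsorZ_fix03 d b1 b2 b3 a0 a3 : b1 != 0 -> b2 != 0 -> (a0 != 0) || (a3 != 0) ->
  square_in K (b1 * (b3 * a3 ^+ 2 - 3 * d * a0 ^+ 2)) ->
  square_in K (b2 * (b3 * a3 ^+ 2 - 4 * d * a0 ^+ 2)) -> torsorZ K d b1 b2 b3.
Proof.
move=> /K0 b10 /K0 b20 a01 [s sE] [t tE].
exists a0%:~R, (s / b1%:~R), (t / b2%:~R), a3%:~R; split.
- by rewrite !xpair_eqE !(intr_eq0_char0 K0); case/orP: a01 => /negPf ->; rewrite ?andbF.
- by rewrite !expr_div_n sE tE !(intrM, intrB, intrD, rmorphXn) /=; field; apply/andP.
- by rewrite expr_div_n sE !(intrM, intrB, intrD, rmorphXn) /=; field.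
Qed.

Lemma square_inM a b : square_in K a -> square_in K b -> square_in K (a * b).
Proof. by case=> s sE [t tE]; exists (s * t); rewrite exprMn sE tE intrM. Qed.

Lemma square_in_sqr a : square_in K (a ^+ 2).
Proof. by exists a%:~R; rewrite rmorphXn. Qed.
End TorsorSections.

(** * Odd places, and solubility at good reduction *)

Section OddPlace.
Variables (p : nat) (p_pr : prime p).
Hypothesis p2 : p <> 2%N.
Local Notation K := (padic p_pr).
Local Notation al a := (add_legendre a p).
Implicit Types a b c d m u w : int.

Let ph := odd_primeE p_pr p2.
Let K0 := padic_char0 p_pr.

Lemma ndvdzM a b : ~~ (p%:Z %| a * b)%Z = ~~ (p%:Z %| a)%Z && ~~ (p%:Z %| b)%Z.
Proof. by rewrite !dvdzE abszM Euclid_dvdM // negb_or. Qed.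

Lemma ndvdzX a n : ~~ (p%:Z %| a)%Z -> ~~ (p%:Z %| a ^+ n)%Z.
Proof. by move=> pa; rewrite dvdzE abszX Euclid_dvdX // negb_and -dvdzE pa. Qed.

Lemma ndvdz_neq0 a : ~~ (p%:Z %| a)%Z -> a != 0.
Proof. by apply: contraNneq => ->; rewrite dvdz0. Qed.

Lemma dvdz_coef c a : ~~ (p%:Z %| c)%Z -> (p%:Z %| c * a ^+ 2)%Z -> (p%:Z %| a)%Z.
Proof. by move=> pc; apply: contraLR => pa; rewrite ndvdzM pc ndvdzX. Qed.

Lemma ndvdz2 : ~~ (p%:Z %| 2%:R)%Z.
Proof. by rewrite dvdzE /= dvdn_prime2 //; apply/eqP. Qed.

Lemma ndvdz4 : ~~ (p%:Z %| 4%:R)%Z.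
Proof. by rewrite (_ : 4%:R = 2%:R * 2%:R) // ndvdzM ndvdz2. Qed.

Lemma ndvdzN a : ~~ (p%:Z %| - a)%Z = ~~ (p%:Z %| a)%Z.
Proof. by rewrite !dvdzE abszN. Qed.

Lemma alM a b : ~~ (p%:Z %| a)%Z -> ~~ (p%:Z %| b)%Z -> al (a * b) = al a + al b.
Proof. exact: add_legendreM ph _ _. Qed.

Lemma al4 : al 4 = 0.
Proof. by rewrite (_ : (4 : int) = 2 ^+ 2) // (add_legendre_sqr p_pr ph). Qed.

Lemma al_square_in a : ~~ (p%:Z %| a)%Z -> al a = 0 -> square_in K a.
Proof. by move=> pa /(add_legendre_eq0 p_pr pa) /(padic_square_odd p_pr p2 pa). Qed.

Lemma al_eq c1 c2 a b : ~~ (p%:Z %| c1)%Z -> ~~ (p%:Z %| c2)%Z -> ~~ (p%:Z %| a)%Z ->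
  (p%:Z %| c1 * a ^+ 2 - c2 * b ^+ 2)%Z -> al c1 = al c2.
Proof.
move=> pc1 pc2 pa h.
have pb : ~~ (p%:Z %| b)%Z.
  apply: contraTN h => pb; apply: contraNN (_ : ~~ (p%:Z %| c1 * a ^+ 2)%Z).
    move=> h; rewrite -(subrK (c2 * b ^+ 2) (c1 * _)) rpredD // dvdz_mull //.
    exact: dvdz_exp.
  by rewrite ndvdzM pc1 ndvdzX.
have := add_legendre_mod p_pr h.
by rewrite (alM pc1 (ndvdzX 2 pa)) (alM pc2 (ndvdzX 2 pb)) !(add_legendre_sqr p_pr ph) !addr0.
Qed.

Lemma dvdz_p2 a : ((p%:Z) ^+ 2 %| a)%Z -> (p%:Z %| a)%Z.
Proof. by apply: dvdz_trans; rewrite expr2 dvdz_mulr. Qed.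

Lemma dvdz_p2_cancel a : ((p%:Z) ^+ 2 %| p%:Z * a)%Z -> (p%:Z %| a)%Z.
Proof. by rewrite expr2 dvdz_mul2l // eqz_nat -lt0n prime_gt0. Qed.

Lemma dvdz_p2_sqr a b : (p%:Z %| a)%Z -> ((p%:Z) ^+ 2 %| b * a ^+ 2)%Z.
Proof. by move=> pa; rewrite dvdz_mull // dvdz_exp2r. Qed.

Lemma square_in_Fp a (y : 'F_p) : y != 0 -> a%:~R = y ^+ 2 -> square_in K a.
Proof.
move=> y0 aE; have pa : ~~ (p%:Z %| a)%Z.
  by rewrite -(intr_Fp_eq0 p_pr) aE expf_neq0.
apply: padic_square_odd => //; apply/(is_square_Fp p_pr)/is_squareP.
by exists y.
Qed.

(** A square root lifts only from a nonzero residue. Since the roots stay distinct, at most one of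
    [z1], [z2], [z3] vanishes; each alternative names two nonzero coordinates to solve for, the
    other two being fixed. *)
Lemma torsor_vanishing (F : fieldType) (d b1 b2 z0 z1 z2 z3 : F) :
  d != 0 -> 3%:R != 0 :> F -> 4%:R != 0 :> F -> b1 != 0 -> b2 != 0 ->
  (z0, z1, z2, z3) != (0, 0, 0, 0) ->
  b1 * z1 ^+ 2 = b2 * z2 ^+ 2 + d * z0 ^+ 2 ->
  b1 * b2 * z3 ^+ 2 = b2 * z2 ^+ 2 + 4 * d * z0 ^+ 2 ->
  [\/ z2 != 0 /\ z3 != 0,
      [/\ z2 = 0, z0 != 0, z1 != 0 & z3 != 0] |
      [/\ z3 = 0, z0 != 0, z1 != 0 & z2 != 0]].
Proof.
move=> d0 d3 d4 b10 b20 nz e1 e2.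
have sq0 (c z : F) : c != 0 -> c * z ^+ 2 = 0 -> z = 0.
  by move=> c0 /eqP; rewrite mulf_eq0 (negPf c0) sqrf_eq0 => /eqP.
have b30 := mulf_neq0 b10 b20; have d40 := mulf_neq0 d4 d0.
have [z20|z20] := eqVneq z2 0.
  rewrite z20 expr0n /= !mulr0 !add0r in e1 e2.
  have z00 : z0 != 0.
    apply: contraNneq nz => z00; rewrite z00 expr0n /= !mulr0 in e1 e2.
    by rewrite z00 z20 (sq0 _ _ b10 e1) (sq0 _ _ b30 e2).
  constructor 2; split => //.
    by apply: contra_eq_neq e1 => ->; rewrite expr0n /= mulr0 eq_sym mulf_neq0 ?expf_neq0.
  by apply: contra_eq_neq e2 => ->; rewrite expr0n /= mulr0 eq_sym mulf_neq0 ?expf_neq0.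
have [z30|z30] := eqVneq z3 0; last by constructor 1.
rewrite z30 expr0n /= mulr0 in e2.
have z00 : z0 != 0.
  apply: contraNneq z20 => z00; rewrite z00 expr0n /= !mulr0 addr0 in e2.
  by rewrite (sq0 _ _ b20 (esym e2)).
constructor 3; split => //; apply: contra_eq_neq e1 => ->.
rewrite expr0n /= mulr0 eq_sym.
have -> : b2 * z2 ^+ 2 + d * z0 ^+ 2
  = b2 * z2 ^+ 2 + 4 * d * z0 ^+ 2 - 3 * d * z0 ^+ 2 by ring.
by rewrite -e2 sub0r oppr_eq0 !mulf_neq0 ?expf_neq0.
Qed.

Lemma torsorZ_good d b1 b2 : p <> 3%N ->
  ~~ (p%:Z %| d)%Z -> ~~ (p%:Z %| b1)%Z -> ~~ (p%:Z %| b2)%Z ->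
  torsorZ K d b1 b2 (b1 * b2).
Proof.
move=> p3 pd pb1 pb2; have cF : #|'F_p| = p./2.*2.+1 by rewrite card_Fp.
have nF a : ~~ (p%:Z %| a)%Z -> a%:~R != 0 :> 'F_p by rewrite (intr_Fp_eq0 p_pr).
have d3 : (3%:R : 'F_p) != 0.
  by rewrite -(dvdn_pcharf (pchar_Fp p_pr)) dvdn_prime2 //; apply/eqP.
have d4 : (4%:R : 'F_p) != 0 by exact: nF ndvdz4.
have [z0 [z1 [z2 [z3 [nz]]]]] := torsor_finfield_point cF (nF _ pd) d3 (nF _ pb1) (nF _ pb2).
have b10 := ndvdz_neq0 pb1; have b20 := ndvdz_neq0 pb2.
have b30 := mulf_neq0 b10 b20.
move: (nF _ pd) (nF _ pb1) (nF _ pb2) => dF b1F b2F.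
set D : 'F_p := d%:~R in dF *; set B1 : 'F_p := b1%:~R in b1F *.
set B2 : 'F_p := b2%:~R in b2F *.
move=> e1 e2.
have e1' : B1 * z1 ^+ 2 = B2 * z2 ^+ 2 + D * z0 ^+ 2 by rewrite -e1; ring.
have e3 : B1 * B2 * z3 ^+ 2 = B2 * z2 ^+ 2 + 4 * D * z0 ^+ 2.
  transitivity (B1 * z1 ^+ 2 - (B1 * z1 ^+ 2 - B1 * B2 * z3 ^+ 2)); first by ring.
  by rewrite e2 e1'; ring.
have [a0 a0E] := intr_Fp_surj z0.
have [a1 a1E] := intr_Fp_surj z1.
have [a2 a2E] := intr_Fp_surj z2.
have [a3 a3E] := intr_Fp_surj z3.
have z_neq0 (a : int) (z : 'F_p) : z = a%:~R -> z != 0 -> a != 0.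
  by move=> ->; apply: contraNneq => ->.
have castE := (intrM, intrD, intrN, @rmorphXn).
case: (torsor_vanishing dF d3 d4 b1F b2F nz e1' e3).
- move=> [z20 z30]; apply: (@torsorZ_fix01 _ K0 _ _ _ _ a0 a1) => //.
  + move: z20; apply: contraNT; rewrite negb_or !negbK => /andP[/eqP a00 /eqP a10].
    move: e1' => /esym/eqP; rewrite a0E a1E a00 a10 expr0n /= !mulr0 addr0.
    by rewrite mulf_eq0 (negPf b2F) sqrf_eq0.
  + apply: (@square_in_Fp _ (B2 * z2)); first exact: mulf_neq0.
    rewrite !castE /= -a0E -a1E -/B1 -/B2 -/D e1'; ring.
  apply: (@square_in_Fp _ (B1 * B2 * z3)); first by rewrite !mulf_neq0.
  rewrite !castE /= -a0E -a1E -/B1 -/B2 -/D e1'.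
  transitivity (B1 * B2 * (B2 * z2 ^+ 2 + 4 * D * z0 ^+ 2)); first by ring.
  by rewrite -e3; ring.
- move=> [z20 z00 z10 z30]; apply: (@torsorZ_fix02 _ K0 _ _ _ _ a0 a2) => //.
  + by rewrite (z_neq0 _ _ a0E).
  + apply: (@square_in_Fp _ (B1 * z1)); first exact: mulf_neq0.
    rewrite !castE /= -a0E -a2E -/B1 -/B2 -/D -e1'; ring.
  apply: (@square_in_Fp _ (B1 * B2 * z3)); first by rewrite !mulf_neq0.
  rewrite !castE /= -a0E -a2E -/B1 -/B2 -/D -e3; ring.
move=> [z30 z00 z10 z20]; apply: (@torsorZ_fix03 _ K0 _ _ _ _ a0 a3) => //.
+ by rewrite (z_neq0 _ _ a0E).
+ apply: (@square_in_Fp _ (B1 * z1)); first exact: mulf_neq0.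
  rewrite !castE /= -a0E -a3E -/B1 -/B2 -/D e3.
  transitivity (B1 * (B2 * z2 ^+ 2 + D * z0 ^+ 2)); first by ring.
  by rewrite -e1'; ring.
apply: (@square_in_Fp _ (B2 * z2)); first exact: mulf_neq0.
rewrite !castE /= -a0E -a3E -/B1 -/B2 -/D e3; ring.
Qed.
End OddPlace.

(** Supports elimination with explicit multipliers [u], [v], [w], checked by [ring]. Taking
    [dvdzz P] as a premise absorbs multiples of [P], and [dvdz0 P] fills an idle slot. *)
Lemma dvdz_combine (x y z s u v w e : int) : (e %| x)%Z -> (e %| y)%Z -> (e %| z)%Z ->
  s = u * x + v * y + w * z -> (e %| s)%Z.
Proof. by move=> ex ey ez ->; rewrite !rpredD // dvdz_mull. Qed.

Ltac combine h1 h2 h3 u v w :=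
  apply: (dvdz_combine (u := u) (v := v) (w := w) h1 h2 h3); ring.

(** * Odd primes dividing n *)

Section BadPlace.
Variables (p : nat) (p_pr : prime p).
Hypotheses (p2 : p <> 2%N).
Local Notation K := (padic p_pr).
Local Notation al a := (add_legendre a p).
Local Notation P := (p%:Z).
Implicit Types c d m : int.

Let ph := odd_primeE p_pr p2.
Let K0 := padic_char0 p_pr.
Let alM := alM p_pr p2.
Let al4 := al4 p_pr p2.
Let al_eq := al_eq p_pr p2.
Let dvdz_coef := dvdz_coef p_pr.
Let cancel2 := @dvdz_p2_cancel p p_pr.

Lemma p_neq0 : P != 0. Proof. by have := prime_gt0 p_pr; lia. Qed.

(** Modulo [P] a coefficient divisible by [P] hides its coordinate; modulo [P ^+ 2] the equations
    can still be divided by [P] once. *)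
Lemma torsorZ_mod_p2 d b1 b2 b3 : torsorZ K d b1 b2 b3 ->
  exists a0 a1 a2 a3 : int,
  [/\ ((P %| a0) -> (P %| a1) -> (P %| a2) -> (P %| a3) -> False)%Z,
      (P ^+ 2 %| b1 * a1 ^+ 2 - b2 * a2 ^+ 2 - d * a0 ^+ 2)%Z &
      (P ^+ 2 %| b1 * a1 ^+ 2 - b3 * a3 ^+ 2 + 3 * d * a0 ^+ 2)%Z].
Proof.
move=> /torsorZ_residues/(_ 2%N isT)[a0 [a1 [a2 [a3 [nz h1 h2]]]]].
exists a0, a1, a2, a3; split => // q0 q1 q2 q3.
by move: nz; rewrite q0 q1 q2 q3.
Qed.


(** The digits in the names of these four lemmas are the valuations of [b1] and [b2]. Each time,
    primitivity leaves some coordinate a unit, and congruences between unit multiples of squares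
    compare the symbols by [al_eq]. *)
Lemma bad_place_nec00 c1 c2 m :
  ~~ (P %| (c1)%R)%Z -> ~~ (P %| (c2)%R)%Z -> ~~ (P %| (m)%R)%Z ->
  torsorZ K (P * m) c1 c2 (c1 * c2) -> al c1 = 0 /\ al c2 = 0.
Proof.
move=> pc1 pc2 pm /torsorZ_mod_p2[a0 [a1 [a2 [a3 [nz h1 h2]]]]].
have h1' := dvdz_p2 h1; have h2' := dvdz_p2 h2.
have pc12 : ~~ (P %| (c1 * c2)%R)%Z by rewrite ndvdzM // pc1.
have k1 : (P %| (c1 * a1 ^+ 2 - c2 * a2 ^+ 2)%R)%Z.
  combine h1' (dvdzz P) (dvdz0 P) (1 : int) (m * a0 ^+ 2) (0 : int).
have k2 : (P %| (c1 * a1 ^+ 2 - c1 * c2 * a3 ^+ 2)%R)%Z.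
  combine h2' (dvdzz P) (dvdz0 P) (1 : int) (- 3 * m * a0 ^+ 2) (0 : int).
have q1 : ~~ (P %| (a1)%R)%Z.
  apply/negP => q1; have q1' := dvdz_p2_sqr c1 q1; have q1'' := dvdz_p2 q1'.
  have q2 : (P %| (a2)%R)%Z.
    apply: (dvdz_coef pc2); combine k1 q1'' (dvdz0 P) (-1 : int) (1 : int) (0 : int).
  have q3 : (P %| (a3)%R)%Z.
    apply: (dvdz_coef pc12); combine k2 q1'' (dvdz0 P) (-1 : int) (1 : int) (0 : int).
  apply: (nz) => //; apply: (dvdz_coef pm); apply: cancel2.
  combine h1 q1' (dvdz_p2_sqr c2 q2) (-1 : int) (1 : int) (-1 : int).
have e1 := al_eq pc1 pc2 q1 k1; have := al_eq pc1 pc12 q1 k2.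
rewrite alM // -e1 => e2; suff: al c1 = 0 by [].
by rewrite e2 F2_addxx.
Qed.

Lemma bad_place_nec10 c1 c2 m :
  ~~ (P %| (c1)%R)%Z -> ~~ (P %| (c2)%R)%Z -> ~~ (P %| (m)%R)%Z ->
  torsorZ K (P * m) (P * c1) c2 (P * (c1 * c2)) -> al c1 + al m = 0 /\ al c2 = 0.
Proof.
move=> pc1 pc2 pm /torsorZ_mod_p2[a0 [a1 [a2 [a3 [nz h1 h2]]]]].
have h1' := dvdz_p2 h1.
have pc12 : ~~ (P %| (c1 * c2)%R)%Z by rewrite ndvdzM // pc1.
have q2 : (P %| (a2)%R)%Z.
  apply: (dvdz_coef pc2).
  combine h1' (dvdzz P) (dvdz0 P) (-1 : int) (c1 * a1 ^+ 2 - m * a0 ^+ 2) (0 : int).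
have k1 : (P %| (m * a0 ^+ 2 - c1 * a1 ^+ 2)%R)%Z.
  apply: cancel2.
  combine h1 (dvdz_p2_sqr c2 q2) (dvdz0 (P ^+ 2)) (-1 : int) (-1 : int) (0 : int).
have k2 : (P %| (c1 * a1 ^+ 2 - c1 * c2 * a3 ^+ 2 + 3 * m * a0 ^+ 2)%R)%Z.
  by apply: cancel2; combine h2 (dvdz0 (P ^+ 2)) (dvdz0 (P ^+ 2)) (1 : int) (0 : int) (0 : int).
have q0 : ~~ (P %| (a0)%R)%Z.
  apply/negP => q0; have q0' := dvdz_p2 (dvdz_p2_sqr m q0).
  have q1 : (P %| (a1)%R)%Z.
    apply: (dvdz_coef pc1); combine k1 q0' (dvdz0 P) (-1 : int) (1 : int) (0 : int).
  apply: (nz) => //; apply: (dvdz_coef pc12).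
  combine k2 (dvdz_p2 (dvdz_p2_sqr c1 q1)) q0' (-1 : int) (1 : int) (3 : int).
have pm4 : ~~ (P %| (4 * m)%R)%Z by rewrite ndvdzM // ndvdz4.
have k3 : (P %| (4 * m * a0 ^+ 2 - c1 * c2 * a3 ^+ 2)%R)%Z.
  combine k1 k2 (dvdz0 P) (1 : int) (1 : int) (0 : int).
have e1 := al_eq pm pc1 q0 k1; have := al_eq pm4 pc12 q0 k3.
rewrite alM ?ndvdz4 // alM // al4 add0r e1 F2_addxx => e2; split=> //.
by rewrite -[LHS]add0r -(F2_addxx (al c1)) -addrA -e2 F2_addxx.
Qed.

Lemma bad_place_nec01 c1 c2 m : p <> 3%N ->
  ~~ (P %| (c1)%R)%Z -> ~~ (P %| (c2)%R)%Z -> ~~ (P %| (m)%R)%Z ->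
  torsorZ K (P * m) c1 (P * c2) (P * (c1 * c2)) ->
  al c1 + al (- 3) = 0 /\ al c2 + al (- m) = 0.
Proof.
move=> p3 pc1 pc2 pm /torsorZ_mod_p2[a0 [a1 [a2 [a3 [nz h1 h2]]]]].
have h1' := dvdz_p2 h1.
have pc12 : ~~ (P %| (c1 * c2)%R)%Z by rewrite ndvdzM // pc1.
have pNm : ~~ (P %| (- m)%R)%Z by rewrite ndvdzN.
have p3' : ~~ (P %| (- 3)%R)%Z by rewrite ndvdzN dvdzE /= dvdn_prime2 //; apply/eqP.
have q1 : (P %| (a1)%R)%Z.
  apply: (dvdz_coef pc1).
  combine h1' (dvdzz P) (dvdz0 P) (1 : int) (c2 * a2 ^+ 2 + m * a0 ^+ 2) (0 : int).
have q1' := dvdz_p2_sqr c1 q1.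
have k1 : (P %| (- m * a0 ^+ 2 - c2 * a2 ^+ 2)%R)%Z.
  by apply: cancel2; combine h1 q1' (dvdz0 (P ^+ 2)) (1 : int) (-1 : int) (0 : int).
have k2 : (P %| ((- 3) * (- m) * a0 ^+ 2 - c1 * c2 * a3 ^+ 2)%R)%Z.
  by apply: cancel2; combine h2 q1' (dvdz0 (P ^+ 2)) (1 : int) (-1 : int) (0 : int).
have q0 : ~~ (P %| (a0)%R)%Z.
  apply/negP => q0; have q0' := dvdz_p2 (dvdz_p2_sqr m q0).
  have q2 : (P %| (a2)%R)%Z.
    apply: (dvdz_coef pc2); combine k1 q0' (dvdz0 P) (-1 : int) (-1 : int) (0 : int).
  apply: (nz) => //; apply: (dvdz_coef pc12).
  combine k2 q0' (dvdz0 P) (-1 : int) (3 : int) (0 : int).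
have p3m : ~~ (P %| ((- 3) * (- m))%R)%Z by rewrite ndvdzM // p3'.
have e1 := al_eq pNm pc2 q0 k1; have := al_eq p3m pc12 q0 k2.
rewrite alM // alM // e1 => e2; split; last exact: F2_addxx.
by rewrite -(addrK (al c2) (al (- 3))) e2 addrK F2_addxx.
Qed.

Lemma bad_place_nec11 c1 c2 m : p <> 3%N ->
  ~~ (P %| (c1)%R)%Z -> ~~ (P %| (c2)%R)%Z -> ~~ (P %| (m)%R)%Z ->
  torsorZ K (P * m) (P * c1) (P * c2) (c1 * c2) ->
  al c1 + al m + al (- 3) = 0 /\ al c2 + al (- m) = 0.
Proof.
move=> p3 pc1 pc2 pm /torsorZ_mod_p2[a0 [a1 [a2 [a3 [nz h1 h2]]]]].
have h2' := dvdz_p2 h2.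
have pc12 : ~~ (P %| (c1 * c2)%R)%Z by rewrite ndvdzM // pc1.
have pNm : ~~ (P %| (- m)%R)%Z by rewrite ndvdzN.
have p3' : ~~ (P %| (- 3)%R)%Z by rewrite ndvdzN dvdzE /= dvdn_prime2 //; apply/eqP.
have q3 : (P %| (a3)%R)%Z.
  apply: (dvdz_coef pc12).
  combine h2' (dvdzz P) (dvdz0 P) (-1 : int) (c1 * a1 ^+ 2 + 3 * m * a0 ^+ 2) (0 : int).
have k1 : (P %| (m * (- 3) * a0 ^+ 2 - c1 * a1 ^+ 2)%R)%Z.
  apply: cancel2.
  combine h2 (dvdz_p2_sqr (c1 * c2) q3) (dvdz0 (P ^+ 2)) (-1 : int) (-1 : int) (0 : int).
have k1' : (P %| (c1 * a1 ^+ 2 - c2 * a2 ^+ 2 - m * a0 ^+ 2)%R)%Z.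
  by apply: cancel2; combine h1 (dvdz0 (P ^+ 2)) (dvdz0 (P ^+ 2)) (1 : int) (0 : int) (0 : int).
have k2 : (P %| (4 * (- m) * a0 ^+ 2 - c2 * a2 ^+ 2)%R)%Z.
  combine k1 k1' (dvdz0 P) (1 : int) (1 : int) (0 : int).
have q0 : ~~ (P %| (a0)%R)%Z.
  apply/negP => q0; have q0' := dvdz_p2 (dvdz_p2_sqr m q0).
  have q2 : (P %| (a2)%R)%Z.
    apply: (dvdz_coef pc2); combine k2 q0' (dvdz0 P) (-1 : int) (- 4 : int) (0 : int).
  apply: (nz) => //; apply: (dvdz_coef pc1).
  combine k1 q0' (dvdz0 P) (-1 : int) (- 3 : int) (0 : int).
have p3m : ~~ (P %| (m * (- 3))%R)%Z by rewrite ndvdzM // p3' pm.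
have p4m : ~~ (P %| (4 * (- m))%R)%Z by rewrite ndvdzM // ndvdz4 // pNm.
have := al_eq p3m pc1 q0 k1; have := al_eq p4m pc2 q0 k2.
have -> : al (4 * (- m)) = al (- m) by rewrite alM ?ndvdz4 // al4 add0r.
have -> : al (m * (- 3)) = al m + al (- 3) by rewrite alM.
by move=> -> <-; rewrite -addrA !F2_addxx.
Qed.

(* At a prime dividing [n] the local image is that of the 2-torsion. *)
Lemma bad_place (x y : bool) c1 c2 m : p <> 3%N ->
  ~~ (P %| (c1)%R)%Z -> ~~ (P %| (c2)%R)%Z -> ~~ (P %| (m)%R)%Z ->
  torsorZ K (P * m) (P ^+ x * c1) (P ^+ y * c2) (P ^+ (x (+) y) * (c1 * c2)) <->
  al c1 + x%:R * al m + y%:R * al (- 3) = 0 /\ al c2 + y%:R * al (- m) = 0.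
Proof.
move=> p3 pc1 pc2 pm.
have c10 := ndvdz_neq0 pc1; have c20 := ndvdz_neq0 pc2; have m0 := ndvdz_neq0 pm.
have P0 := p_neq0; have c120 := mulf_neq0 c10 c20.
have pNm : ~~ (P %| (- m)%R)%Z by rewrite ndvdzN.
have p3' : ~~ (P %| (- 3)%R)%Z by rewrite ndvdzN dvdzE /= dvdn_prime2 //; apply/eqP.
have sq a b : ~~ (P %| (a)%R)%Z -> al a = 0 -> b = a -> square_in K b.
  by move=> pa a0 ->; apply: al_square_in.
have sqp a b c : ~~ (P %| (a)%R)%Z -> al a = 0 -> b = a * c ^+ 2 -> square_in K b.
  by move=> pa a0 ->; apply: square_inM; [apply: al_square_in|apply: square_in_sqr].
split.
  case: x y => [] [] /=; rewrite ?expr0 ?expr1 ?mul1r ?mul0r ?addr0.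
  - exact: bad_place_nec11.
  - exact: bad_place_nec10.
  - exact: bad_place_nec01.
  - exact: bad_place_nec00.
(* The witnesses are the 2-torsion points: [z3 = 0], [z2 = 0] and [z1 = 0] give the roots [-3n], [n]
   and 0, and [z0 = 0] the origin at infinity. *)
case: x y => [] [] /=; rewrite ?expr0 ?expr1 ?mul1r ?mul0r ?addr0 => -[e1 e2].
- apply: (@torsorZ_fix03 _ K0 _ _ _ _ 1 0); rewrite ?mulf_neq0 //.
    apply: (sqp (c1 * m * (- 3)) _ P); rewrite ?ndvdzM ?pc1 ?pm ?alM ?ndvdzM ?pc1 //; ring.
  apply: (sqp (c2 * (- m)) _ (2 * P)); rewrite ?ndvdzM ?pc2 ?alM //; ring.
- apply: (@torsorZ_fix02 _ K0 _ _ _ _ 1 0); rewrite ?mulf_neq0 //.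
    apply: (sqp (c1 * m) _ P); rewrite ?ndvdzM ?pc1 ?alM //; ring.
  apply: (sqp (c1 * m * c2) _ (2 * P)); last by ring.
    by rewrite !ndvdzM // pc1 pm.
  by rewrite alM ?ndvdzM ?pc1 // alM // e1 e2 addr0.
- apply: (@torsorZ_fix01 _ K0 _ _ _ _ 1 0); rewrite ?mulf_neq0 //.
    apply: (sqp (c2 * (- m)) _ P); rewrite ?ndvdzM ?pc2 ?alM //; ring.
  apply: (sqp ((c1 * (- 3)) * (c2 * (- m))) _ P).
  + by rewrite !ndvdzM // pc1 p3' pc2.
  + by rewrite alM ?ndvdzM ?pc1 ?pc2 // !alM // e1 e2 addr0.
  ring.
- apply: (@torsorZ_fix01 _ K0 _ _ _ _ 0 1); rewrite ?mulf_neq0 //.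
    apply: (sq (c1 * c2)); rewrite ?ndvdzM ?pc1 ?alM ?e1 ?e2 ?addr0 //; ring.
  apply: (sqp c2 _ c1) => //; ring.
Qed.
End BadPlace.

(** If the torsor is ramified, exactly two of its three coefficients are divisible by [p]. Comparing
    these two modulo [p] leaves [d], [3 * d] or [4 * d] times [a0 ^+ 2], so [p] divides [a0], and
    then every coordinate. *)
Lemma unramified_place p (p_pr : prime p) (x y : bool) (c1 c2 d : int) :
  p <> 2%N -> p <> 3%N ->
  ~~ (p%:Z %| c1)%Z -> ~~ (p%:Z %| c2)%Z -> ~~ (p%:Z %| d)%Z ->
  torsorZ (padic p_pr) d (p%:Z ^+ x * c1) (p%:Z ^+ y * c2)
    (p%:Z ^+ (x (+) y) * (c1 * c2)) -> x = false /\ y = false.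
Proof.
move=> p2 p3 pc1 pc2 pd /torsorZ_mod_p2[a0 [a1 [a2 [a3 [nz h1 h2]]]]].
set P := p%:Z in pc1 pc2 pd nz h1 h2 *.
have pc12 : ~~ (P %| c1 * c2)%Z by rewrite ndvdzM // pc1.
have p3d : ~~ (P %| (3 * d)%R)%Z by rewrite ndvdzM // pd dvdzE /= dvdn_prime2 // andbT; apply/eqP.
have p4d : ~~ (P %| (4 * d)%R)%Z by rewrite ndvdzM // ndvdz4.
have coef := dvdz_coef p_pr; have cancel2 := @dvdz_p2_cancel p p_pr.
have sq (b a : int) : (P %| a)%Z -> (P ^+ 2 %| b * a ^+ 2)%Z by exact: dvdz_p2_sqr.
have P0 := dvdz0 P; have P20 := dvdz0 (P ^+ 2).
have h1' := dvdz_p2 h1; have h2' := dvdz_p2 h2.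
case: x y h1 h2 h1' h2' => [] [] /=;
  rewrite ?expr0 ?expr1 ?mul1r => h1 h2 h1' h2'; try (by split); exfalso.
- have q0 : (P %| a0)%Z.
    apply: (coef _ _ pd);
    combine h1' (dvdzz P) P0 (-1 : int) (c1 * a1 ^+ 2 - c2 * a2 ^+ 2) (0 : int).
  have q3 : (P %| a3)%Z.
    apply: (coef _ _ pc12); combine h2' (dvdzz P) q0 (-1 : int) (c1 * a1 ^+ 2) (3 * d * a0).
  have q1 : (P %| a1)%Z.
    apply: (coef _ _ pc1); apply: cancel2.
    combine h2 (sq (c1 * c2) a3 q3) (sq (3 * d) a0 q0) (1 : int) (1 : int) (-1 : int).
  apply: nz => //; apply: (coef _ _ pc2); apply: cancel2.
  combine h1 (sq (P * c1) a1 q1) (sq d a0 q0) (-1 : int) (1 : int) (-1 : int).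
- have q0 : (P %| a0)%Z.
    apply: (coef _ _ p3d);
    combine h2' (dvdzz P) P0 (1 : int) (- (c1 * a1 ^+ 2 - c1 * c2 * a3 ^+ 2)) (0 : int).
  have q2 : (P %| a2)%Z.
    apply: (coef _ _ pc2); combine h1' (dvdzz P) q0 (-1 : int) (c1 * a1 ^+ 2) (- d * a0).
  have q1 : (P %| a1)%Z.
    apply: (coef _ _ pc1); apply: cancel2.
    combine h1 (sq c2 a2 q2) (sq d a0 q0) (1 : int) (1 : int) (1 : int).
  apply: nz => //; apply: (coef _ _ pc12); apply: cancel2.
  combine h2 (sq (P * c1) a1 q1) (sq (3 * d) a0 q0) (-1 : int) (1 : int) (1 : int).
- have q0 : (P %| a0)%Z.
    apply: (coef _ _ p4d).
    combine h2' h1' (dvdzz P) (1 : int) (-1 : int) (c1 * c2 * a3 ^+ 2 - c2 * a2 ^+ 2).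
  have q1 : (P %| a1)%Z.
    apply: (coef _ _ pc1); combine h1' (dvdzz P) q0 (1 : int) (c2 * a2 ^+ 2) (d * a0).
  have q2 : (P %| a2)%Z.
    apply: (coef _ _ pc2); apply: cancel2.
    combine h1 (sq c1 a1 q1) (sq d a0 q0) (-1 : int) (1 : int) (-1 : int).
  apply: nz => //; apply: (coef _ _ pc12); apply: cancel2.
  combine h2 (sq c1 a1 q1) (sq (3 * d) a0 q0) (-1 : int) (1 : int) (1 : int).
Qed.

(** * The place 3 *)

Section PlaceThree.
Variable p3 : prime 3.
Local Notation K := (padic p3).
Local Notation al a := (add_legendre a 3).
Implicit Types u w m a : int.

Let n32 : 3%N <> 2%N. Proof. by []. Qed.
Let K0 := padic_char0 p3.

(** Modulo 3 the roots 0 and [-3n] collide, so the second quadric loses its right-hand side. An odd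
    valuation of [b2] leads to an infinite descent; otherwise one congruence fixes the class of [w]
    and leaves [u] free. *)
Lemma place3_nec (x y : bool) u w m :
  ~~ (3 %| u)%Z -> ~~ (3 %| w)%Z -> ~~ (3 %| m)%Z ->
  torsorZ K m (3%:Z ^+ x * u) (3%:Z ^+ y * w) (3%:Z ^+ (x (+) y) * (u * w)) ->
  y = false /\ al w + x%:R * al (- m) = 0.
Proof.
have -> : (3 : int)%Z = 3%:Z by [].
move=> pu pw pm /torsorZ_mod_p2[a0 [a1 [a2 [a3 [nz h1 h2]]]]].
set P := 3%:Z in pu pw pm nz h1 h2 *.
have puw : ~~ (P %| u * w)%Z by rewrite ndvdzM // pu.
have pNm : ~~ (P %| (- m)%R)%Z by rewrite ndvdzN.
have P3 : 3%R = P by [].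
have coef := dvdz_coef p3; have cancel2 := @dvdz_p2_cancel 3 p3.
have sq (b a : int) : (P %| a)%Z -> (P ^+ 2 %| b * a ^+ 2)%Z by exact: dvdz_p2_sqr.
have P0 := dvdz0 P; have P20 := dvdz0 (P ^+ 2).
rewrite P3 in h2; have h1' := dvdz_p2 h1; have h2' := dvdz_p2 h2.
case: x y h1 h2 h1' h2' => [] [] /=; rewrite ?expr0 ?expr1 ?mul1r ?mul0r ?addr0 => h1 h2 h1' h2'.
- exfalso; have q0 : (P %| a0)%Z.
    apply: (coef _ _ pm); combine h1' (dvdzz P) P0 (-1 : int) (u * a1 ^+ 2 - w * a2 ^+ 2) (0 : int).
  have q3 : (P %| a3)%Z.
    apply: (coef _ _ puw);
    combine h2' (dvdzz P) P0 (-1 : int) (u * a1 ^+ 2 + m * a0 ^+ 2) (0 : int).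
  have q1 : (P %| a1)%Z.
    apply: (coef _ _ pu); apply: cancel2.
    combine h2 (sq (u * w) a3 q3) (sq (P * m) a0 q0) (1 : int) (1 : int) (-1 : int).
  apply: nz => //; apply: (coef _ _ pw); apply: cancel2.
  combine h1 (sq (P * u) a1 q1) (sq m a0 q0) (-1 : int) (1 : int) (-1 : int).
- split=> //.
  have k : (P %| (- m * a0 ^+ 2 - w * a2 ^+ 2)%R)%Z.
    combine h1' (dvdzz P) P0 (1 : int) (- u * a1 ^+ 2) (0 : int).
  have q0 : ~~ (P %| a0)%Z.
    apply/negP => q0; have q2 : (P %| a2)%Z.
      apply: (coef _ _ pw); combine k q0 P0 (-1 : int) (- m * a0) (0 : int).
    have q1 : (P %| a1)%Z.
      apply: (coef _ _ pu); apply: cancel2.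
      combine h1 (sq w a2 q2) (sq m a0 q0) (1 : int) (1 : int) (1 : int).
    apply: nz => //; apply: (coef _ _ puw); apply: cancel2.
    combine h2 (sq (P * u) a1 q1) (sq (P * m) a0 q0) (-1 : int) (1 : int) (1 : int).
  by rewrite (al_eq p3 n32 pNm pw q0 k) F2_addxx.
- exfalso; have q1 : (P %| a1)%Z.
    apply: (coef _ _ pu);
    combine h2' (dvdzz P) P0 (1 : int) (u * w * a3 ^+ 2 - m * a0 ^+ 2) (0 : int).
  have q0 : (P %| a0)%Z.
    apply: (coef _ _ pm); combine h1' (dvdzz P) q1 (-1 : int) (- w * a2 ^+ 2) (u * a1).
  have q2 : (P %| a2)%Z.
    apply: (coef _ _ pw); apply: cancel2.
    combine h1 (sq u a1 q1) (sq m a0 q0) (-1 : int) (1 : int) (-1 : int).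
  apply: nz => //; apply: (coef _ _ puw); apply: cancel2.
  combine h2 (sq u a1 q1) (sq (P * m) a0 q0) (-1 : int) (1 : int) (1 : int).
split=> //.
have k : (P %| u * a1 ^+ 2 - u * w * a3 ^+ 2)%Z.
  combine h2' (dvdzz P) P0 (1 : int) (- m * a0 ^+ 2) (0 : int).
have q1 : ~~ (P %| a1)%Z.
  apply/negP => q1; have q3 : (P %| a3)%Z.
    apply: (coef _ _ puw); combine k q1 P0 (-1 : int) (u * a1) (0 : int).
  have q0 : (P %| a0)%Z.
    apply: (coef _ _ pm); apply: cancel2.
    combine h2 (sq u a1 q1) (sq (u * w) a3 q3) (1 : int) (-1 : int) (1 : int).
  apply: nz => //; apply: (coef _ _ pw).
  combine h1' q1 q0 (-1 : int) (u * a1) (- m * a0).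
have := al_eq p3 n32 pu puw q1 k.
by rewrite (alM p3 n32) // => E; rewrite -[LHS]add0r -(F2_addxx (al u)) -addrA -E F2_addxx.
Qed.

Lemma square_in_F3 a : a%:~R = 1 :> 'F_3 -> square_in K a.
Proof. by move=> a1; apply: (@square_in_Fp _ p3 n32 a 1); rewrite ?oner_neq0 // expr1n. Qed.

Lemma square_in_9F3 a b : b%:~R = 1 :> 'F_3 -> a = b * 3 ^+ 2 -> square_in K a.
Proof. by move=> /square_in_F3 sb ->; apply: square_inM => //; apply: square_in_sqr. Qed.

Lemma residue3 a : ~~ (3 %| a)%Z ->
  (a%:~R = 1 :> 'F_3 /\ al a = 0) \/ (a%:~R = -1 :> 'F_3 /\ al a = 1).
Proof.
move=> pa; have [h|h] : (3 %| a - 1)%Z \/ (3 %| a - -1)%Z by lia.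
  left; split; first by apply/eqP; rewrite (intr_Fp_eq p3 a 1).
  by rewrite (@add_legendre_mod 3 p3 a 1) // (@add_legendre1 3 1).
right; split; first by apply/eqP; rewrite (intr_Fp_eq p3 a (-1)).
by rewrite (@add_legendre_mod 3 p3 a (-1)) // add_legendreN1.
Qed.

(** Witnesses chosen according to [u] and [m] modulo 3. Each number to be a square is 1 modulo 3, or
    9 times such a number. *)
Lemma place3_suff (x : bool) u w m :
  ~~ (3 %| u)%Z -> ~~ (3 %| w)%Z -> ~~ (3 %| m)%Z ->
  al w + x%:R * al (- m) = 0 ->
  torsorZ K m (3%:Z ^+ x * u) w (3%:Z ^+ x * (u * w)).
Proof.
move=> pu pw pm; have pNm : ~~ (3 %| (- m)%R)%Z by lia.
have u0 : u != 0 by lia. have w0 : w != 0 by lia. have m0 : m != 0 by lia.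
have uw0 := mulf_neq0 u0 w0.
have castE := (intrM, intrD, intrN, @rmorphXn).
case: x => /=; rewrite ?expr0 ?expr1 ?mul1r ?mul0r ?addr0 => E.
  have {E} wm : w%:~R = - m%:~R :> 'F_3.
    rewrite -intrN; case: (residue3 pw) E => -[-> ->];
    by case: (residue3 pNm) => -[-> ->].
  case: (residue3 pu) => -[uE _]; last first.
    apply: (@torsorZ_fix01 _ K0 _ _ _ _ 1 0); rewrite ?mulf_neq0 //.
      apply: square_in_F3; rewrite !castE /= uE wm.
      by case: (residue3 pm) => -[-> _]; apply: val_inj.
    apply: (@square_in_9F3 _ (u * w * m)); last by ring.
    rewrite !castE /= uE wm; by case: (residue3 pm) => -[-> _]; apply: val_inj.
  case: (residue3 pm) => -[mE _]; rewrite mE in wm.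
    apply: (@torsorZ_fix03 _ K0 _ _ _ _ 1 1); rewrite ?mulf_neq0 //.
      apply: (@square_in_9F3 _ (u * (u * w - m))); last by ring.
      by rewrite !castE /= uE wm mE; apply: val_inj.
    by apply: square_in_F3; rewrite !castE /= uE wm mE; apply: val_inj.
  apply: (@torsorZ_fix03 _ K0 _ _ _ _ 1 0); rewrite ?mulf_neq0 //.
    apply: (@square_in_9F3 _ (- (u * m))); last by ring.
    by rewrite !castE /= uE mE; apply: val_inj.
  by apply: square_in_F3; rewrite !castE /= uE wm mE; apply: val_inj.
have {E} wE : w%:~R = 1 :> 'F_3.
  by case: (residue3 pw) E => -[-> ->].
case: (residue3 pu) => -[uE _].
  apply: (@torsorZ_fix01 _ K0 _ _ _ _ 0 1); rewrite ?mulf_neq0 //.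
    by apply: square_in_F3; rewrite !castE /= uE wE; case: (residue3 pm) => -[-> _]; apply: val_inj.
  by apply: square_in_F3; rewrite !castE /= uE wE; case: (residue3 pm) => -[-> _]; apply: val_inj.
case: (residue3 pm) => -[mE _].
  apply: (@torsorZ_fix02 _ K0 _ _ _ _ 1 1); rewrite ?mulf_neq0 //.
    by apply: square_in_F3; rewrite !castE /= uE wE mE; apply: val_inj.
  by apply: square_in_F3; rewrite !castE /= uE wE mE; apply: val_inj.
apply: (@torsorZ_fix02 _ K0 _ _ _ _ 1 0); rewrite ?mulf_neq0 //.
  by apply: square_in_F3; rewrite !castE /= uE wE mE; apply: val_inj.
by apply: square_in_F3; rewrite !castE /= uE wE mE; apply: val_inj.
Qed.
End PlaceThree.

(** For [d < 0] the smallest root is [d], so [x - d] is nonnegative on both real components, while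
    the sign of [x] can be either. *)
Lemma real_place (R : realType) (d b1 b2 : int) : d < 0 -> b1 != 0 -> b2 != 0 ->
  torsorZ R d b1 b2 (b1 * b2) <-> 0 < b2.
Proof.
move=> d0 b10 b20; have R0 (a : int) : a != 0 -> a%:~R != 0 :> R by rewrite intr_eq0.
have sq (a : int) : 0 <= a -> square_in R a.
  by move=> a0; exists (Num.sqrt a%:~R); rewrite sqr_sqrtr // ler0z.
split=> [|b2p]; last first.
  have [b1p|b1n] := ltP 0 b1.
    by apply: (@torsorZ_fix01 _ R0 _ _ _ _ 0 1); rewrite ?mulf_neq0 //; apply: sq; nia.
  by apply: (@torsorZ_fix02 _ R0 _ _ _ _ 1 0); rewrite ?mulf_neq0 //; apply: sq; nia.
case=> z0 [z1 [z2 [z3 [nz e1 e2]]]]; rewrite ltNge; apply/negP => b2n.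
have {}b2n : b2%:~R < 0 :> R by rewrite ltrz0; lia.
have {}d0 : d%:~R < 0 :> R by rewrite ltrz0.
have b1R : b1%:~R != 0 :> R by rewrite intr_eq0.
move/negP: nz; apply; rewrite intrM in e2.
move: b1R b2n d0 e1 e2; move: (b1%:~R : R) (b2%:~R : R) (d%:~R : R) => B1 B2 D B10 B2n D0 e1 e2.
have [s0 s1 s2 s3] : [/\ 0 <= z0 ^+ 2, 0 <= z1 ^+ 2, 0 <= z2 ^+ 2 & 0 <= z3 ^+ 2].
  by rewrite !sqr_ge0.
have sqz (z : R) : z ^+ 2 = 0 -> z = 0 by move=> /eqP; rewrite sqrf_eq0 => /eqP.
case: (ltgtP B1 0) B10 => // B1s _.
  have e3 : B1 * B2 * z3 ^+ 2 = B2 * z2 ^+ 2 + 4 * D * z0 ^+ 2.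
    transitivity (B1 * z1 ^+ 2 - (B1 * z1 ^+ 2 - B1 * B2 * z3 ^+ 2)); first by ring.
    rewrite e2 (_ : B1 * z1 ^+ 2 = D * z0 ^+ 2 + B2 * z2 ^+ 2); first by ring.
    by rewrite -e1 subrK.
  have B3 : 0 < B1 * B2 by rewrite nmulr_rgt0.
  have q0 : z0 = 0 by apply: sqz; nra.
  have q2 : z2 = 0 by apply: sqz; nra.
  have q3 : z3 = 0 by apply: sqz; nra.
  have q1 : z1 = 0 by apply: sqz; rewrite q0 q2 in e1; nra.
  by rewrite q0 q1 q2 q3.
have q0 : z0 = 0 by apply: sqz; nra.
have q1 : z1 = 0 by apply: sqz; nra.
have q2 : z2 = 0 by apply: sqz; nra.
have B3 : B1 * B2 < 0 by rewrite pmulr_rlt0.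
have q3 : z3 = 0 by apply: sqz; rewrite q0 q1 in e2; nra.
by rewrite q0 q1 q2 q3.
Qed.

(** * The place 2 *)

Definition eps_nat (u : nat) : bool := (u %% 4 == 3)%N.
Definition omega_nat (u : nat) : bool := ((u %% 8 == 3) || (u %% 8 == 5))%N.

(* The conditions at 2 on [b1 = 2 ^ g * u], [b2 = 2 ^ x * w] for [n = 2 * m];
   [two_cond] gives rows 2 and 3 of [B2], [two_cond3] is the condition which is
   not a row. *)
Definition two_cond (g x : bool) (u m : nat) : bool :=
  (eps_nat u == g && eps_nat m) && ~~ (omega_nat u (+) (g && omega_nat m) (+) x).
Definition two_cond3 (x : bool) (w m : nat) : bool :=
  ~~ ((x && omega_nat m) (+) omega_nat w (+) (eps_nat w && eps_nat m)).

Definition odd8 : seq nat := [:: 1; 3; 5; 7]%N.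
Definition squares16 : seq nat := [:: 0; 1; 4; 9]%N.
Definition bools : seq bool := [:: false; true].

Definition two_class (g : bool) (u : nat) : nat := (2 ^ g * u)%N.
(** A 2-adic square class depends on the unit part modulo 8 and the parity of the valuation; a
    factor 4 is dropped by the exclusive or. *)
Definition two_class3 (g x : bool) (u w : nat) : nat := (2 ^ (g (+) x) * (u * w %% 8))%N.

(** The variables are the squares of the coordinates modulo 16, one of them odd by primitivity. The
    first congruence is tested before [s3] is introduced, which prunes the computation. *)
Definition two_obstruction (g x : bool) (u w m : nat) : bool :=
  all (fun s0 => all (fun s1 => all (fun s2 =>
    (two_class g u * s1 == two_class x w * s2 + 2 * m * s0 %[mod 16])%N ==>
    all (fun s3 =>
      [&& (two_class g u * s1 + 6 * m * s0 == two_class3 g x u w * s3 %[mod 16])%N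
        & [|| odd s0, odd s1, odd s2 | odd s3]] ==> two_cond g x u m)
    squares16) squares16) squares16) squares16.

Lemma two_obstructionP :
  all (fun g => all (fun x => all (fun u => all (fun w => all
    (two_obstruction g x u w) odd8) odd8) odd8) bools) bools.
Proof. by vm_compute. Qed.

(** A decidable sufficient condition: 0, or [4 ^ k] times a number congruent to 1 modulo 8, with [k]
    at most 2. *)
Definition two_square (a : int) : bool :=
  [|| a == 0, (8 %| a - 1)%Z, (4 %| a)%Z && (8 %| (a %/ 4)%Z - 1)%Z
    | (16 %| a)%Z && (8 %| (a %/ 16)%Z - 1)%Z].

(* The three alternatives fix [(z0, z1)], [(z0, z2)] or [(z0, z3)] to be [(a0, a)]. *)
Definition two_witness (d b1 b2 b3 a0 a : int) : bool :=
  ((a0 != 0) || (a != 0)) &&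
  [|| two_square (b2 * (b1 * a ^+ 2 - d * a0 ^+ 2)) &&
      two_square (b3 * (b1 * a ^+ 2 + 3 * d * a0 ^+ 2)),
      two_square (b1 * (b2 * a ^+ 2 + d * a0 ^+ 2)) &&
      two_square (b3 * (b2 * a ^+ 2 + 4 * d * a0 ^+ 2)) |
      two_square (b1 * (b3 * a ^+ 2 - 3 * d * a0 ^+ 2)) &&
      two_square (b2 * (b3 * a ^+ 2 - 4 * d * a0 ^+ 2))].

(** The ranges for [a0] and [a] form a search box; that it is large enough is what the computation
    establishes. *)
Definition two_solvable (g x : bool) (u w m : nat) : bool :=
  two_cond g x u m && two_cond3 x w m ==>
  has (fun a0 : nat => has (fun a : nat =>
    two_witness (2 * m%:Z) (two_class g u)%:Z (two_class x w)%:Z (two_class3 g x u w)%:Z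
       a0%:Z a%:Z)
    (iota 0 6)) [:: 0; 1; 3]%N.

Lemma two_solvableP :
  all (fun g => all (fun x => all (fun u => all (fun w => all
    (two_solvable g x u w) odd8) odd8) odd8) bools) bools.
Proof. by vm_compute. Qed.

Lemma cong16_2 (b1 b2 m s0 s1 s2 : nat) (k0 k1 k2 : int) :
  (16 %| b1%:Z * (s1%:Z + 16 * k1) - b2%:Z * (s2%:Z + 16 * k2)
    - 2 * m%:Z * (s0%:Z + 16 * k0))%Z -> (b1 * s1 == b2 * s2 + 2 * m * s0 %[mod 16])%N.
Proof. lia. Qed.

Lemma cong16_3 (b1 b3 m s0 s1 s3 : nat) (k0 k1 k3 : int) :
  (16 %| b1%:Z * (s1%:Z + 16 * k1) - b3%:Z * (s3%:Z + 16 * k3)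
    + 3 * (2 * m%:Z) * (s0%:Z + 16 * k0))%Z ->
  (b1 * s1 + 6 * m * s0 == b3 * s3 %[mod 16])%N.
Proof. lia. Qed.

Section PlaceTwo.
Variable two_pr : prime 2.
Local Notation K := (padic two_pr).
Implicit Types u w m a : int.

Let K0 := padic_char0 two_pr.

Lemma two_square_in a : two_square a -> square_in K a.
Proof.
case/or4P => [/eqP->|/padic_square_two//|
  /andP[a4 /padic_square_two h]|
  /andP[a16 /padic_square_two h]].
- exact: (square_in_sqr K 0).
- rewrite -(divzK a4); apply: square_inM; first exact: h.
  by rewrite (_ : (4 : int)%Z = 2 ^+ 2) //; exact: square_in_sqr.
- rewrite -(divzK a16); apply: square_inM; first exact: h.
  by rewrite (_ : (16 : int)%Z = 4 ^+ 2) //; exact: square_in_sqr.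
Qed.

Lemma two_witness_torsor d b1 b2 b3 a0 a : b1 != 0 -> b2 != 0 -> b3 != 0 ->
  two_witness d b1 b2 b3 a0 a -> torsorZ K d b1 b2 b3.
Proof.
move=> b10 b20 b30 /andP[a0a /or3P[]] /andP[/two_square_in s1 /two_square_in s2].
- exact: (torsorZ_fix01 K0 b20 b30 a0a s1 s2).
- exact: (torsorZ_fix02 K0 b10 b30 a0a s1 s2).
- exact: (torsorZ_fix03 K0 b10 b20 a0a s1 s2).
Qed.

Definition res8 u : nat := `|(u %% 8)%Z|%N.

Lemma res8E u : (res8 u)%:Z = (u %% 8)%Z.
Proof. by rewrite /res8; lia. Qed.

Lemma res8_odd u : ~~ (2 %| u)%Z -> res8 u \in odd8.
Proof. by move=> u2; have := res8E u; rewrite !inE; lia. Qed.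

Lemma square_in_res8 (c u v : int) : ~~ (2 %| u)%Z -> (8 %| u - v)%Z ->
  square_in K (c * u * (c * v)).
Proof.
move=> u2 uv; rewrite mulrACA -expr2; apply: square_inM; first exact: square_in_sqr.
apply: padic_square_two.
have uu : (8 %| u * u - 1)%Z.
  have [k ->] : exists k, u = 2 * k + 1 by exists (u %/ 2)%Z; lia.
  have [j [kj|kj]] : exists j, k = 2 * j \/ k = 2 * j + 1 by exists (k %/ 2)%Z; lia.
    by apply/dvdzP; exists (2 * j ^+ 2 + j); rewrite kj; lia.
  rewrite kj; apply/dvdzP; exists (2 * j ^+ 2 + 3 * j + 1); lia.
have -> : u * v - 1 = u * u - 1 - u * (u - v) by ring.
by rewrite rpredB // dvdz_mull.
Qed.

(** Odd integers congruent modulo 8 differ by a 2-adic square, so only finitely many torsors remain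
    at 2. *)
Lemma torsorZ_res8 (g x : bool) u w m :
  ~~ (2 %| u)%Z -> ~~ (2 %| w)%Z -> ~~ (2 %| m)%Z ->
  torsorZ K (2 * m) (2%:Z ^+ g * u) (2%:Z ^+ x * w) (2%:Z ^+ (g (+) x) * (u * w)) <->
  torsorZ K (2 * (res8 m)%:Z) (two_class g (res8 u))%:Z (two_class x (res8 w))%:Z
    (two_class3 g x (res8 u) (res8 w))%:Z.
Proof.
move=> u2 w2 m2.
have uw2 : ~~ (2 %| u * w)%Z by rewrite (@ndvdzM 2 isT) u2.
have E (h : bool) (k : nat) : (2 ^ h * k)%N%:Z = 2%:Z ^+ h * k%:Z by case: h; rewrite PoszM.
rewrite /two_class /two_class3 !E.
have pw (h : bool) : 2%:Z ^+ h != 0 by case: h.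
have n0 (v : int) : ~~ (2 %| v)%Z -> v != 0 by lia.
have r0 (v : int) : ~~ (2 %| v)%Z -> (res8 v)%:Z != 0 by have := res8E v; lia.
have ruw : (8 %| u * w - ((res8 u * res8 w) %% 8)%N%:Z)%Z.
  have -> : ((res8 u * res8 w) %% 8)%N%:Z = ((u * w) %% 8)%Z.
    by rewrite -modz_nat PoszM !res8E modzMml modzMmr.
  by lia.
have ruw0 : ((res8 u * res8 w) %% 8)%N%:Z != 0.
  by apply: contraNneq uw2 => h; move: ruw; rewrite h; lia.
have res v : (8 %| v - (res8 v)%:Z)%Z by rewrite res8E; lia.
have := (n0 u u2, n0 w w2, n0 m m2, r0 u u2, r0 w w2, r0 m m2).
case=> [[[[[u0 w0] m0] ru0] rw0] rm0].
by apply: torsorZ_square => //; rewrite ?mulf_neq0 //; apply: square_in_res8.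
Qed.

Lemma square_mod16 a : exists s k,
  [/\ s \in squares16, a ^+ 2 = s%:Z + 16 * k & odd s = ~~ (2 %| a)%Z].
Proof.
have [k [r [r8 aE]]] : exists k r, (r < 8)%N /\ a = 8 * k + r%:Z.
  by exists (a %/ 8)%Z, `|(a %% 8)%Z|%N; lia.
exists (r ^ 2 %% 16)%N, (4 * k ^+ 2 + k * r%:Z + (r ^ 2 %/ 16)%N%:Z); split.
- by case: r r8 {aE} => [|[|[|[|[|[|[|[|r]]]]]]]].
- have rE : r%:Z ^+ 2 = (r ^ 2 %/ 16)%N%:Z * 16 + (r ^ 2 %% 16)%N%:Z.
    by rewrite expr2 -!PoszM mulnn -PoszD -divn_eq.
  by rewrite aE sqrrD rE exprMn; lia.
- have -> : (2 %| a)%Z = ~~ odd r by rewrite aE; lia.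
  by rewrite negbK; case: r r8 {aE} => [|[|[|[|[|[|[|[|r]]]]]]]].
Qed.

Lemma place2_nec (g x : bool) u w m :
  ~~ (2 %| u)%Z -> ~~ (2 %| w)%Z -> ~~ (2 %| m)%Z ->
  torsorZ K (2 * m) (2%:Z ^+ g * u) (2%:Z ^+ x * w) (2%:Z ^+ (g (+) x) * (u * w)) ->
  two_cond g x (res8 u) (res8 m).
Proof.
move=> u2 w2 m2 /(torsorZ_res8 g x u2 w2 m2).
have := res8_odd u2; have := res8_odd w2; have := res8_odd m2.
move: (res8 u) (res8 w) (res8 m) => {u2 w2 m2} {}u {}w {}m mo wo uo.
move=> /torsorZ_residues/(_ 4%N isT)[a0 [a1 [a2 [a3 [nz h1 h2]]]]].
have [s0 [k0 [s0i s0E s0o]]] := square_mod16 a0.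
have [s1 [k1 [s1i s1E s1o]]] := square_mod16 a1.
have [s2 [k2 [s2i s2E s2o]]] := square_mod16 a2.
have [s3 [k3 [s3i s3E s3o]]] := square_mod16 a3.
have gi : g \in bools by case: (g).
have xi : x \in bools by case: (x).
have /allP/(_ g gi)/allP/(_ x xi)/allP/(_ u uo)/allP/(_ w wo)/allP/(_ m mo) := two_obstructionP.
move=> /allP/(_ s0 s0i)/allP/(_ s1 s1i)/allP/(_ s2 s2i).
rewrite s0E s1E s2E in h1; rewrite s0E s1E s3E in h2.
move: h1 h2; set b1 := two_class g u; set b2 := two_class x w; set b3 := two_class3 g x u w.
move=> h1 h2.
have E1 : (b1 * s1 == b2 * s2 + 2 * m * s0 %[mod 16])%N.
  by rewrite (cong16_2 (k1 := k1) (k2 := k2) (k0 := k0)).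
rewrite E1 implyTb => /allP/(_ s3 s3i).
have E2 : (b1 * s1 + 6 * m * s0 == b3 * s3 %[mod 16])%N.
  by rewrite (cong16_3 (k1 := k1) (k3 := k3) (k0 := k0)).
by rewrite E2 s0o s1o s2o s3o -!negb_and nz.
Qed.

Lemma place2_suff (g x : bool) u w m :
  ~~ (2 %| u)%Z -> ~~ (2 %| w)%Z -> ~~ (2 %| m)%Z ->
  two_cond g x (res8 u) (res8 m) -> two_cond3 x (res8 w) (res8 m) ->
  torsorZ K (2 * m) (2%:Z ^+ g * u) (2%:Z ^+ x * w) (2%:Z ^+ (g (+) x) * (u * w)).
Proof.
move=> u2 w2 m2 c12 c3; apply/(torsorZ_res8 g x u2 w2 m2).
have := res8_odd u2; have := res8_odd w2; have := res8_odd m2.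
move: (res8 u) (res8 w) (res8 m) c12 c3 => {u2 w2 m2} {}u {}w {}m c12 c3 mo wo uo.
have gi : g \in bools by case: (g).
have xi : x \in bools by case: (x).
have /allP/(_ g gi)/allP/(_ x xi)/allP/(_ u uo)/allP/(_ w wo)/allP/(_ m mo) := two_solvableP.
rewrite /two_solvable c12 c3 => /hasP[a0 _ /hasP[a _]].
have odd_gt0 k : k \in odd8 -> (0 < k)%N by rewrite !inE; lia.
have pw (h : bool) : (0 < 2 ^ h)%N by case: h.
apply: two_witness_torsor; rewrite eqz_nat -lt0n muln_gt0 pw ?odd_gt0 //=.
by move: uo wo; rewrite !inE => /or4P[]/eqP-> /or4P[]/eqP->.
Qed.
End PlaceTwo.

(** * The rows of the Monsky matrix *)

Section Kernel.
Variables (t : nat) (p : 'I_t -> nat).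
Implicit Type v : 'cV['F_2]_(6 + (t + t)).

(** Indices 0, 1, 2 hold the exponents of -1, 2, 3 in [b2], and 3, 4, 5 those in [b1]; [ycoef]
    belongs to [b2] and [xcoef] to [b1]. *)
Definition coef v k : 'F_2 := usubmx v (inord k) 0.
Definition ycoef v i : 'F_2 := usubmx (dsubmx v) i 0.
Definition xcoef v i : 'F_2 := dsubmx (dsubmx v) i 0.

Definition global_rows v : Prop :=
  [/\ coef v 0 = 0,
      coef v 3 + (1 + add_jacobi p (-1)) * coef v 4 + coef v 5
        + \sum_i add_legendre (-1) (p i) * xcoef v i = 0,
      coef v 1 + add_jacobi p 2 * coef v 4 + coef v 5
        + \sum_i add_legendre 2 (p i) * xcoef v i = 0,
      coef v 0 + coef v 1 + (1 + add_jacobi p (- 3)) * coef v 5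
        + \sum_i add_legendre (- 3) (p i) * ycoef v i = 0
    & coef v 2 = 0].

Definition local_rows v (i : 'I_t) : Prop :=
  add_legendre (-1) (p i) * coef v 3 + add_legendre 2 (p i) * coef v 4
    + add_legendre 3 (p i) * coef v 5 + add_legendre (- 3) (p i) * ycoef v i
    + (\sum_j A_ p i j * xcoef v j + add_legendre (- 2) (p i) * xcoef v i) = 0 /\
  add_legendre (-1) (p i) * coef v 0 + add_legendre 2 (p i) * coef v 1
    + add_legendre 3 (p i) * coef v 2
    + (\sum_j A_ p i j * ycoef v j + add_legendre 2 (p i) * ycoef v i) = 0.

Lemma sum6 (f : 'I_6 -> 'F_2) : \sum_j f j =
  f (inord 0) + f (inord 1) + f (inord 2) + f (inord 3) + f (inord 4) + f (inord 5).
Proof.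
rewrite !big_ord_recr big_ord0 /= add0r.
by do !congr (_ + _); congr f; apply: val_inj; rewrite /= inordK.
Qed.

Lemma diag_mulmx (d : 'rV['F_2]_t) (u : 'cV['F_2]_t) i : (diag_mx d *m u) i 0 = d 0 i * u i 0.
Proof. by rewrite mul_diag_mx mxE. Qed.

Lemma B2_kernel v : B2 p *m v = 0 <-> global_rows v /\ forall i, local_rows v i.
Proof.
have vE : v = col_mx (usubmx v) (col_mx (usubmx (dsubmx v)) (dsubmx (dsubmx v))).
  by rewrite !vsubmxK.
rewrite {1}vE /B2 mul_block_col !mul_row_col mul_block_col.
set U := usubmx v; set Y := usubmx (dsubmx v); set W := dsubmx (dsubmx v).
have cm0 m1 m2 (a : 'cV['F_2]_m1) (b : 'cV['F_2]_m2) : col_mx a b = 0 <-> a = 0 /\ b = 0.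
  by split=> [/eqP|[-> ->]]; rewrite ?col_mx0 // col_mx_eq0 => /andP[/eqP-> /eqP->].
rewrite mul_col_mx add_col_mx !cm0.
have col0 m (a : 'cV['F_2]_m) : a = 0 <-> forall i, a i 0 = 0.
  split=> [-> i|H]; first by rewrite mxE.
  by apply/matrixP => i j; rewrite ord1 H mxE.
rewrite !col0.
have rows_mul m (r : seq 'rV['F_2]_t) (u : 'cV['F_2]_t) (i : 'I_m) :
    (of_rows m r *m u) i 0 = \sum_j (nth 0 r i) 0 j * u j 0.
  by rewrite mxE; apply: eq_bigr => j _; rewrite !mxE.
have row0 (u : 'cV['F_2]_t) : \sum_j (0 : 'rV['F_2]_t) 0 j * u j 0 = 0.
  by rewrite big1 // => j _; rewrite mxE mul0r.
have row_r d (u : 'cV['F_2]_t) :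
    \sum_j (r_ p d) 0 j * u j 0 = \sum_j add_legendre d (p j) * u j 0.
  by apply: eq_bigr => j _; rewrite mxE.
have entries_mul (e : seq (seq 'F_2)) (i : 'I_5) : (of_entries 5 6 e *m U) i 0 =
    let r := nth [::] e i in r`_0 * coef v 0 + r`_1 * coef v 1 + r`_2 * coef v 2
      + r`_3 * coef v 3 + r`_4 * coef v 4 + r`_5 * coef v 5.
  by rewrite mxE sum6 ![of_entries _ _ _ _ _]mxE !inordK //.
have cols_mul (r : seq 'rV['F_2]_t) (i : 'I_t) : ((of_rows 6 r)^T *m U) i 0 =
    r`_0 0 i * coef v 0 + r`_1 0 i * coef v 1 + r`_2 0 i * coef v 2
      + r`_3 0 i * coef v 3 + r`_4 0 i * coef v 4 + r`_5 0 i * coef v 5.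
  by rewrite mxE sum6 ![(of_rows _ _)^T _ _]mxE ![of_rows _ _ _ _]mxE !inordK //.
have addE m n (a b : 'M['F_2]_(m, n)) i j : (a + b) i j = a i j + b i j by rewrite mxE.
have E5 (Q : nat -> Prop) : (forall i : 'I_5, Q i) <-> [/\ Q 0%N, Q 1%N, Q 2%N, Q 3%N & Q 4%N].
  split=> [H|[q0 q1 q2 q3 q4] [[|[|[|[|[|//]]]]] ilt] //].
  by split; [have := H (inord 0)|have := H (inord 1)|have := H (inord 2)
    |have := H (inord 3)|have := H (inord 4)]; rewrite inordK.
have Q5 (i : 'I_5) (e : seq (seq 'F_2)) r1 r2 :
  (of_entries 5 6 e *m U + (of_rows 5 r1 *m Y + of_rows 5 r2 *m W)) i 0 =
  (fun k => let r := nth [::] e k in r`_0 * coef v 0 + r`_1 * coef v 1 + r`_2 * coef v 2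
      + r`_3 * coef v 3 + r`_4 * coef v 4 + r`_5 * coef v 5 +
   (\sum_j (nth 0 r1 k) 0 j * Y j 0 + \sum_j (nth 0 r2 k) 0 j * W j 0)) (i : nat).
  by rewrite !addE entries_mul !rows_mul.
have -> : (forall i : 'I_t,
   ((of_rows 6 [:: 0; 0; 0; r_ p (-1); r_ p 2; r_ p 3])^T *m U +
    (D_ p (-3) *m Y + (A_ p + D_ p (-2)) *m W)) i 0 = 0) /\
  (forall i : 'I_t, ((of_rows 6 [:: r_ p (-1); r_ p 2; r_ p 3; 0; 0; 0])^T *m U +
    ((A_ p + D_ p 2) *m Y + 0 *m W)) i 0 = 0) <-> forall i, local_rows v i.
  have e1 (i : 'I_t) : ((of_rows 6 [:: 0; 0; 0; r_ p (-1); r_ p 2; r_ p 3])^T *m U +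
    (D_ p (-3) *m Y + (A_ p + D_ p (-2)) *m W)) i 0 =
     add_legendre (-1) (p i) * coef v 3 + add_legendre 2 (p i) * coef v 4
    + add_legendre 3 (p i) * coef v 5 + add_legendre (- 3) (p i) * ycoef v i
    + (\sum_j A_ p i j * xcoef v j + add_legendre (- 2) (p i) * xcoef v i).
    rewrite !addE cols_mul /= mulmxDl addE !diag_mulmx !mxE !mul0r !add0r !addrA.
    by rewrite /ycoef /xcoef !mxE.
  have e2 (i : 'I_t) : ((of_rows 6 [:: r_ p (-1); r_ p 2; r_ p 3; 0; 0; 0])^T *m U +
    ((A_ p + D_ p 2) *m Y + 0 *m W)) i 0 =
    add_legendre (-1) (p i) * coef v 0 + add_legendre 2 (p i) * coef v 1
    + add_legendre 3 (p i) * coef v 2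
    + (\sum_j A_ p i j * ycoef v j + add_legendre 2 (p i) * ycoef v i).
    rewrite !addE cols_mul /= mul0mx mulmxDl addE !diag_mulmx !mxE !mul0r !addr0 !addrA.
    by rewrite /ycoef !mxE.
  split=> [[h1 h2] i|h].
    by split; [rewrite -e1|rewrite -e2].
  by split=> i; [rewrite e1|rewrite e2]; case: (h i).
have {Q5} -> : (forall i : 'I_5, (of_entries 5 6
      [:: [:: 1; 0; 0; 0; 0; 0]; [:: 0; 0; 0; 1; 1 + add_jacobi p (-1); 1];
          [:: 0; 1; 0; 0; add_jacobi p 2; 1];
          [:: 1; 1; 0; 0; 0; 1 + add_jacobi p (-3)]; [::
          0; 0; 1; 0; 0; 0]] *m U +
    (of_rows 5 [:: 0; 0; 0; r_ p (-3); 0] *m Y +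
     of_rows 5 [:: 0; r_ p (-1); r_ p 2; 0; 0] *m W)) i 0 = 0) <-> global_rows v.
  transitivity (global_rows v) => //.
  rewrite /global_rows.
  split => [h|h].
    have := h (inord 0); have := h (inord 1); have := h (inord 2).
    have := h (inord 3); have := h (inord 4).
    rewrite !Q5 !inordK //= !row0 !row_r !mul0r !mul1r !addr0 !add0r.
    by move=> *; split.
  by case=> [[|[|[|[|[|//]]]]] ilt];
    rewrite Q5 /= ?row0 ?row_r ?mul0r ?mul1r ?addr0 ?add0r; case: h.
by [].
Qed.
End Kernel.

Definition bit (e : 'F_2) : bool := e != 0.

Lemma bitE e : e = (bit e)%:R.
Proof. by case: (F2_cases e) => ->; apply: val_inj. Qed.

Lemma val_bit e : val e = bit e.
Proof. by case: (F2_cases e) => ->. Qed.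

Lemma bit_inj e e' : bit e = bit e' -> e = e'.
Proof. by move=> h; rewrite (bitE e) (bitE e') h. Qed.

(** * Decoded integers and their local symbols *)

Section Decode.
Variables (t : nat) (p : 'I_t -> nat).
Implicit Types (e : 'F_2) (x : 'I_t -> 'F_2) (P : pred 'I_t).

(** Restricting the product to [P] lets the same form express the part of a decoded integer prime to
    [p i]. *)
Definition dec P e0 e1 e2 x : int :=
  (-1) ^+ val e0 * 2 ^+ val e1 * 3 ^+ val e2 * \prod_(i | P i) (p i)%:Z ^+ val (x i).

Section Symbol.
Variables (U : pred int) (f : int -> 'F_2).
Hypotheses (U1 : U 1) (f1 : f 1 = 0).
Hypotheses (UM : forall a b, U a -> U b -> U (a * b))
  (fM : forall a b, U a -> U b -> f (a * b) = f a + f b).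

Lemma symbol_pow (a : int) (e : 'F_2) : (e != 0 -> U a) ->
  U (a ^+ val e) /\ f (a ^+ val e) = e * f a.
Proof.
case: (F2_cases e) => -> /=; first by rewrite expr0 mul0r.
by move=> /(_ isT) Ua; rewrite expr1 mul1r.
Qed.

Lemma symbol_prod P (a : 'I_t -> int) x : (forall i, P i -> U (a i)) ->
  U (\prod_(i | P i) a i ^+ val (x i)) /\
  f (\prod_(i | P i) a i ^+ val (x i)) = \sum_(i | P i) x i * f (a i).
Proof.
move=> Ua; elim/big_rec2: _ => // i s d Pi [Ud fd].
have [Ui fi] := symbol_pow (e := x i) (fun _ => Ua i Pi).
by rewrite fM // fi fd; split=> //; apply: UM.
Qed.

(** A symbol [f], additive on the units [U] of a place, becomes a linear form in the exponents: this
    is where the rows of the matrix come from. With [f = 0] the lemma only transports [U]. *)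
Lemma symbol_dec P e0 e1 e2 x :
  U (-1) -> (e1 != 0 -> U 2) -> (e2 != 0 -> U 3) -> (forall i, P i -> U (p i)) ->
  U (dec P e0 e1 e2 x) /\
  f (dec P e0 e1 e2 x) = e0 * f (-1) + e1 * f 2 + e2 * f 3 + \sum_(i | P i) x i * f (p i).
Proof.
move=> UN1 U2 U3 Up.
have [Va fa] := symbol_pow (e := e0) (fun _ => UN1).
have [Vb fb] := symbol_pow U2; have [Vc fc] := symbol_pow U3.
have [Vd fd] := symbol_prod x Up.
have Vab := UM Va Vb; have Vabc := UM Vab Vc; split; first exact: UM.
by rewrite fM // fM // fM // fa fb fc fd.
Qed.
End Symbol.

Lemma dec_split2 e0 e1 e2 x : dec predT e0 e1 e2 x = 2%:Z ^+ bit e1 * dec predT e0 0 e2 x.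
Proof. by rewrite /dec (val_bit e1) expr0 mulr1; ring. Qed.

Lemma dec_split3 e0 e1 e2 x : dec predT e0 e1 e2 x = 3%:Z ^+ bit e2 * dec predT e0 e1 0 x.
Proof. by rewrite /dec (val_bit e2) expr0 mulr1; ring. Qed.

Lemma dec_splitp i e0 e1 e2 x :
  dec predT e0 e1 e2 x = (p i)%:Z ^+ bit (x i) * dec (fun j => j != i) e0 e1 e2 x.
Proof. by rewrite /dec (bigD1 i) //= (val_bit (x i)); ring. Qed.

Lemma decode1E v : decode1 p v =
  (dec predT (coef v 3) (coef v 4) (coef v 5) (xcoef v))%:~R.
Proof.
rewrite /decode1 /dec !intrM !rmorphXn /= (rmorph_prod (intr : int -> rat)).
by congr (_ * _ * _ * _); apply: eq_bigr => i _; rewrite rmorphXn.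
Qed.

Lemma decode2E v : decode2 p v =
  (dec predT (coef v 0) (coef v 1) (coef v 2) (ycoef v))%:~R.
Proof.
rewrite /decode2 /dec !intrM !rmorphXn /= (rmorph_prod (intr : int -> rat)).
by congr (_ * _ * _ * _); apply: eq_bigr => i _; rewrite rmorphXn.
Qed.

Hypotheses (p_prime : forall i, prime (p i)) (p_neq2 : forall i, p i <> 2%N)
    (p_neq3 : forall i, p i <> 3%N) (p_inj : injective p).

Lemma dec_neq0 P e0 e1 e2 x : dec P e0 e1 e2 x != 0.
Proof.
have [] := @symbol_dec (fun a => a != 0) (fun _ => 0) isT (erefl 0) (@mulf_neq0 _)
  (fun _ _ _ _ => esym (addr0 0)) P e0 e1 e2 x isT (fun _ => isT) (fun _ => isT) => //.
by move=> i _; have := prime_gt0 (p_prime i); lia.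
Qed.

Lemma dec_lt0 P e0 e1 e2 x : (dec P e0 e1 e2 x < 0) = bit e0.
Proof.
rewrite /dec -!mulrA; set r := (X in _ * X); have r0 : 0 < r.
  do 2!(apply: mulr_gt0; first by rewrite exprn_gt0).
  apply: prodr_gt0 => i _.
  by rewrite exprn_gt0 // ltz_nat prime_gt0.
by case: (F2_cases e0) => -> /=; rewrite ?expr0 ?expr1 ?mul1r ?mulN1r ?oppr_lt0 ?r0 // ltNge ltW.
Qed.

Lemma dec_ndvdz q P e0 e1 e2 x : prime q ->
  (e1 != 0 -> q <> 2%N) -> (e2 != 0 -> q <> 3%N) -> (forall i, P i -> q <> p i) ->
  ~~ (q%:Z %| dec P e0 e1 e2 x)%Z.
Proof.
move=> q_pr q2 q3 qp; pose U (a : int) := ~~ (q%:Z %| a)%Z.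
have UM (a b : int) : U a -> U b -> U (a * b) by rewrite /U ndvdzM // => -> ->.
have Uq (r : nat) : prime r -> q <> r -> U r.
  by move=> r_pr qr; rewrite /U dvdzE /= dvdn_prime2 //; apply/eqP.
have U1 : U 1 by rewrite /U dvdzE /= gtnNdvd // prime_gt1.
have UN1 : U (-1) by rewrite /U dvdzE /= gtnNdvd // prime_gt1.
have [] := @symbol_dec U (fun _ => 0) U1 (erefl 0) UM
  (fun _ _ _ _ => esym (addr0 0)) P e0 e1 e2 x UN1 => //.
- by move=> /q2 => /(Uq 2 isT).
- by move=> /q3 => /(Uq 3 isT).
- by move=> i /qp; apply: Uq.
Qed.

Lemma dec_legendre q P e0 e1 e2 x : prime q -> q <> 2%N ->
  (e2 != 0 -> q <> 3%N) -> (forall i, P i -> q <> p i) ->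
  add_legendre (dec P e0 e1 e2 x) q =
    e0 * add_legendre (-1) q + e1 * add_legendre 2 q + e2 * add_legendre 3 q
    + \sum_(i | P i) x i * add_legendre (p i) q.
Proof.
move=> q_pr q2 q3 qp; pose U (a : int) := ~~ (q%:Z %| a)%Z.
have UM (a b : int) : U a -> U b -> U (a * b) by rewrite /U ndvdzM // => -> ->.
have Uq (r : nat) : prime r -> q <> r -> U r.
  by move=> r_pr qr; rewrite /U dvdzE /= dvdn_prime2 //; apply/eqP.
have U1 : U 1 by rewrite /U dvdzE /= gtnNdvd // prime_gt1.
have UN1 : U (-1) by rewrite /U dvdzE /= gtnNdvd // prime_gt1.
have [] := @symbol_dec U (fun a => add_legendre a q) U1
  (add_legendre1 q_pr (odd_primeE q_pr q2)) UM (alM q_pr q2) P e0 e1 e2 x UN1 => //.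
- by move=> _; apply: (Uq 2).
- by move=> /q3 => /(Uq 3 isT).
- by move=> i /qp; apply: Uq.
Qed.

Lemma dec_two (f : int -> 'F_2) P e0 e2 x : f 1 = 0 ->
  (forall a b, ~~ (2 %| a)%Z -> ~~ (2 %| b)%Z -> f (a * b) = f a + f b) ->
  f (dec P e0 0 e2 x) = e0 * f (-1) + e2 * f 3 + \sum_(i | P i) x i * f (p i).
Proof.
move=> f1 fM; have UM (a b : int) : ~~ (2 %| a)%Z -> ~~ (2 %| b)%Z -> ~~ (2 %| a * b)%Z.
  by move=> a2 b2; rewrite (@ndvdzM 2 isT) a2.
have [] := @symbol_dec (fun a => ~~ (2 %| a)%Z) f isT f1 UM fM P e0 0 e2 x isT => //.
  move=> i _; rewrite dvdzE /= dvdn_prime2 // eq_sym; exact/eqP.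
by rewrite mul0r addr0.
Qed.

Definition place_cofactor (i : 'I_t) : int := - 2 * \prod_(j < t | j != i) (p j)%:Z.
Definition radical : int := \prod_(i < t) (p i)%:Z.

Lemma place_cofactorE i : - 2 * radical = (p i)%:Z * place_cofactor i.
Proof. by rewrite /radical (bigD1 i) //= mulrCA. Qed.

Lemma cofactor_dec i (b : bool) : (-1) ^+ b * 2 * \prod_(j < t | j != i) (p j)%:Z =
  dec (fun j => j != i) b%:R 1 0 (fun _ => 1).
Proof. by rewrite /dec expr0 !expr1 mulr1; case: b. Qed.

(** The diagonal entry of [A_] is the symbol at [p i] of the product of the other primes. It
    accounts for the cofactor of [p i] in [n], which enters when [p i] divides the decoded
    integer. *)
Lemma A_sum (y : 'I_t -> 'F_2) i : \sum_j A_ p i j * y j =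
  \sum_(j | j != i) y j * add_legendre (p j) (p i)
  + y i * \sum_(j | j != i) add_legendre (p j) (p i).
Proof.
rewrite (bigD1 i) //= mxE eqxx addrC mulrC; congr (_ + _); apply: eq_bigr => j ji.
by rewrite mxE eq_sym (negPf ji) mulrC.
Qed.

Lemma legendreM2 (a b : int) i : ~~ (p i %| a)%Z -> ~~ (p i %| b)%Z ->
  add_legendre (a * b) (p i) = add_legendre a (p i) + add_legendre b (p i).
Proof. exact: alM (p_prime i) (@p_neq2 i) _ _. Qed.

(** The blocks [D_ (- 2)] and [D_ 2] come from the factors of [n / p_i] and of its opposite that the
    diagonal of [A_] does not contain. *)
Lemma local_rowsP v i : local_rows p v i <->
  let c1 := dec (fun j => j != i) (coef v 3) (coef v 4) (coef v 5) (xcoef v) in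
  let c2 := dec (fun j => j != i) (coef v 0) (coef v 1) (coef v 2) (ycoef v) in
  add_legendre c1 (p i) + (bit (xcoef v i))%:R * add_legendre (place_cofactor i) (p i)
    + (bit (ycoef v i))%:R * add_legendre (- 3) (p i) = 0 /\
  add_legendre c2 (p i) + (bit (ycoef v i))%:R * add_legendre (- place_cofactor i) (p i) = 0.
Proof.
have ne (j : 'I_t) : j != i -> p i <> p j by move=> ji /p_inj/esym/eqP; rewrite (negPf ji).
have cof1 : place_cofactor i = dec (fun j => j != i) 1 1 0 (fun _ => 1).
  by rewrite -(cofactor_dec i true) /place_cofactor /=; ring.
have cof2 : - place_cofactor i = dec (fun j => j != i) 0 1 0 (fun _ => 1).
  by rewrite -(cofactor_dec i false) /place_cofactor /=; ring.
have p2' : ~~ (p i %| 2%:R)%Z by exact: ndvdz2.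
have pN1' : ~~ (p i %| -1)%Z by rewrite dvdzE /= gtnNdvd // prime_gt1.
have N2 : add_legendre (- 2) (p i) = add_legendre (-1) (p i) + add_legendre 2 (p i).
  by rewrite -[- 2]mulN1r legendreM2.
rewrite /= -!bitE cof1 cof2 !dec_legendre //.
rewrite /local_rows !A_sum N2 !mul0r !mul1r !addr0 !add0r.
have S1 : \sum_(j | j != i) 1 * add_legendre (p j) (p i)
    = \sum_(j | j != i) add_legendre (p j) (p i) by apply: eq_bigr => j _; rewrite mul1r.
rewrite ?S1.
have iff0 (a b a' b' : 'F_2) : a = a' -> b = b' -> (a = 0 /\ b = 0) <-> (a' = 0 /\ b' = 0).
  by move=> -> ->.
by apply: iff0; ring.
Qed.

Lemma torsorZ_xor (K : fieldType) (P d c1 c2 : int) (x y : bool) :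
  (forall a : int, a != 0 -> a%:~R != 0 :> K) ->
  P != 0 -> d != 0 -> c1 != 0 -> c2 != 0 ->
  torsorZ K d (P ^+ x * c1) (P ^+ y * c2) (P ^+ x * c1 * (P ^+ y * c2)) <->
  torsorZ K d (P ^+ x * c1) (P ^+ y * c2) (P ^+ (x (+) y) * (c1 * c2)).
Proof.
move=> K0 P0 d0 c10 c20; apply: torsorZ_square => //; rewrite ?mulf_neq0 ?expf_neq0 //.
1-3: by rewrite -expr2; apply: square_in_sqr.
(* As integers, [x + y + (x (+) y)] is twice [x || y]. *)
rewrite (_ : _ * _ = (P ^+ (x || y) * c1 * c2) ^+ 2); first exact: square_in_sqr.
by case: x; case: y; rewrite /= ?expr0 ?expr1; ring.
Qed.

Definition dec1 v := dec predT (coef v 3) (coef v 4) (coef v 5) (xcoef v).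
Definition dec2 v := dec predT (coef v 0) (coef v 1) (coef v 2) (ycoef v).

Lemma radical_gt0 : 0 < radical.
Proof. by apply: prodr_gt0 => i _; rewrite ltz_nat prime_gt0. Qed.

Let n : int := - 2 * radical.

Lemma n_neq0 : n != 0.
Proof. by have := radical_gt0; rewrite /n; lia. Qed.

Lemma radical_ndvdz q : prime q -> (forall i, q <> p i) -> ~~ (q%:Z %| radical)%Z.
Proof.
move=> q_pr qp; have -> : radical = dec predT 0 0 0 (fun _ => 1).
  by rewrite /dec !expr0 !mul1r.
exact: dec_ndvdz.
Qed.

Lemma solvable_at_p v i :
  torsorZ (padic (p_prime i)) n (dec1 v) (dec2 v) (dec1 v * dec2 v) <-> local_rows p v i.
Proof.
have ne (j : 'I_t) : j != i -> p i <> p j by move=> ji /p_inj/esym/eqP; rewrite (negPf ji).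
have P0 : (p i)%:Z != 0 by have := prime_gt0 (p_prime i); lia.
rewrite local_rowsP /dec1 /dec2 !(dec_splitp i).
rewrite torsorZ_xor ?dec_neq0 ?n_neq0 //; last exact: padic_char0.
rewrite /n (place_cofactorE i) bad_place //.
- exact: dec_ndvdz.
- exact: dec_ndvdz.
have -> : place_cofactor i = dec (fun j => j != i) 1 1 0 (fun _ => 1).
  by rewrite -(cofactor_dec i true) /place_cofactor /=; ring.
exact: dec_ndvdz.
Qed.

Lemma solvable_good q (q_pr : prime q) v : q <> 2%N -> q <> 3%N -> (forall i, q <> p i) ->
  torsorZ (padic q_pr) n (dec1 v) (dec2 v) (dec1 v * dec2 v).
Proof.
move=> q2 q3 qp; apply: torsorZ_good => //; try exact: dec_ndvdz.
rewrite /n ndvdzM // radical_ndvdz // andbT.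
by rewrite dvdzE /= dvdn_prime2 //; apply/eqP.
Qed.

Lemma solvable_real (R : realType) v :
  torsorZ R n (dec1 v) (dec2 v) (dec1 v * dec2 v) <-> coef v 0 = 0.
Proof.
rewrite real_place ?dec_neq0 //; last by have := radical_gt0; rewrite /n; lia.
have := dec_lt0 predT (coef v 0) (coef v 1) (coef v 2) (ycoef v).
have := dec_neq0 predT (coef v 0) (coef v 1) (coef v 2) (ycoef v).
rewrite -/(dec2 v) => d0 dlt; have -> : (0 < dec2 v) = ~~ bit (coef v 0) by rewrite -dlt; lia.
by rewrite /bit negbK; split=> [/eqP|->].
Qed.

(** The symbols of [p i] at 3 and of [- 3] at [p i] both equal [theta (p i)], which turns the
    condition at 3 into entries of [r_ (- 3)]. *)
Lemma legendre3_sum P (y : 'I_t -> 'F_2) :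
  \sum_(i | P i) y i * add_legendre (p i) 3 = \sum_(i | P i) add_legendre (- 3) (p i) * y i.
Proof.
apply: eq_bigr => i _; rewrite mulrC add_legendreN3 // add_legendre_theta //.
by rewrite dvdzE /= dvdn_prime2 //; apply/eqP; exact: nesym.
Qed.

Lemma solvable_at_3 (p3 : prime 3) v :
  torsorZ (padic p3) n (dec1 v) (dec2 v) (dec1 v * dec2 v) <->
  coef v 2 = 0 /\
  coef v 0 + coef v 1 + (1 + add_jacobi p (- 3)) * coef v 5
        + \sum_i add_legendre (- 3) (p i) * ycoef v i = 0.
Proof.
have ne i : 3%N <> p i by exact: nesym.
set w := dec predT (coef v 0) (coef v 1) 0 (ycoef v).
set u := dec predT (coef v 3) (coef v 4) 0 (xcoef v).
have pu : ~~ (3 %| u)%Z by exact: dec_ndvdz.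
have pw : ~~ (3 %| w)%Z by exact: dec_ndvdz.
have pn : ~~ (3 %| n)%Z by rewrite /n (@ndvdzM 3) // radical_ndvdz.
have L1 : add_legendre (-1) 3 = 1 by rewrite add_legendreN1.
have L2 : add_legendre 2 3 = 1 by rewrite add_legendre2.
have wE : add_legendre w 3 = coef v 0 + coef v 1 + \sum_i add_legendre (- 3) (p i) * ycoef v i.
  by rewrite dec_legendre // L1 L2 !mulr1 mul0r addr0 legendre3_sum.
have nE : add_legendre (- n) 3 = 1 + add_jacobi p (- 3).
  have -> : - n = dec predT 0 1 0 (fun _ => 1).
    by rewrite /dec /n /radical !expr0 !expr1 mul1r mulr1; ring.
  rewrite dec_legendre // L2 !mul0r add0r mulr1 addr0 legendre3_sum.
  by congr (_ + _); apply: eq_bigr => i _; rewrite mulr1.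
rewrite /dec1 /dec2 (dec_split3 _ _ (coef v 5)) (dec_split3 _ _ (coef v 2)) -/u -/w.
rewrite torsorZ_xor ?dec_neq0 ?n_neq0 //; last exact: padic_char0.
have rE : coef v 0 + coef v 1 + (1 + add_jacobi p (- 3)) * coef v 5
    + \sum_i add_legendre (- 3) (p i) * ycoef v i =
  add_legendre w 3 + (bit (coef v 5))%:R * add_legendre (- n) 3.
  by rewrite wE nE -bitE; ring.
rewrite rE; split.
  move=> /(place3_nec pu pw pn)[y0 E]; split=> //.
  by apply: bit_inj; rewrite y0.
by move=> [-> E]; rewrite addbF expr0 mul1r; apply: place3_suff.
Qed.
End Decode.

Lemma eps_natE u : eps u = (eps_nat (res8 u))%:R.
Proof. by rewrite /eps /eps_nat; congr (nat_of_bool _)%:R; have := res8E u; lia. Qed.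

Lemma omega_natE u : omega u = (omega_nat (res8 u))%:R.
Proof. by rewrite /omega /omega_nat; congr (nat_of_bool _)%:R; have := res8E u; lia. Qed.

Lemma two_condP (g x : bool) (u m : int) : two_cond g x (res8 u) (res8 m) <->
  eps u = g%:R * eps m /\ omega u + g%:R * omega m + x%:R = 0.
Proof.
rewrite !eps_natE !omega_natE /two_cond.
move: (eps_nat _) (eps_nat _) (omega_nat _) (omega_nat _) => a b c d.
case: g x a b c d => [] [] [] [] [] [] /=;
  by (split => [h|[h1 h2]]; [split; exact: val_inj|move/eqP: h1; move/eqP: h2]).
Qed.

Lemma two_cond3P (x : bool) (w m : int) : two_cond3 x (res8 w) (res8 m) <->
  x%:R * omega m + omega w + eps w * eps m = 0.
Proof.
rewrite !eps_natE !omega_natE /two_cond3.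
move: (eps_nat _) (eps_nat _) (omega_nat _) (omega_nat _) => a b c d.
case: x a b c d => [] [] [] [] [] /=;
  by (split => [h|h]; [exact: val_inj|move/eqP: h]).
Qed.

(** * The kernel of the matrix and everywhere local solubility *)

Section Solvability.
Variables (t : nat) (p : 'I_t -> nat).
Hypotheses (p_prime : forall i, prime (p i)) (p_neq2 : forall i, p i <> 2%N)
    (p_neq3 : forall i, p i <> 3%N) (p_inj : injective p).
Implicit Type v : 'cV['F_2]_(6 + (t + t)).

Local Notation n := (- 2 * radical p).
Local Notation m := (- radical p).

Lemma eps1 : eps 1 = 0. Proof. by apply: val_inj. Qed.
Lemma omega1 : omega 1 = 0. Proof. by apply: val_inj. Qed.

Lemma eps_dec e0 e2 x : eps (dec p predT e0 0 e2 x) =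
  e0 + e2 + \sum_i add_legendre (-1) (p i) * x i.
Proof.
rewrite (dec_two p_prime p_neq2) ?eps1 //; last exact: epsM.
have -> : eps (-1) = 1 by apply: val_inj.
have -> : eps 3 = 1 by apply: val_inj.
rewrite !mulr1.
by congr (_ + _); apply: eq_bigr => i _; rewrite mulrC add_legendreN1.
Qed.

Lemma omega_dec e0 e2 x : omega (dec p predT e0 0 e2 x) =
  e2 + \sum_i add_legendre 2 (p i) * x i.
Proof.
rewrite (dec_two p_prime p_neq2) ?omega1 //; last exact: omegaM.
have -> : omega (-1) = 0 by apply: val_inj.
have -> : omega 3 = 1 by apply: val_inj.
rewrite mulr1 mulr0 add0r.
by congr (_ + _); apply: eq_bigr => i _; rewrite mulrC add_legendre2.
Qed.

Lemma m_dec : m = dec p predT 1 0 0 (fun _ => 1).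
Proof.
by rewrite /dec !expr0 expr1 !mulr1 mulN1r.

Qed.

Lemma eps_m : eps m = 1 + add_jacobi p (-1).
Proof.
rewrite m_dec eps_dec addr0; congr (_ + _).
by apply: eq_bigr => i _; rewrite mulr1.
Qed.

Lemma omega_m : omega m = add_jacobi p 2.
Proof. by rewrite m_dec omega_dec add0r; apply: eq_bigr => i _; rewrite mulr1. Qed.

Lemma odd_dec (e0 e2 : 'F_2) (x : 'I_t -> 'F_2) : ~~ (2 %| dec p predT e0 0%R e2 x)%Z.
Proof. by apply: (dec_ndvdz p_prime) => // i _; exact: nesym. Qed.

Lemma global_rows2 v : eps (dec p predT (coef v 3) 0 (coef v 5) (xcoef v))
     = (bit (coef v 4))%:R * eps m /\
   omega (dec p predT (coef v 3) 0 (coef v 5) (xcoef v))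
     + (bit (coef v 4))%:R * omega m + (bit (coef v 1))%:R = 0 <->
   coef v 3 + (1 + add_jacobi p (-1)) * coef v 4 + coef v 5
        + \sum_i add_legendre (-1) (p i) * xcoef v i = 0 /\
   coef v 1 + add_jacobi p 2 * coef v 4 + coef v 5
        + \sum_i add_legendre 2 (p i) * xcoef v i = 0.
Proof.
rewrite eps_dec omega_dec eps_m omega_m -!bitE -F2_add_eq0.
have iff0 (a b a' b' : 'F_2) : a = a' -> b = b' -> (a = 0 /\ b = 0) <-> (a' = 0 /\ b' = 0).
  by move=> -> ->.
by apply: iff0; ring.
Qed.

Lemma torsorZ_at_2 (two_pr : prime 2) v :
  torsorZ (padic two_pr) n (dec1 p v) (dec2 p v) (dec1 p v * dec2 p v) <->
  torsorZ (padic two_pr) (2 * m)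
    (2%:Z ^+ bit (coef v 4) * dec p predT (coef v 3) 0 (coef v 5) (xcoef v))
    (2%:Z ^+ bit (coef v 1) * dec p predT (coef v 0) 0 (coef v 2) (ycoef v))
    (2%:Z ^+ (bit (coef v 4) (+) bit (coef v 1)) *
      (dec p predT (coef v 3) 0 (coef v 5) (xcoef v) *
       dec p predT (coef v 0) 0 (coef v 2) (ycoef v))).
Proof.
rewrite /dec1 /dec2 (dec_split2 _ _ (coef v 4)) (dec_split2 _ _ (coef v 1)).
rewrite torsorZ_xor ?(dec_neq0 p_prime) ?(n_neq0 p_prime) //; last exact: padic_char0.
by rewrite mulNr mulrN.
Qed.

(* Summing the last rows, quadratic reciprocity gives the product formula for
   the Hilbert symbols [(b2, n)]; it provides the condition at 2 that [B2]
   omits. *)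
Lemma product_formula v : (forall i, local_rows p v i) -> coef v 0 = 0 -> coef v 2 = 0 ->
  (bit (coef v 1))%:R * omega m + omega (dec p predT (coef v 0) 0 (coef v 2) (ycoef v))
    + eps (dec p predT (coef v 0) 0 (coef v 2) (ycoef v)) * eps m = 0.
Proof.
move=> rows v0 v2; rewrite v0 v2 eps_dec omega_dec eps_m omega_m -bitE !add0r.
pose a i j := add_legendre (p j) (p i).
pose e i : 'F_2 := add_legendre (-1) (p i).
pose y := ycoef v.
have ee i : e i * e i = e i by case: (F2_cases (e i)) => ->; apply: val_inj.
have recip i j : j != i -> a i j + a j i = e i * e j.
  move=> ji; rewrite /a quadratic_reciprocity // /e ?add_legendreN1 //; first exact: mulrC.
  by move/p_inj/eqP; rewrite (negPf ji).
(* Exchanging indices pairs [a i j] with [a j i], and reciprocity turns their sum into [e i * e j].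
   Completing the sum over [j] adds the diagonal term [e i * e i = e i], hence the last summand. *)
have sumA : \sum_i \sum_j A_ p i j * y j =
    (\sum_i e i * y i) * (\sum_i e i) + \sum_i e i * y i.
  under eq_bigr do rewrite A_sum.
  rewrite big_split /=.
  have -> : \sum_i \sum_(j | j != i) y j * a i j = \sum_i \sum_(j | j != i) y i * a j i.
    rewrite (exchange_big_dep predT) //=; apply: eq_bigr => j _.
    by apply: eq_bigl => i; rewrite eq_sym.
  rewrite -big_split /= mulr_suml -big_split /=; apply: eq_bigr => i _.
  rewrite -mulr_sumr -mulrDr -big_split /=.
  under eq_bigr => j ji do rewrite addrC (recip i j ji).
  rewrite -mulr_sumr [\sum_j e j](bigD1 i) //=.
  set s := \sum_(j | _) _.
  have -> : e i * y i * (e i + s) + e i * y i = y i * (e i * s) + y i * (e i * e i + e i).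
    by ring.
  by rewrite ee F2_addxx mulr0 addr0.
have : \sum_i (add_legendre 2 (p i) * coef v 1
      + (\sum_j A_ p i j * y j + add_legendre 2 (p i) * y i)) = 0.
  rewrite big1 // => i _; have [_] := rows i; rewrite v0 v2 !mulr0 add0r addr0.
  by [].
rewrite !big_split /= sumA -mulr_suml => E.
by rewrite -[RHS]E /add_jacobi; ring.
Qed.

Lemma kernel_solvable (R : realType) v : B2 p *m v = 0 <->
  torsorZ R n (dec1 p v) (dec2 p v) (dec1 p v * dec2 p v) /\
  forall q (q_pr : prime q), torsorZ (padic q_pr) n (dec1 p v) (dec2 p v) (dec1 p v * dec2 p v).
Proof.
have m2 : ~~ (2 %| m)%Z by rewrite m_dec odd_dec.
rewrite B2_kernel (solvable_real p_prime); split.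
  move=> [[r0 r1 r2 r3 r4] rows]; split=> // q q_pr.
  have [q2|/eqP q2] := eqVneq q 2%N.
    subst q; apply/torsorZ_at_2/place2_suff; rewrite ?odd_dec //.
      by apply/two_condP/global_rows2.
    exact/two_cond3P/product_formula.
  have [q3|/eqP q3] := eqVneq q 3%N.
    by subst q; apply/solvable_at_3.
  have [/existsP[i /eqP qi]|qp] := boolP [exists i, q == p i].
    (* The field depends on the primality proof, which must be identified with the given one. *)
    subst q; rewrite (bool_irrelevance q_pr (p_prime i)).
    exact/solvable_at_p.
  apply: solvable_good => // i qi; case/negP: qp; apply/existsP; exists i; exact/eqP.
move=> [r0 loc]; split; last by move=> i; apply/(solvable_at_p p_prime) => //.
have /(solvable_at_3 p_prime p_neq2 p_neq3)[r4 r3] := loc 3%N isT.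
have [] := iffLR (global_rows2 v); last by move=> r1 r2; split.
apply/two_condP.
by apply: (place2_nec _ _ m2 (iffLR (torsorZ_at_2 _ v) (loc 2%N isT))); exact: odd_dec.
Qed.
End Solvability.

(** * Square classes of rationals *)

Definition odd_val (q : nat) (a : int) : bool := odd (logn q `|a|%N).

Lemma odd_valM q a b : a != 0 -> b != 0 -> odd_val q (a * b) = odd_val q a (+) odd_val q b.
Proof. by move=> a0 b0; rewrite /odd_val abszM lognM ?absz_gt0 // oddD. Qed.

Lemma odd_val_sqr q a : odd_val q (a ^+ 2) = false.
Proof. by rewrite /odd_val abszX lognX oddM. Qed.

Lemma odd_val_pow q (x : bool) c : prime q -> ~~ (q%:Z %| c)%Z -> odd_val q (q%:Z ^+ x * c) = x.
Proof.
move=> q_pr qc; have c0 := ndvdz_neq0 qc; have q0 := prime_gt0 q_pr.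
have qZ : q%:Z ^+ x != 0 by rewrite expf_neq0 // eqz_nat -lt0n.
rewrite odd_valM // /odd_val abszX lognX /= logn_prime // eqxx muln1.
by rewrite (@logn_coprime q `|c|) ?addbF ?oddb // prime_coprime // -dvdzE.
Qed.

Lemma square_of_even_logn (k : nat) : (0 < k)%N ->
  (forall q, prime q -> ~~ odd (logn q k)) -> exists r, k = (r ^ 2)%N.
Proof.
move=> k0 ev; exists (\prod_(q <- primes k) q ^ (logn q k)./2)%N.
rewrite {1}(prod_prime_decomp k0) prime_decompE big_map -[RHS]mulnn -big_split /=.
rewrite big_seq [RHS]big_seq; apply: eq_bigr => q; rewrite mem_primes => /andP[q_pr _].
by rewrite -expnD addnn halfK (negbTE (ev q q_pr)) subn0.
Qed.

Lemma rat_square_parity (a b : int) (s : rat) : a != 0 -> b != 0 ->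
  a%:~R = b%:~R * s ^+ 2 ->
  (forall q, odd_val q a = odd_val q b) /\ (a < 0) = (b < 0).
Proof.
move=> a0 b0 ab; have d0 := denq_neq0 s.
have E : a * denq s ^+ 2 = b * numq s ^+ 2.
  have N : (numq s)%:~R = s * (denq s)%:~R :> rat by rewrite numqE.
  by apply: (@intr_inj rat); rewrite !expr2 !intrM /= ab N; ring.
have n0 : numq s != 0.
  by apply: contra_eq_neq E => ->; rewrite expr0n mulr0 mulf_neq0 ?expf_neq0.
split=> [q|].
  have := congr1 (odd_val q) E.
  by rewrite (odd_valM q a0 (expf_neq0 2 d0)) (odd_valM q b0 (expf_neq0 2 n0))
             !odd_val_sqr !addbF.
have dd : 0 < denq s ^+ 2 by rewrite exprn_even_gt0.
have nn : 0 < numq s ^+ 2 by rewrite exprn_even_gt0.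
by rewrite -(pmulr_llt0 a dd) E pmulr_llt0.
Qed.

Lemma rat_square_of_parity (a b : int) : a != 0 -> b != 0 ->
  (forall q, prime q -> odd_val q a = odd_val q b) -> (a < 0) = (b < 0) ->
  exists2 s : rat, s != 0 & a%:~R = b%:~R * s ^+ 2.
Proof.
move=> a0 b0 ab sab.
have ab_gt0 : (0 < `|(a * b)%R|)%N by rewrite absz_gt0 mulf_neq0.
have ev q : prime q -> ~~ odd (logn q `|(a * b)%R|).
  by move=> q_pr; rewrite -/(odd_val q (a * b)) odd_valM // ab // addbb.
have [r rE] := square_of_even_logn ab_gt0 ev.
have abr : a * b = r%:Z ^+ 2.
  have ab0 : 0 <= a * b by move: sab; case: (ltP a 0) => ha; case: (ltP b 0) => // hb _; nia.
  by rewrite -[LHS]gez0_abs // rE -mulnn PoszM.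
have b0' : (b%:~R : rat) != 0 by rewrite intr_eq0.
have r0 : (r%:Z%:~R : rat) != 0.
  rewrite intr_eq0; apply: contra_eq_neq abr => ->.
  by rewrite expr0n mulf_neq0.
exists (r%:Z%:~R / b%:~R); first by rewrite mulf_neq0 ?invr_eq0.
have E : (r%:Z%:~R : rat) ^+ 2 = a%:~R * b%:~R by rewrite -intrM abr rmorphXn.
by rewrite expr_div_n E; field.
Qed.

Lemma square_classP (a b : rat) : (exists2 s : rat, s != 0 & b = a * s ^+ 2) ->
  square_class a = square_class b.
Proof.
case=> s s0 ->; apply/seteqP; split=> c [r r0 ->] /=.
  by exists (r / s); [rewrite mulf_neq0 ?invr_eq0|field].
by exists (s * r); [rewrite mulf_neq0|ring].
Qed.

Lemma square_class_eq (a b : rat) : square_class a = square_class b ->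
  exists2 s : rat, s != 0 & b = a * s ^+ 2.
Proof.
move=> ab; have : square_class b b by exists 1; rewrite ?oner_neq0 // expr1n mulr1.
by rewrite -ab.
Qed.

Lemma rat_integer_class (b : rat) : b != 0 ->
  exists2 m : int, m != 0 & exists2 s : rat, s != 0 & b = m%:~R * s ^+ 2.
Proof.
move=> b0; exists (numq b * denq b); first by rewrite mulf_neq0 ?numq_eq0 ?denq_eq0.
have d0 : ((denq b)%:~R : rat) != 0 by rewrite intr_eq0 denq_eq0.
exists (denq b)%:~R^-1; first by rewrite invr_eq0.
by rewrite intrM numqE; field.
Qed.

Lemma real_char0 (R : realType) (a : int) : a != 0 -> a%:~R != 0 :> R.
Proof. by rewrite intr_eq0. Qed.

Lemma prime_valuation q (a : int) : prime q -> a != 0 ->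
  exists k c, ~~ (q%:Z %| c)%Z /\ a = q%:Z ^+ k * c.
Proof.
move=> q_pr a0; have a_gt0 : (0 < `|a|)%N by rewrite absz_gt0.
have [c cq aE] := pfactor_coprime q_pr a_gt0.
exists (logn q `|a|), (Num.sg a * c%:Z); split.
  by rewrite dvdzE abszM absz_sg a0 mul1n -prime_coprime.
rewrite mulrCA [RHS]mulrC (_ : q%:Z ^+ _ * c%:Z = `|a|%N%:Z).
  by rewrite abszE mulrC -numEsg.
rewrite {2}aE PoszM mulrC; congr (_ * _).
by elim: (logn _ _) => // k IH; rewrite exprS expnS PoszM IH.
Qed.

Lemma square_in_power (K : fieldType) q k (c : int) :
  square_in K (q%:Z ^+ k * c * (q%:Z ^+ odd k * c)).
Proof.
(* The exponents [k] and [odd k] add up to twice [uphalf k]. *)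
rewrite (_ : _ * _ = (q%:Z ^+ uphalf k * c) ^+ 2); first exact: square_in_sqr.
rewrite mulrACA -expr2 -exprD exprMn -exprM; congr (_ ^+ _ * _).
by rewrite uphalf_half; have := odd_double_half k; lia.
Qed.

Lemma unramified_parity q (q_pr : prime q) (d m1 m2 : int) :
  q <> 2%N -> q <> 3%N -> ~~ (q%:Z %| d)%Z -> m1 != 0 -> m2 != 0 ->
  torsorZ (padic q_pr) d m1 m2 (m1 * m2) -> odd_val q m1 = false /\ odd_val q m2 = false.
Proof.
move=> q2 q3 qd m10 m20.
have [k1 [c1 [qc1 ->]]] := prime_valuation q_pr m10.
have [k2 [c2 [qc2 ->]]] := prime_valuation q_pr m20.
have c10 := ndvdz_neq0 qc1; have c20 := ndvdz_neq0 qc2; have d0 := ndvdz_neq0 qd.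
have q0 : q%:Z != 0 by rewrite eqz_nat -lt0n prime_gt0.
have K0 := padic_char0 q_pr.
have par k c : ~~ (q%:Z %| c)%Z -> odd_val q (q%:Z ^+ k * c) = odd k.
  move=> qc; have c0 := ndvdz_neq0 qc.
  rewrite -(odd_val_pow (odd k) q_pr qc) odd_valM ?expf_neq0 // odd_valM ?expf_neq0 //.
  congr (_ (+) _); rewrite /odd_val !abszX !lognX !oddM.
  by rewrite oddb.
move=> T; rewrite !par //; apply: (unramified_place q2 q3 qc1 qc2 qd (p_pr := q_pr)).
apply/(torsorZ_xor (odd k1) (odd k2) K0 q0 d0 c10 c20).
apply: (iffLR _ T); apply: torsorZ_square; rewrite ?mulf_neq0 ?expf_neq0 //.
- by rewrite -expr2; exact: square_in_sqr.
- exact: square_in_power.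
- exact: square_in_power.
rewrite mulrACA; apply: square_inM; exact: square_in_power.
Qed.

(** * The encoding is a bijection onto the Selmer group *)

Section Bijection.
Variables (t : nat) (p : 'I_t -> nat).
Hypotheses (p_prime : forall i, prime (p i)) (p_neq2 : forall i, p i <> 2%N)
    (p_neq3 : forall i, p i <> 3%N) (p_inj : injective p).
Implicit Type v : 'cV['F_2]_(6 + (t + t)).

Lemma dec_odd_val2 e0 e1 e2 x : odd_val 2 (dec p predT e0 e1 e2 x) = bit e1.
Proof.
by rewrite dec_split2 odd_val_pow //; exact: (odd_dec p_prime p_neq2).
Qed.

Lemma dec_odd_val3 e0 e1 e2 x : odd_val 3 (dec p predT e0 e1 e2 x) = bit e2.
Proof.
rewrite dec_split3 odd_val_pow //; apply: (dec_ndvdz p_prime) => // i _; exact: nesym.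
Qed.

Lemma dec_odd_valp i e0 e1 e2 x : odd_val (p i) (dec p predT e0 e1 e2 x) = bit (x i).
Proof.
rewrite (dec_splitp p i) odd_val_pow //; apply: (dec_ndvdz p_prime) => // j ji.
by move/p_inj/esym/eqP; rewrite (negPf ji).
Qed.

Lemma dec_odd_val_other q e0 e1 e2 x : prime q -> q <> 2%N -> q <> 3%N ->
  (forall i, q <> p i) -> odd_val q (dec p predT e0 e1 e2 x) = false.
Proof.
move=> q_pr q2 q3 qp.
have qd : ~~ (q%:Z %| dec p predT e0 e1 e2 x)%Z by exact: (dec_ndvdz p_prime).
by have := odd_val_pow false q_pr qd; rewrite expr0 mul1r.
Qed.

(** The sign and the parities of the valuations are invariants of a square class, and they return
    the exponents. *)
Lemma dec_inj e0 e1 e2 x e0' e1' e2' x' :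
  square_class (dec p predT e0 e1 e2 x)%:~R = square_class (dec p predT e0' e1' e2' x')%:~R ->
  [/\ e0 = e0', e1 = e1', e2 = e2' & x =1 x'].
Proof.
move=> /esym/square_class_eq[s _ /rat_square_parity[]]; rewrite ?(dec_neq0 p_prime) // => ov lt.
split=> [|||i]; apply: bit_inj.
- by rewrite -(dec_lt0 p_prime predT e0 e1 e2 x) -(dec_lt0 p_prime predT e0' e1' e2' x') lt.
- by have := ov 2%N; rewrite !dec_odd_val2.
- by have := ov 3%N; rewrite !dec_odd_val3.
- by have := ov (p i); rewrite !dec_odd_valp.
Qed.

Lemma dec_surj (a : int) : a != 0 ->
  (forall q, prime q -> q <> 2%N -> q <> 3%N -> (forall i, q <> p i) -> odd_val q a = false) ->
  exists2 s : rat, s != 0 & a%:~R = (dec p predT (a < 0)%R%:R (odd_val 2 a)%:R (odd_val 3 a)%:R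
    (fun i => (odd_val (p i) a)%:R))%:~R * s ^+ 2.
Proof.
have bitb (b : bool) : bit b%:R = b by case: b.
move=> a0 other; apply: rat_square_of_parity; rewrite ?(dec_neq0 p_prime) //; last first.
  by rewrite (dec_lt0 p_prime) bitb.
move=> q q_pr.
have [->|/eqP q2] := eqVneq q 2%N; first by rewrite dec_odd_val2 bitb.
have [->|/eqP q3] := eqVneq q 3%N; first by rewrite dec_odd_val3 bitb.
have [/existsP[i /eqP ->]|qp] := boolP [exists i, q == p i].
  by rewrite dec_odd_valp bitb.
have qp' i : q <> p i by move=> qi; case/negP: qp; apply/existsP; exists i; apply/eqP.
by rewrite other // dec_odd_val_other.
Qed.

Lemma coef_ext v v' : (forall k, (k < 6)%N -> coef v k = coef v' k) ->
  ycoef v =1 ycoef v' -> xcoef v =1 xcoef v' -> v = v'.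
Proof.
move=> c y x; rewrite -(vsubmxK v) -(vsubmxK v') -(vsubmxK (dsubmx v)) -(vsubmxK (dsubmx v')).
congr (col_mx _ (col_mx _ _)); apply/matrixP => i j; rewrite ord1.
- by have := c i (ltn_ord i); rewrite /coef inord_val.
- exact: y.
- exact: x.
Qed.

Lemma decode_inj v v' : Defs.decode p v = Defs.decode p v' -> v = v'.
Proof.
case; rewrite !decode1E !decode2E => /dec_inj[e3 e4 e5 ex] /dec_inj[e0 e1 e2 ey].
by apply: coef_ext => // -[|[|[|[|[|[|]]]]]].
Qed.

Lemma encode_exists (e : nat -> 'F_2) (y x : 'I_t -> 'F_2) :
  exists v, [/\ forall k, (k < 6)%N -> coef v k = e k, ycoef v =1 y & xcoef v =1 x].
Proof.
exists (col_mx (\col_(k < 6) e k) (col_mx (\col_i y i) (\col_i x i))).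
rewrite /coef /ycoef /xcoef; split=> [k k6|i|i]; rewrite ?col_mxKd ?col_mxKu mxE //.
by rewrite inordK.
Qed.

Local Notation n := (- 2 * radical p).

(** A Selmer class comes with unspecified rational representatives; solubility is carried from them
    to the decoded integers, which differ by rational squares. *)
Lemma decode_selmer (R : realType) v : selmer2_E R n (Defs.decode p v) <-> B2 p *m v = 0.
Proof.
rewrite (kernel_solvable p_prime p_neq2 p_neq3 p_inj R).
have KR := @real_char0 R.
have d1 : ((dec1 p v)%:~R : rat) != 0 by rewrite intr_eq0 (dec_neq0 p_prime).
have d2 : ((dec2 p v)%:~R : rat) != 0 by rewrite intr_eq0 (dec_neq0 p_prime).
split=> [[b1 [b2 [b10 b20 cE TR Tp]]]|[TR Tp]].
  case: cE; rewrite decode1E decode2E => /square_class_eq[s1 s10 e1].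
  move=> /square_class_eq[s2 s20 e2].
  split; first by apply/(torsor_has_pointZ KR n s10 s20 e1 e2).
  move=> q q_pr; apply/(torsor_has_pointZ (@padic_char0 q q_pr) n s10 s20 e1 e2); exact: Tp.
have e1 : (dec1 p v)%:~R = (dec1 p v)%:~R * 1 ^+ 2 :> rat by rewrite expr1n mulr1.
have e2 : (dec2 p v)%:~R = (dec2 p v)%:~R * 1 ^+ 2 :> rat by rewrite expr1n mulr1.
have o : (1 : rat) != 0 := oner_neq0 _.
exists (dec1 p v)%:~R, (dec2 p v)%:~R; split=> //.
- by rewrite /Defs.decode decode1E decode2E.
- by apply/(torsor_has_pointZ KR n o o e1 e2).
move=> q q_pr; apply/(torsor_has_pointZ (@padic_char0 q q_pr) n o o e1 e2); exact: Tp.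
Qed.

(** A Selmer class is unramified outside [6 n], so its sign and its parities at 2, 3 and the [p i]
    determine it; these are the bits of the preimage. *)
Lemma decode_onto (R : realType) c : selmer2_E R n c -> exists v, Defs.decode p v = c.
Proof.
move=> [b1 [b2 [b10 b20 -> TR Tp]]].
have [m1 m10 [s1 s10 e1]] := rat_integer_class b10.
have [m2 m20 [s2 s20 e2]] := rat_integer_class b20.
have other q : prime q -> q <> 2%N -> q <> 3%N -> (forall i, q <> p i) ->
    odd_val q m1 = false /\ odd_val q m2 = false.
  move=> q_pr q2 q3 qp.
  have := iffLR (torsor_has_pointZ (@padic_char0 q q_pr) n s10 s20 e1 e2) (Tp q q_pr).
  apply: unramified_parity => //.
  rewrite ndvdzM // radical_ndvdz // andbT.
  by rewrite dvdzE /= dvdn_prime2 //; apply/eqP.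
have [r1 r10 f1] := dec_surj m10 (fun q a b c d => proj1 (other q a b c d)).
have [r2 r20 f2] := dec_surj m20 (fun q a b c d => proj2 (other q a b c d)).
pose bits : seq 'F_2 := [:: (m2 < 0)%R%:R; (odd_val 2 m2)%:R; (odd_val 3 m2)%:R;
   (m1 < 0)%R%:R; (odd_val 2 m1)%:R; (odd_val 3 m1)%:R].
have [v [ve vy vx]] := encode_exists (nth 0 bits)
  (fun i => (odd_val (p i) m2)%:R) (fun i => (odd_val (p i) m1)%:R).
exists v; rewrite /Defs.decode decode1E decode2E !ve //=.
have decx (g0 g1 g2 : 'F_2) x x' :
    x =1 x' -> dec p predT g0 g1 g2 x = dec p predT g0 g1 g2 x'.
  by move=> xx; rewrite /dec; congr (_ * _); apply: eq_bigr => i _; rewrite xx.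
rewrite (decx _ _ _ _ _ vy) (decx _ _ _ _ _ vx).
congr (_, _); apply: square_classP.
  by exists (r1 * s1); rewrite ?mulf_neq0 // e1 f1; ring.
by exists (r2 * s2); rewrite ?mulf_neq0 // e2 f2; ring.
Qed.
End Bijection.

Theorem theorem6p17 (R : realType) (t : nat) (p : 'I_t -> nat) (n : int)
    (p_prime : forall i, prime (p i)) (p_neq2 : forall i, p i <> 2%N)
    (p_neq3 : forall i, p i <> 3%N) (p_inj : injective p)
    (n_def : n = - 2 * \prod_(i < t) (p i)%:Z) :
  is_monsky_matrix R n p (B2 p).
Proof.
have sel := decode_selmer p_prime p_neq2 p_neq3 p_inj R.
rewrite n_def; split.
- by move=> v Bv; apply/sel.
- by move=> v v' _ _; apply: decode_inj.
move=> c cS; have [v vc] := decode_onto p_prime p_neq2 p_neq3 p_inj cS.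
by exists v => //; apply/sel; rewrite vc.
Qed.
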